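(* Let $k$ be a complete, non-trivially valued non-Archimedean field and $\mu$ a probability measure with countable support on $\mathrm{SL}(2,k)$ such that the group generated by $\mathrm{supp}(\mu)$ is non-elementary. Let $\Omega_n=\{\omega:\ r_n(\omega)\text{ is hyperbolic}\}$ and let $\mathrm{att}^n,\mathrm{rep}^n:\Omega_n\to\mathbb{P}^1(k)$ send $\omega$ to the attracting, resp. repelling, fixed point of $r_n(\omega)$. Then $\mathsf{P}(\Omega_n)\to1$, and $(\mathrm{att}^n)_*(\mathsf{P}|_{\Omega_n})\to\nu$ and $(\mathrm{rep}^n)_*(\mathsf{P}|_{\Omega_n})\to\check\nu$ weakly on $\mathbb{P}^{1,an}_k$, where $\nu$ (resp. $\check\nu$) is the unique $\mu$-stationary (resp. $\check\mu$-stationary) probability measure. If moreover $\int\log\|\gamma\|\,d\mu(\gamma)<\infty$, then for every $\varepsilon>0$, $$\mathsf{P}\left(\left|\tfrac1n\log|\mathrm{tr}(r_n(\omega))|-\chi(\mu)\right|<\varepsilon\right)\to1.$$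
   Context: $(\Omega,\mathsf{P})=(\mathrm{SL}(2,k)^{\mathbb{N}^*},\mu^{\mathbb{N}^*})$, $r_n(\omega)=\gamma_1\cdots\gamma_n$ for $\omega=(\gamma_i)$. $\check\mu$ is the image of $\mu$ under $\gamma\mapsto\gamma^{-1}$. An element $\gamma$ is hyperbolic if $|\mathrm{tr}\gamma|>1$; it then has an attracting and a repelling fixed point in $\mathbb{P}^1(k)$. Non-elementary: image in $\mathrm{PGL}(2,k)$ contains a hyperbolic element and has no finite orbit on $\mathbb{P}^1(k)$. $\mathbb{P}^{1,an}_k$ is the Berkovich projective line; stationary means $\nu=\int\gamma_*\nu\,d\mu(\gamma)$ (such $\nu$ exists uniquely here). $\|\gamma\|$ is the maximum absolute value of entries, $\chi(\mu)=\lim_n\frac1n\int\log\|\gamma\|\,d\mu^n(\gamma)$ with $\mu^n$ the $n$-th convolution power. *)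

(* Defs.v *)
From HB Require Import structures.
From mathcomp Require Import all_boot all_order all_algebra.
From mathcomp Require Import all_classical all_reals all_analysis.
Set Implicit Arguments. Unset Strict Implicit. Unset Printing Implicit Defensive.
Import Order.TTheory GRing.Theory Num.Theory.
Local Open Scope classical_set_scope.
Local Open Scope ring_scope.

Section Defs.
Variables (R : realType) (k : fieldType) (v : k -> R).

Definition complete_nonarch_abs : Prop :=
  [/\ (forall x, 0 <= v x),
      (forall x, v x = 0 <-> x = 0),
      (forall x y, v (x * y) = v x * v y),
      (forall x y, v (x + y) <= Num.max (v x) (v y)) &
      (exists x, v x <> 0 /\ v x <> 1)] /\
      (forall u : nat -> k,
         (forall e : R, 0 < e -> exists N, forall m n, (N <= m)%N -> (N <= n)%N ->
             v (u m - u n) < e) ->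
         exists l, forall e : R, 0 < e -> exists N, forall n, (N <= n)%N ->
             v (u n - l) < e).

(** ** P^1(k) = k ∪ {∞}, encoded as [option k] ([None] = ∞ = [1:0], [Some z] = [z:1]) *)
Definition P1 := option k.
Definition line (u : 'cV[k]_2) : P1 :=
  if u 1 0 == 0 then None else Some (u 0 0 / u 1 0).
Definition homc (z : P1) : 'cV[k]_2 :=
  match z with None => \col_i (if i == 0 then 1 else 0)
             | Some z => \col_i (if i == 0 then z else 1) end.
Definition mob (g : 'M[k]_2) (z : P1) : P1 := line (g *m homc z).

Definition hyperbolic (g : 'M[k]_2) : Prop := 1 < v (\tr g).

Definition is_att (g : 'M[k]_2) (z : P1) : Prop :=
  exists (l : k) (u : 'cV[k]_2), [/\ u != 0, g *m u = l *: u, 1 < v l & z = line u].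
Definition is_rep (g : 'M[k]_2) (z : P1) : Prop :=
  exists (l : k) (u : 'cV[k]_2), [/\ u != 0, g *m u = l *: u, v l < 1 & z = line u].
Definition att (g : 'M[k]_2) : P1 := xget None (is_att g).
Definition rep (g : 'M[k]_2) : P1 := xget None (is_rep g).

Definition gen_group (S : set 'M[k]_2) : set 'M[k]_2 :=
  \bigcap_(H in [set H : set 'M[k]_2 | [/\ S `<=` H, H 1%:M,
        (forall x y, H x -> H y -> H (x *m y)) & (forall x, H x -> H (invmx x))]]) H.

Definition non_elementary (G : set 'M[k]_2) : Prop :=
  (exists2 g, G g & hyperbolic g) /\
  (forall z : P1, ~ finite_set [set mob g z | g in G]).

Definition mnorm (g : 'M[k]_2) : R :=
  \big[Num.max/0]_(ij : 'I_2 * 'I_2) v (g ij.1 ij.2).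

Definition is_mseminorm (x : {poly k} -> R) : Prop :=
  [/\ (forall c, x c%:P = v c),
      (forall p, 0 <= x p),
      (forall p q, x (p * q) = x p * x q) &
      (forall p q, x (p + q) <= x p + x q)].

(** A^{1,an}: with the weakest topology making all x |-> x(f) continuous *)
Definition Rtop : topologicalType := R^o.
Definition PtwsFun : topologicalType := @prod_topology {poly k} (fun _ => Rtop).
Definition A1an : topologicalType :=
  @set_type PtwsFun [set x | is_mseminorm x].
Definition P1an : topologicalType := one_point_compactification A1an.
Definition P1anB := g_sigma_algebraType (@open P1an).

Definition iota_rel (z : P1) (y : P1an) : Prop :=
  match z with
  | None => y = None
  | Some z => exists t : A1an, y = Some t /\ forall f, set_val t f = v f.[z]
  end.
Definition berk_pt (z : P1) : P1an := xget None (iota_rel z).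

(** action of g = [[a,b],[c,d]] on P^{1,an}:
    |f|_{g x} = |F(aT+b, cT+d)|_x / |cT+d|_x^{deg f}, F the homogenization of f *)
Definition hpull (g : 'M[k]_2) (f : {poly k}) : {poly k} :=
  \sum_(i < size f) f`_i *: (('X * (g 0 0)%:P + (g 0 1)%:P) ^+ i *
                             ('X * (g 1 0)%:P + (g 1 1)%:P) ^+ ((size f).-1 - i)).
Definition act_rel (g : 'M[k]_2) (x y : P1an) : Prop :=
  match x with
  | Some s =>
      let den := set_val s ('X * (g 1 0)%:P + (g 1 1)%:P) in
      if den == 0 then y = None
      else exists t : A1an, y = Some t /\
             forall f, set_val t f = set_val s (hpull g f) / den ^+ (size f).-1
  | None => y = berk_pt (mob g None)
  end.
Definition act (g : 'M[k]_2) (x : P1an) : P1an := xget None (act_rel g x).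

(** ** the random walk, for mu = sum_j p j * delta_{g j} *)
Variables (p : nat -> R) (g : nat -> 'M[k]_2).

Definition weight n (t : n.-tuple nat) : R := \prod_(i < n) p (tnth t i).
Definition rn n (t : n.-tuple nat) : 'M[k]_2 := \prod_(i < n) g (tnth t i).

Definition Prob n (E : set 'M[k]_2) : \bar R :=
  (\esum_(t in [set t : n.-tuple nat | E (rn t)]) (weight t)%:E)%E.

(** integral of f against the push-forward of P|Omega_n by phi o r_n,
    Omega_n = {r_n hyperbolic}: int f^+ - int f^- *)
Definition push_int n (phi : 'M[k]_2 -> P1an) (f : P1an -> R) : \bar R :=
  (\esum_(t in [set t : n.-tuple nat | hyperbolic (rn t)])
      (weight t * Num.max (f (phi (rn t))) 0)%:E -
   \esum_(t in [set t : n.-tuple nat | hyperbolic (rn t)])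
      (weight t * Num.max (- f (phi (rn t))) 0)%:E)%E.

Definition stationary (h : nat -> 'M[k]_2) (nu : probability P1anB R) : Prop :=
  forall A : set P1anB, measurable A ->
    nu A = (\esum_(j in [set: nat]) (p j)%:E * nu (act (h j) @^-1` A))%E.

Definition Elog n : \bar R :=
  (\esum_(t in [set: n.-tuple nat]) (weight t * ln (mnorm (rn t)))%:E)%E.
Definition chi : R := limn (fun n : nat => (fine (Elog n) / n%:R : R^o)).

End Defs.

Arguments stationary [R k] v p h nu.
Arguments push_int [R k] v p g n phi f.

(* Main.v *)
(** Everything is reduced to expectations over words of length [n] in the support of [mu].
    Cayley-Hamilton and Hensel's lemma give a hyperbolic element in the semigroup, and non-elementarity
    then gives many words that move any direction to well separated directions with a large dilation.
    Conditioning on such words shows that no direction carries much mass: the law of [r_n x] and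
    the norm of [r_n] do not concentrate, uniformly in [x] and in [n] large.  Writing [r_n] as a large
    rank one matrix plus a small error, its attracting column and repelling row depend
    essentially on the beginning and on the end of the word, hence are transversal with high
    probability.  This makes [r_n] hyperbolic with [|tr r_n|] comparable to [|r_n|], and
    brings its attracting point close to [r_n xi] for most points [xi] of the Berkovich line, so that
    the law of the attracting point is asymptotic to [int r_n_* nu = nu].  The repelling point is
    the attracting point of the inverse, which is the inverse walk read backwards.
    The trace asymptotics follow from the law of large numbers for [log |r_n|].  For the existence of [nu], words are coded by points of
    [0, 1[ with Lebesgue measure; [r_n x] is Cauchy in probability in the complete space [P^1(k)],
    converges almost surely along a sparse sequence of times, and the law of the limit is stationary. *)

(* The field need not be locally compact, so [P^1(k)] need not be compact, and the Berkovich line,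
   though compact, need not be metrizable. Regularity is therefore not read off from a limit
   measure: every estimate is uniform in the starting point and in the target direction. Let [q] be
   the infimum of the bounds [s] valid for all such data at some scale and all large times.
   Conditioning on [K] words of equal length whose events exclude each other replaces [s] by
   [(1 - c K) s + c], an affine map with fixed point [1 / K]; as [K] is arbitrary, [q = 0]. The
   conditioning takes place at a fixed time, hence the equal lengths, obtained by tracking lengths
   modulo that of a hyperbolic word and padding with its powers. A family that separates fails near
   one repelling direction; a second family, with one more word applied first, covers that case.
   Points of [P^1(k)] and of the Berkovich line are treated together through seminorms on linear
   forms, and convergence on the Berkovich line is tested with ultrafilters and by comparison with
   points of [P^1(k)]. *)
Require Import Defs.
From HB Require Import structures.
From mathcomp Require Import all_boot all_order all_algebra.
From mathcomp Require Import all_classical all_reals all_analysis.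
From mathcomp Require Import ring lra measurable_realfun.
Set Implicit Arguments. Unset Strict Implicit. Unset Printing Implicit Defensive.
Import Order.TTheory GRing.Theory Num.Theory.
Import numFieldNormedType.Exports.
Local Open Scope classical_set_scope.
Local Open Scope ring_scope.

(** * Expectations over random words *)

Lemma esumZl (R : realType) (T : choiceType) (I : set T) (c : R) (a : T -> \bar R) :
  0 <= c -> (forall i, 0 <= a i)%E ->
  (\esum_(i in I) (c%:E * a i) = c%:E * \esum_(i in I) a i)%E.
Proof.
move=> c0 a0; rewrite /esum -ereal_supZl//; last first.
  by apply/set0P; exists (\sum_(x \in set0) a x)%E; exists set0 => //; exact: fsets_set0.
congr ereal_sup; rewrite image_comp; apply: eq_imagel => A _ /=.
by rewrite ge0_mule_fsumr.
Qed.

Section WordExpectation.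
Variables (R : realType) (p : nat -> R).
Hypothesis p_ge0 : forall j, 0 <= p j.
Local Open Scope ereal_scope.

(** Iterated sums rather than one sum over tuples: conditioning on a prefix ([wexp_cat]) is then an
    unfolding, and exchanging sums only asks for nonnegativity. *)
Fixpoint wexp (n : nat) (F : seq nat -> \bar R) : \bar R :=
  if n is m.+1 then \sum_(0 <= j <oo) (p j)%:E * wexp m (fun w => F (j :: w))
  else F [::].

Definition wprob n (A : set (seq nat)) : \bar R := wexp n (fun w => (\1_A w)%:E).

Definition wt (w : seq nat) : R := (\prod_(j <- w) p j)%R.

Lemma wt_ge0 w : (0 <= wt w)%R. Proof. exact: prodr_ge0. Qed.

Lemma wexp_ge0 n F : (forall w, 0 <= F w) -> 0 <= wexp n F.
Proof.
elim: n F => [|n IH] F F0 //=; apply: nneseries_ge0 => j _ _.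
by rewrite mule_ge0 ?lee_fin// IH.
Qed.
Hint Resolve wexp_ge0 : core.

Lemma eq_wexp n F G : (forall w, size w = n -> F w = G w) -> wexp n F = wexp n G.
Proof.
elim: n F G => [|n IH] F G FG /=; first exact: FG.
by apply: eq_eseriesr => j _; rewrite (IH _ (fun w => G (j :: w)))// => w sw; rewrite FG//= sw.
Qed.

Lemma le_wexp n F G : (forall w, 0 <= F w) ->
  (forall w, size w = n -> F w <= G w) -> wexp n F <= wexp n G.
Proof.
elim: n F G => [|n IH] F G F0 FG /=; first exact: FG.
apply: lee_nneseries => j _; first by move=> _; rewrite mule_ge0 ?lee_fin// wexp_ge0.
by rewrite lee_wpmul2l ?lee_fin// IH// => w sw; rewrite FG//= sw.
Qed.

Lemma wexpD n F G : (forall w, 0 <= F w) -> (forall w, 0 <= G w) ->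
  wexp n (fun w => F w + G w) = wexp n F + wexp n G.
Proof.
elim: n F G => [|n IH] F G F0 G0 //=.
rewrite -nneseriesD; [| by move=> j _ _; rewrite mule_ge0 ?lee_fin// wexp_ge0
                      | by move=> j _ _; rewrite mule_ge0 ?lee_fin// wexp_ge0].
by apply: eq_eseriesr => j _; rewrite IH// ge0_muleDr// wexp_ge0.
Qed.

Lemma wexpZl n (c : R) F : (forall w, 0 <= F w) ->
  wexp n (fun w => c%:E * F w) = c%:E * wexp n F.
Proof.
elim: n F => [|n IH] F F0 //=.
rewrite -nneseriesZl; last by move=> j _; rewrite mule_ge0 ?lee_fin// wexp_ge0.
by apply: eq_eseriesr => j _; rewrite IH// muleCA.
Qed.

Lemma wexp_nneseries n (F : nat -> seq nat -> \bar R) :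
  (forall j w, 0 <= F j w) ->
  wexp n (fun w => \sum_(0 <= j <oo) F j w) = \sum_(0 <= j <oo) wexp n (F j).
Proof.
elim: n F => [|n IH] F F0 //=.
rewrite nneseries_interchange; last first.
  by move=> i j; rewrite mule_ge0 ?lee_fin// wexp_ge0.
apply: eq_eseriesr => j _; rewrite IH// nneseriesZl// => i _.
exact: wexp_ge0.
Qed.

Lemma wexp_sum n (I : Type) (r : seq I) (F : I -> seq nat -> \bar R) :
  (forall i w, 0 <= F i w) ->
  wexp n (fun w => \sum_(i <- r) F i w) = \sum_(i <- r) wexp n (F i).
Proof.
move=> F0; elim: r => [|i r IH].
  rewrite big_nil -[RHS](mul0e (wexp n (fun=> 0))) -wexpZl//.
  by apply: eq_wexp => w _; rewrite big_nil mul0e.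
rewrite big_cons -IH -wexpD// => [|w]; last by rewrite sume_ge0.
by apply: eq_wexp => w _; rewrite big_cons.
Qed.

Lemma wexp_cat m n F :
  wexp (m + n) F = wexp m (fun w => wexp n (fun w' => F (w ++ w'))).
Proof. by elim: m F => [|m IH] F //=; apply: eq_eseriesr => j _; rewrite IH. Qed.

Lemma wexp_swap m n (F : seq nat -> seq nat -> \bar R) : (forall w w', 0 <= F w w') ->
  wexp m (fun w => wexp n (F w)) = wexp n (fun w' => wexp m (fun w => F w w')).
Proof.
elim: m F => [|m IH] F F0 //=.
rewrite wexp_nneseries; last by move=> j w; rewrite mule_ge0 ?lee_fin// wexp_ge0.
by apply: eq_eseriesr => j _; rewrite IH// wexpZl// => w; apply: wexp_ge0.
Qed.

(** The letters are independent with a common law. This symmetry is what relates the inverse walk,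
    and hence repelling points, to the walk itself. *)
Lemma wexp_rev n F : (forall w, 0 <= F w) -> wexp n (fun w => F (rev w)) = wexp n F.
Proof.
elim: n F => [|n IH] F F0 //=.
rewrite -[RHS]/(wexp n.+1 F) -addn1 wexp_cat wexp_nneseries; last first.
  by move=> j w; rewrite mule_ge0 ?lee_fin// wexp_ge0.
apply: eq_eseriesr => j _; rewrite wexpZl//; congr (_ * _).
rewrite -[RHS]IH//; apply: eq_wexp => w _.
by rewrite rev_cons cats1.
Qed.

Lemma wexp_esum n F : (forall w, 0 <= F w) ->
  wexp n F = \esum_(t in [set: n.-tuple nat]) ((wt t)%:E * F t).
Proof.
elim: n F => [|n IH] F F0 /=.
  have -> : [set: 0.-tuple nat] = [set [tuple]].
    by apply/seteqP; split=> t _ //=; rewrite tuple0.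
  by rewrite esum_set1 /wt /= big_nil mul1e.
rewrite nneseries_esumT; last by move=> j; rewrite mule_ge0 ?lee_fin ?wexp_ge0.
pose e (k : nat * n.-tuple nat) : n.+1.-tuple nat := [tuple of k.1 :: k.2].
rewrite (@reindex_esum _ _ _ ([set: nat] `*`` fun=> [set: n.-tuple nat]) _ e); last first.
  split.
  - by move=> k _.
  - by move=> [i s] [j t] _ _ [-> /val_inj ->].
  - by move=> t _; exists (thead t, [tuple of behead t]) => //=; rewrite /e /= -tuple_eta.
rewrite -(@esum_esum _ _ _ _ _ (fun i j => (wt (e (i, j)))%:E * F (e (i, j)))); last first.
  by move=> i j _ _; rewrite mule_ge0 ?lee_fin ?wt_ge0.
apply: eq_esum => j _; rewrite IH// -esumZl// => [|t]; last first.
  by rewrite mule_ge0 ?lee_fin ?wt_ge0.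
by apply: eq_esum => t _; rewrite muleA -EFinM /wt big_cons.
Qed.

Lemma wprob_ge0 n A : 0 <= wprob n A.
Proof. by apply: wexp_ge0 => w; rewrite lee_fin. Qed.

Lemma le_wprob n (A B : set (seq nat)) : (forall w, size w = n -> A w -> B w) ->
  wprob n A <= wprob n B.
Proof.
move=> AB; apply: le_wexp => w; first by rewrite lee_fin.
move=> sw; rewrite lee_fin !indicE; have [Aw|nAw] := pselect (A w).
  by rewrite !mem_set//; exact: AB.
by rewrite memNset.
Qed.

Lemma wprobU n (A B : set (seq nat)) : wprob n (A `|` B) <= wprob n A + wprob n B.
Proof.
rewrite -wexpD => [|w|w]; [|by rewrite lee_fin..].
apply: le_wexp => w; first by rewrite lee_fin.
by move=> _; rewrite -EFinD lee_fin !indicE in_setU; do 2 case: (_ \in _) => //=; lra.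
Qed.

Lemma wexp_single n w0 (c : R) : size w0 = n -> (0 <= c)%R ->
  wexp n (fun w => if w == w0 then c%:E else 0) = (wt w0 * c)%:E.
Proof.
move=> /eqP sw c0; rewrite wexp_esum => [|w]; last by case: ifP.
rewrite -[RHS](@esum_set1 _ _ (Tuple sw) (fun t : n.-tuple nat => (wt t * c)%:E)) ?lee_fin ?mulr_ge0 ?wt_ge0//.
rewrite [RHS]esum_mkcond; apply: eq_esum => t _.
have [->|tw] := eqVneq t (Tuple sw).
  by rewrite mem_set//= eqxx EFinM.
rewrite memNset => [|/= tE]; last by rewrite tE eqxx in tw.
by rewrite (_ : (t : seq nat) == w0 = false) ?mule0//; apply: contra_neqF tw => /eqP tE; exact: val_inj.
Qed.

(** Finitely many words carry all of a finite integral but [e]. It gives tightness in [wprob_tail]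
    and truncation in [weak_law_L1]. *)
Lemma wexp_tail n F (e : R) : (forall w, 0 <= F w) -> wexp n F < +oo -> (0 < e)%R ->
  exists A : seq (seq nat), wexp n (fun w => if w \in A then 0 else F w) <= e%:E.
Proof.
move=> F0 Foo e0.
have Ffin : wexp n F \is a fin_num by rewrite ge0_fin_numE// wexp_ge0.
have := Ffin; rewrite {1}wexp_esum// => Efin.
have [_ [A [finA _] <-]] := ub_ereal_sup_adherent e0 Efin.
rewrite -/(esum _ _) -wexp_esum// => HA.
exists [seq val t | t <- finmap.enum_fset (fset_set A)].
set G := (X in wexp n X).
pose H := fun w => if w \in [seq val t | t <- finmap.enum_fset (fset_set A)] then F w else 0.
have G0 w : 0 <= G w by rewrite /G; case: ifP.
have H0 w : 0 <= H w by rewrite /H; case: ifP.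
have FE : wexp n F = wexp n H + wexp n G.
  by rewrite -wexpD//; apply: eq_wexp => w _; rewrite /H /G; case: ifP; rewrite ?adde0 ?add0e.
have HH : wexp n F - e%:E <= wexp n H.
  apply: (le_trans (ltW HA)); rewrite wexp_esum//; apply: esum_ge; exists A => //.
  apply: lee_fsum => // t At; rewrite /H (_ : _ \in _ = true)//.
  by apply/map_f; rewrite in_fset_set// inE.
have Hfin : wexp n H \is a fin_num.
  by rewrite ge0_fin_numE ?wexp_ge0// (le_lt_trans _ Foo)// FE leeDl// wexp_ge0.
move: HH; rewrite FE leeBlDr//.
by rewrite leeD2lE.
Qed.

Section Probability.
Hypothesis p_sum1 : \esum_(j in [set: nat]) (p j)%:E = 1.

Lemma wexp_cst n (c : R) : wexp n (fun=> c%:E) = c%:E.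
Proof.
elim: n => //= n IH; rewrite (eq_eseriesr (fun j _ => congr1 (fun x => (p j)%:E * x) IH)).
under eq_eseriesr => j _ do rewrite muleC.
rewrite nneseriesZl; last by move=> j _; rewrite lee_fin.
by rewrite nneseries_esumT ?p_sum1 ?mule1// => j; rewrite lee_fin.
Qed.

Lemma le_wexp_cst n F (c : R) : (forall w, 0 <= F w) ->
  (forall w, size w = n -> F w <= c%:E) -> wexp n F <= c%:E.
Proof. by move=> F0 Fc; rewrite -(wexp_cst n c) le_wexp. Qed.

Lemma wprob_le1 n A : wprob n A <= 1.
Proof. by apply: le_wexp_cst => w; rewrite ?lee_fin// indicE; case: (_ \in _). Qed.

Lemma wprob_fin n A : wprob n A \is a fin_num.
Proof. by rewrite ge0_fin_numE ?wprob_ge0// (le_lt_trans (wprob_le1 n A))// ltry. Qed.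

Lemma wprobC n A : wprob n A + wprob n (~` A) = 1.
Proof.
rewrite -wexpD => [|w|w]; [|by rewrite lee_fin..].
rewrite -(wexp_cst n 1); apply: eq_wexp => w _.
by rewrite -EFinD !indicE in_setC; case: (_ \in _); rewrite /= ?addr0 ?add0r.
Qed.

(** Given the prefix, the conditional probability is at most [s] on [A] and at most 1 off [A]. *)
Lemma wprob_cat_le m n (E A : set (seq nat)) (s : R) : (0 <= s)%R ->
  (forall w, size w = m -> A w -> wprob n [set w' | E (w ++ w')] <= s%:E) ->
  wprob (m + n) E <= s%:E + wprob m (~` A).
Proof.
move=> s0 HA; rewrite /wprob wexp_cat -(wexp_cst m s) -wexpD => [|w|w]; [|by rewrite lee_fin..].
apply: le_wexp => [w|w sw]; first by apply: wexp_ge0 => w'; rewrite lee_fin.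
have [Aw|nAw] := pselect (A w).
  by rewrite indicE memNset ?adde0//=; exact: HA.
rewrite indicE mem_set//; apply: (le_trans (wprob_le1 n [set w' | E (w ++ w')])).
by rewrite -EFinD lee_fin lerDr.
Qed.

Lemma wprob_tail n (M : seq nat -> R) (e : R) : (0 < e)%R ->
  exists B, wprob n [set w | (B < M w)%R] <= e%:E.
Proof.
move=> e0; have [|||A HA] := @wexp_tail n (fun=> 1) e => //.
  by rewrite -[X in wexp _ X]/(fun=> 1%:E) wexp_cst ltry.
exists (\big[Num.max/0]_(w <- A) M w)%R.
apply: le_trans HA; apply: le_wexp => [w|w _]; first by rewrite lee_fin.
case: ifP => wA; last by rewrite lee_fin indicE; case: (_ \in _).
rewrite indicE memNset//=; apply/negP; rewrite -leNgt.
exact: (@le_bigmax_seq _ _ _ _ _ _ predT).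
Qed.

(* The words [ws i] have total mass at least [c * K] and their sections of [E] share a mass of at most 1,
   so on average each of them carries only [1 / K]. *)
Lemma wprob_step b n K (ws : 'I_K -> seq nat) (E A : set (seq nat)) (s c : R) :
  (0 <= c)%R -> (0 <= s)%R ->
  injective ws -> (forall i, size (ws i) = b) -> (forall i, c <= wt (ws i))%R ->
  (forall i, A (ws i)) ->
  (forall w, A w -> wprob n [set w' | E (w ++ w')] <= s%:E) ->
  (forall i j w', i != j -> E (ws i ++ w') -> E (ws j ++ w') -> False) ->
  wprob (b + n) E <= ((1 - c * K%:R) * s + c)%:E + wprob b (~` A).
Proof.
move=> c0 s0 injw szw wtw Aws HA disj.
pose f w := fine (wprob n [set w' | E (w ++ w')]).
have fE w : (f w)%:E = wprob n [set w' | E (w ++ w')] by rewrite fineK// wprob_fin.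
have f0 w : (0 <= f w)%R by rewrite fine_ge0// wprob_ge0.
have f1 w : (f w <= 1)%R by rewrite -lee_fin fE wprob_le1.
have fs i : (f (ws i) <= s)%R by rewrite -lee_fin fE HA.
(* For a given continuation [w'] at most one of the events holds, so the integrand of the summed
   sections is at most 1. *)
have sumf : (\sum_i f (ws i) <= 1)%R.
  rewrite -lee_fin -sumEFin; under eq_bigr do rewrite fE.
  rewrite /wprob -wexp_sum => [|i w]; last by rewrite lee_fin.
  apply: le_wexp_cst => [w|w' _]; first by rewrite sume_ge0.
  rewrite sumEFin lee_fin.
  have [[i Ei]|nE] := pselect (exists i, E (ws i ++ w')).
    rewrite (bigD1 i)//= big1 ?addr0 => [|j ji]; first by rewrite indicE; case: (_ \in _).
    by rewrite indicE memNset//= => Ej; exact: (disj j i w').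
  by rewrite big1// => i _; rewrite indicE memNset//= => Ei; apply: nE; exists i.
(* The saving [s - f (ws i)] made on each special word is kept on the left, so that only nonnegative
   quantities are integrated. *)
have main : wprob (b + n) E + \sum_i (wt (ws i) * (s - f (ws i)))%:E
    <= s%:E + wprob b (~` A).
  rewrite {1}/wprob wexp_cat.
  under eq_bigr => i _ do rewrite -(@wexp_single b (ws i) (s - f (ws i))) ?subr_ge0//.
  rewrite -wexp_sum => [|i w]; last by case: ifP; rewrite ?lee_fin ?subr_ge0.
  rewrite -(wexp_cst b s) -!wexpD => [|w|w|w|w]; last 4 first.
  - by rewrite lee_fin.
  - by rewrite lee_fin.
  - by apply: wexp_ge0 => w'; rewrite lee_fin.
  - by rewrite sume_ge0// => i _; case: ifP; rewrite ?lee_fin ?subr_ge0.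
  apply: le_wexp => [w|w sw].
    rewrite adde_ge0 ?wexp_ge0 ?sume_ge0// => i _.
    by case: ifP; rewrite ?lee_fin ?subr_ge0.
  rewrite -[X in X + _]/(wprob n [set w' | E (w ++ w')]) -fE.
  have [[i wi]|nw] := pselect (exists i, w = ws i).
    rewrite (bigD1 i)//= wi eqxx big1 => [|j ji]; last by rewrite (inj_eq injw) eq_sym (negbTE ji).
    by rewrite adde0 -EFinD addrC subrK leeDl// lee_fin.
  rewrite big1 ?adde0 => [|i _]; last by case: eqP => // wi; exfalso; apply: nw; exists i.
  rewrite -EFinD lee_fin indicE; have [Aw|nAw] := pselect (A w).
    by rewrite memNset ?addr0 -?lee_fin ?fE//; exact: HA.
  by rewrite mem_set//=; have := f1 w; lra.
move: main; rewrite sumEFin -(fineK (wprob_fin (b + n) E)) -(fineK (wprob_fin b (~` A))).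
rewrite -!EFinD !lee_fin; set P1 := fine _; set P2 := fine _ => main.
have : (\sum_i c * (s - f (ws i)) <= \sum_i wt (ws i) * (s - f (ws i)))%R.
  by apply: ler_sum => i _; rewrite ler_wpM2r// subr_ge0.
rewrite -mulr_sumr sumrB sumr_const card_ord -mulr_natr => H.
have : (c * \sum_i f (ws i) <= c)%R by rewrite ler_piMr.
nra.
Qed.

End Probability.
End WordExpectation.

(** * An abstract non-concentration principle *)

Section Concentration.
Variables (R : realType) (p : nat -> R).
Hypothesis p_ge0 : forall j, 0 <= p j.
Hypothesis p_sum1 : (\esum_(j in [set: nat]) (p j)%:E)%E = 1%E.

(** [Ev i d] is a bad event at scale [d] for the data [i]. Reading a prefix [w] changes the data and
    enlarges the scale by the factor [sc w]. [Ev_sep] offers two families of words, since a single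
    one may fail for some data; with only two, one lower bound on the weights serves every [i]. *)
Variables (I : Type) (Ev : I -> R -> set (seq nat)) (sc : seq nat -> R).
Hypothesis Ev_mono : forall i d d' w, d <= d' -> Ev i d w -> Ev i d' w.
Hypothesis Ev_shift : forall i w, exists i', forall d w', 0 <= d ->
  Ev i d (w ++ w') -> Ev i' (d * sc w) w'.
Hypothesis Ev_sep : forall K, exists2 d0 : R, 0 < d0 &
  exists (b : bool -> nat) (ws : bool -> 'I_K -> seq nat),
  [/\ forall c, injective (ws c), forall c a, size (ws c a) = b c,
      forall c a, 0 < wt p (ws c a) &
      forall i, exists c, forall a a' w', a != a' ->
        Ev i d0 (ws c a ++ w') -> Ev i d0 (ws c a' ++ w') -> False].

Definition uniformly_small (s : R) := exists2 d : R, 0 < d &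
  exists N, forall n i, (N <= n)%N -> (wprob p n (Ev i d) <= s%:E)%E.

(** For each datum one family makes the [K] events exclude each other and [wprob_step] applies;
    prefixes with a large [sc] have mass at most [e]. The constant [c] is chosen before [s], so the
    step can be applied arbitrarily close to the infimum. *)
Lemma uniformly_small_step (K : nat) : exists2 c : R, 0 < c /\ c * K%:R <= 1 &
  forall s e : R, 0 < e -> 0 <= s -> uniformly_small s -> uniformly_small ((1 - c * K%:R) * s + c + e).
Proof.
have [d0 d0_gt0 [b [ws [injw szw wtw sep]]]] := Ev_sep K.
pose c0 := \big[Num.min/1]_(x : bool * 'I_K) wt p (ws x.1 x.2).
have c0_gt0 : 0 < c0 by rewrite /c0; elim/big_ind: _ => //= x y x0 y0; rewrite lt_min x0.
have c0_le f a : c0 <= wt p (ws f a).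
  by rewrite /c0 (bigD1 (f, a))//= ge_min lexx.
(* As [c0 <= 1], dividing by [K + 1] secures [c * K <= 1]. *)
pose c := c0 / K.+1%:R.
have c_gt0 : 0 < c by rewrite divr_gt0// ltr0n.
have c0_le1 : c0 <= 1 by apply: bigmin_le_id.
have c_lec0 : c <= c0 by rewrite ler_pdivrMr ?ltr0n// ler_peMr// ?ler1n// ltW.
exists c; first split => //.
  rewrite /c mulrAC ler_pdivrMr ?ltr0n// mul1r (@le_trans _ _ K%:R)//.
    by rewrite ler_piMl.
  by rewrite ler_nat.
move=> s e e0 s0 [d d_gt0 [N HN]].
have [B1 HB1] := wprob_tail p_ge0 p_sum1 (b true) sc e0.
have [B2 HB2] := wprob_tail p_ge0 p_sum1 (b false) sc e0.
pose B0 := \big[Num.max/1]_(x : bool * 'I_K) sc (ws x.1 x.2).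
pose B := Num.max (Num.max B1 B2) B0.
have B_gt0 : 0 < B.
  by rewrite /B !lt_max; apply/orP; right; apply: (lt_le_trans ltr01); apply: bigmax_ge_id.
(* At scale [d0] the events exclude each other; scale [d / B] becomes at most [d] after a prefix
   with [sc w <= B]. *)
exists (Num.min d0 (d / B)); first by rewrite lt_min d0_gt0 divr_gt0.
(* Whichever family is used, at least [N] letters remain after it. *)
exists (N + (b true + b false))%N => n i nN.
have [f Hf] := sep i.
have bn : (b f <= n)%N by case: (f); apply: leq_trans nN; rewrite ?addnA ?leq_addl// addnAC leq_addl.
rewrite -(subnKC bn).
pose A := [set w | sc w <= B].
apply: (@le_trans _ _ (((1 - c * K%:R) * s + c)%:E + wprob p (b f) (~` A))%E).
  apply: (@wprob_step _ _ p_ge0 p_sum1 _ _ _ (ws f)) => //.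
  - exact: ltW.
  - by move=> a; apply: le_trans (c0_le f a).
  - move=> a; rewrite /A /B /= !le_max; apply/orP; right.
    by rewrite /B0 (bigD1 (f, a))//= le_max lexx.
  - move=> w Aw; have [i' Hi'] := Ev_shift i w.
    apply: (le_trans (le_wprob p_ge0 _)); last first.
      apply: (HN _ i'); rewrite leq_subRL//; apply: leq_trans nN.
      by rewrite addnC leq_add2l; case: (f); rewrite ?leq_addr ?leq_addl.
    move=> w' _ /= /Hi' H; apply: Ev_mono (H _) => /=; last first.
      by rewrite le_min ltW//= divr_ge0// ltW.
    have [scw|scw] := leP (sc w) 0.
      by rewrite (@le_trans _ _ 0)//; [rewrite mulr_ge0_le0// le_min ltW//= divr_ge0// ltW|exact: ltW].
    rewrite (@le_trans _ _ (d / B * sc w))//.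
      by rewrite ler_wpM2r ?(ltW scw)// ge_min lexx orbT.
    by rewrite mulrAC ler_pdivrMr// ler_pM2l.
  - move=> a a' w' aa'.
    have le_d0 : Num.min d0 (d / B) <= d0 by rewrite ge_min lexx.
    by move=> Ea Ea'; apply: (Hf a a' w' aa'); apply: Ev_mono le_d0 _.
rewrite [in leRHS]EFinD leeD2l//.
have le_p (B' : R) : B' <= B -> (wprob p (b f) (~` A) <= wprob p (b f) [set w | (B' < sc w)%R])%E.
  by move=> B'B; apply: le_wprob => // w _ /= /negP; rewrite -ltNge; exact: le_lt_trans B'B.
case: (f) le_p => le_p.
  by apply: le_trans HB1; apply: le_p; rewrite /B !le_max lexx.
by apply: le_trans HB2; apply: le_p; rewrite /B !le_max lexx orbT.
Qed.

(** If the infimum [q] of the uniform bounds were at least [e], one step with [K > 4 / e], started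
    close to [q], would produce a bound below [q]. *)
Lemma concentration (e : R) : 0 < e -> exists2 d : R, 0 < d &
  exists N, forall n i, (N <= n)%N -> (wprob p n (Ev i d) <= e%:E)%E.
Proof.
move=> e0; pose S := [set s : R | 0 <= s /\ uniformly_small s].
have infS : has_inf S.
  split; last by exists 0 => s [].
  exists 1; split=> //; exists 1 => //; exists 0%N => n i _.
  exact: wprob_le1.
have small_lt s : S s -> s <= e -> uniformly_small e.
  move=> [_ [d d0 [N HN]]] se; exists d => //; exists N => n i nN.
  by apply: le_trans (HN n i nN) _; rewrite lee_fin.
have [q_lt|q_ge] := ltP (inf S) e.
  have := inf_adherent (_ : 0 < e - inf S) infS.
  rewrite subr_gt0 => /(_ q_lt) [s Ss]; rewrite addrC subrK => /ltW se.
  exact: small_lt Ss se.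
pose K := (Num.truncn (4 / e)).+1.
have KE : 4 / e < K%:R by apply: Num.Theory.truncnS_gt.
have K_gt0 : 0 < K%:R :> R by rewrite ltr0n.
have [c [c_gt0 cK] step] := uniformly_small_step K.
(* With [X = c K], a step from [s < q + e'] gives at most [q - X q + c + 2 e']. Here
   [c + 2 e' < 3 X e / 4], while [X q >= X e]. *)
pose e' := c * K%:R * e / 4.
have e'_gt0 : 0 < e' by rewrite !mulr_gt0.
have [s [s0 Ss] sq] := inf_adherent e'_gt0 infS.
have /(ge_inf infS.2) : S ((1 - c * K%:R) * s + c + e').
  split; last exact: step.
  by rewrite addr_ge0 ?(ltW e'_gt0)// addr_ge0 ?(ltW c_gt0)// mulr_ge0// subr_ge0.
have KE' : 4 < K%:R * e by rewrite -ltr_pdivrMr.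
set q := inf S in q_ge sq * => Hq.
pose X := c * K%:R.
have e'E : e' = X * e / 4 by [].
have X_ge0 : 0 <= X by apply: mulr_ge0; exact: ltW.
have h1 : 4 * c < X * e by rewrite mulrC -mulrA ltr_pM2l.
have h2 : (1 - X) * s <= (1 - X) * (q + e') by rewrite ler_wpM2l ?subr_ge0// ltW.
have h3 : X * e <= X * q by rewrite ler_wpM2l.
have h4 : 0 <= X * e' by rewrite mulr_ge0// ltW.
rewrite -/X in Hq; exfalso; move: h1 h2 h3 h4 Hq e'E; clearbody X e' q; lra.
Qed.

End Concentration.

(** * Linear algebra in the plane over a valued field *)

Section Plane.
Variables (k : fieldType).
Implicit Types (g h : 'M[k]_2) (x y : k * k).

(** Vectors are pairs, so that identities between them reduce to [ring]. With the norm [vn] defined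
    further on, [v (wed x y) / (vn v x * vn v y)] is the distance between two directions. *)
Definition wed x y : k := x.1 * y.2 - x.2 * y.1.
Definition dot x y : k := x.1 * y.1 + x.2 * y.2.
Definition mv g x : k * k := (g 0 0 * x.1 + g 0 1 * x.2, g 1 0 * x.1 + g 1 1 * x.2).
Definition vm x g : k * k := (x.1 * g 0 0 + x.2 * g 1 0, x.1 * g 0 1 + x.2 * g 1 1).
Definition sv (c : k) x : k * k := (c * x.1, c * x.2).
Definition perp x : k * k := (x.2, - x.1).
Definition nz x := (x.1 != 0) || (x.2 != 0).

Lemma sum_ord2 (V : nmodType) (F : 'I_2 -> V) : \sum_(i < 2) F i = F 0 + F 1.
Proof. by rewrite !big_ord_recl big_ord0 addr0; congr (_ + F _); exact: val_inj. Qed.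

Lemma ord2P (P : 'I_2 -> Prop) : P 0 -> P 1 -> forall i, P i.
Proof.
move=> P0 P1 i; case: i => -[|[|//]] Hi.
- by rewrite (_ : Ordinal Hi = 0)//; exact: val_inj.
- by rewrite (_ : Ordinal Hi = 1)//; exact: val_inj.
Qed.

Lemma mx2P g h : g 0 0 = h 0 0 -> g 0 1 = h 0 1 -> g 1 0 = h 1 0 -> g 1 1 = h 1 1 -> g = h.
Proof. by move=> *; apply/matrixP => i j; move: j; apply: ord2P; move: i; apply: ord2P. Qed.

Lemma mulmx2E g h i j : (g *m h) i j = g i 0 * h 0 j + g i 1 * h 1 j.
Proof. by rewrite mxE sum_ord2. Qed.

Lemma mulr2E g h i j : (g * h) i j = g i 0 * h 0 j + g i 1 * h 1 j.
Proof. exact: mulmx2E. Qed.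

Lemma mxtrace2 g : \tr g = g 0 0 + g 1 1.
Proof. by rewrite /mxtrace sum_ord2. Qed.

Lemma det2 g : \det g = g 0 0 * g 1 1 - g 0 1 * g 1 0.
Proof.
have l0 : lift (0 : 'I_2) (0 : 'I_1) = 1 by exact: val_inj.
have l1 : lift (1 : 'I_2) (0 : 'I_1) = 0 by exact: val_inj.
rewrite (expand_det_row _ 0) sum_ord2 /cofactor !det_mx11 !mxE l0 l1 /=.
by rewrite expr0 expr1 mul1r mulN1r mulrN.
Qed.

Lemma scalar2E (c : k) : ((c%:M : 'M[k]_2) 0 0 = c) * ((c%:M : 'M[k]_2) 0 1 = 0) *
  ((c%:M : 'M[k]_2) 1 0 = 0) * ((c%:M : 'M[k]_2) 1 1 = c).
Proof. by rewrite !mxE /= mulr1n mulr0n. Qed.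

Lemma invmx2E g : \det g = 1 ->
  (invmx g 0 0 = g 1 1) * (invmx g 0 1 = - g 0 1) *
  (invmx g 1 0 = - g 1 0) * (invmx g 1 1 = g 0 0).
Proof.
move=> dg.
pose a : 'M[k]_2 := \matrix_(i, j) (if i == 0 then if j == 0 then g 1 1 else - g 0 1
                        else if j == 0 then - g 1 0 else g 0 0).
have ug : g \in unitmx by rewrite unitmxE dg unitr1.
have ga : g *m a = 1%:M.
  move: dg; rewrite det2 => dg.
  by apply: mx2P; rewrite mulmx2E !mxE /= ?mulr1n ?mulr0n -?dg; ring.
suff -> : invmx g = a by rewrite !mxE.
by rewrite -[LHS]mulmx1 -ga mulKmx.
Qed.

Lemma det_invmx1 g : \det g = 1 -> \det (invmx g) = 1.
Proof. by move=> dg; rewrite det_inv dg invr1. Qed.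

Lemma tr_invmx2 g : \det g = 1 -> \tr (invmx g) = \tr g.
Proof. by move=> dg; rewrite !mxtrace2 !(invmx2E dg) addrC. Qed.

Lemma mvM g h x : mv (g * h) x = mv g (mv h x).
Proof. by rewrite /mv !mulr2E /=; congr pair; ring. Qed.

Lemma mv1 x : mv 1 x = x.
Proof. by case: x => a b; rewrite /mv !scalar2E /=; congr pair; ring. Qed.

Lemma mvV g x : \det g = 1 -> mv (invmx g) (mv g x) = x.
Proof.
case: x => a b dg; rewrite /mv !(invmx2E dg) /=; move: dg; rewrite det2 => dg.
by congr pair; [rewrite -[RHS]mul1r -dg|rewrite -[RHS]mul1r -dg]; ring.
Qed.

Lemma mvZ g c x : mv g (sv c x) = sv c (mv g x).
Proof. by rewrite /mv /sv /=; congr pair; ring. Qed.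

Lemma vmM g h x : vm x (g * h) = vm (vm x g) h.
Proof. by rewrite /vm !mulr2E /=; congr pair; ring. Qed.

Lemma dot_vm x g y : dot (vm x g) y = dot x (mv g y).
Proof. by rewrite /dot /vm /mv /=; ring. Qed.

Lemma wed_mv g x y : wed (mv g x) (mv g y) = \det g * wed x y.
Proof. by rewrite det2 /wed /mv /=; ring. Qed.

(** Matrices of determinant 1 preserve [wed], so identifying forms with vectors by [perp] turns the
    row action into the inverse column action. *)
Lemma perp_vm y g : \det g = 1 -> vm (perp y) g = perp (mv (invmx g) y).
Proof. by move=> dg; rewrite /perp /vm /mv !(invmx2E dg) /=; congr pair; ring. Qed.

Lemma nz_mv g x : \det g = 1 -> nz x -> nz (mv g x).
Proof.
move=> dg nx; apply: contraT; rewrite negb_or !negbK => /andP[/eqP e1 /eqP e2].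
have := mvV x dg; rewrite [X in mv _ X]surjective_pairing e1 e2 /mv /= !mulr0 addr0 => xE.
by move: nx; rewrite -xE /nz /= eqxx.
Qed.

Definition pline x : P1 k := if x.2 == 0 then None else Some (x.1 / x.2).
Definition hom (z : P1 k) : k * k := if z is Some z then (z, 1) else (1, 0).

Lemma nz_hom z : nz (hom z).
Proof. by case: z => [z|]; rewrite /nz /= oner_eq0 ?orbT. Qed.

Lemma homK z : pline (hom z) = z.
Proof. by case: z => [z|]; rewrite /pline /= ?eqxx// oner_eq0 divr1. Qed.

Lemma pline_eqP x y : nz x -> nz y -> (pline x = pline y) <-> wed x y = 0.
Proof.
case: x y => [a b] [c d]; rewrite /nz /pline /wed /=.
case: (eqVneq b 0) => [->|b0] /=; rewrite ?orbF.
  move=> a0; case: (eqVneq d 0) => [->|d0] /=; first by split=> // _; ring.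
  by move=> _; split=> // /eqP; rewrite mul0r subr0 mulf_eq0 (negbTE a0) (negbTE d0).
move=> _; case: (eqVneq d 0) => [->|d0] /=; rewrite ?orbF.
  by move=> c0; split=> // /eqP; rewrite mulr0 sub0r oppr_eq0 mulf_eq0 (negbTE c0) (negbTE b0).
move=> _; split=> [[ab]|/eqP]; last by rewrite subr_eq0 => /eqP e; congr Some; apply/eqP; rewrite eqr_div// e mulrC.
by apply/eqP; rewrite subr_eq0 [b * c]mulrC -eqr_div// ab.
Qed.

Lemma pline_sv c x : c != 0 -> pline (sv c x) = pline x.
Proof.
move=> c0; rewrite /pline /sv /= mulf_eq0 (negbTE c0) /=; case: ifP => // _.
by rewrite -mulf_div divff// mul1r.
Qed.

Lemma hom_pline x : nz x -> exists2 c, c != 0 & hom (pline x) = sv c x.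
Proof.
case: x => a b; rewrite /nz /pline /sv /=; case: (eqVneq b 0) => [->|b0] /=.
  by rewrite orbF => a0; exists a^-1; rewrite ?invr_eq0// mulVf// mulr0.
by move=> _; exists b^-1; rewrite ?invr_eq0// mulVf// mulrC.
Qed.

Definition cpair (u : 'cV[k]_2) : k * k := (u 0 0, u 1 0).
Definition cvec x : 'cV[k]_2 := \col_i (if i == 0 then x.1 else x.2).

Lemma line_cpair u : line u = pline (cpair u). Proof. by []. Qed.

Lemma cpair_homc z : cpair (homc z) = hom z.
Proof. by case: z => [z|]; rewrite /cpair !mxE. Qed.

Lemma cvecK x : cpair (cvec x) = x.
Proof. by case: x => a b; rewrite /cpair !mxE. Qed.

Lemma cpair_mul g u : cpair (g *m u) = mv g (cpair u).
Proof. by rewrite /cpair !mxE !sum_ord2. Qed.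

Lemma cpair_inj : injective cpair.
Proof.
move=> u u' [e0 e1]; apply/matrixP => i j; rewrite (ord1 j).
by move: i; apply: ord2P.
Qed.

Lemma mobE g z : mob g z = pline (mv g (hom z)).
Proof. by rewrite /mob line_cpair cpair_mul cpair_homc. Qed.

Lemma mob_pline g x : \det g = 1 -> nz x -> mob g (pline x) = pline (mv g x).
Proof. by move=> dg nx; rewrite mobE; have [c c0 ->] := hom_pline nx; rewrite mvZ pline_sv. Qed.

Lemma mobM g h z : \det h = 1 -> \det g = 1 -> mob (g * h) z = mob g (mob h z).
Proof. by move=> dh dg; rewrite [mob h z]mobE mob_pline ?nz_mv ?nz_hom// mobE mvM. Qed.

End Plane.

Section Valued.
Variables (R : realType) (k : fieldType) (v : k -> R).
Hypothesis hv : complete_nonarch_abs v.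
Implicit Types (g h : 'M[k]_2) (x y : k * k).

Lemma v_ge0 a : 0 <= v a. Proof. by case: hv => -[]. Qed.
Lemma v_eq0 a : (v a == 0) = (a == 0).
Proof. by case: hv => -[_ H _ _ _] _; apply/eqP/eqP => /H. Qed.
Lemma vM a b : v (a * b) = v a * v b. Proof. by case: hv => -[]. Qed.
Lemma vD a b : v (a + b) <= Num.max (v a) (v b). Proof. by case: hv => -[]. Qed.
Lemma v0 : v 0 = 0. Proof. by apply/eqP; rewrite v_eq0. Qed.
Lemma v_gt0 a : (0 < v a) = (a != 0).
Proof. by rewrite lt0r v_eq0 v_ge0 andbT. Qed.
Lemma v1 : v 1 = 1.
Proof.
have /mulfI : v 1 != 0 by rewrite v_eq0 oner_eq0.
by apply; rewrite -vM !mulr1.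
Qed.
Lemma vN1 : v (-1) = 1.
Proof.
apply/eqP; rewrite -(@pexpr_eq1 _ _ 2) ?v_ge0// expr2 -vM mulrNN mulr1.
by rewrite v1.
Qed.
Lemma vN a : v (- a) = v a. Proof. by rewrite -mulN1r vM vN1 mul1r. Qed.
Lemma vV a : v a^-1 = (v a)^-1.
Proof.
have [->|a0] := eqVneq a 0; first by rewrite invr0 v0 invr0.
have va0 : v a != 0 by rewrite v_eq0.
by apply: (mulfI va0); rewrite -vM !divff// v1.
Qed.
Lemma vX a n : v (a ^+ n) = v a ^+ n.
Proof. by elim: n => [|n IH]; rewrite ?expr0 ?v1// !exprS vM IH. Qed.
Lemma vDle a b m : v a <= m -> v b <= m -> v (a + b) <= m.
Proof. by move=> am bm; apply: le_trans (vD a b) _; rewrite ge_max am. Qed.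
Lemma vBle a b m : v a <= m -> v b <= m -> v (a - b) <= m.
Proof. by move=> am bm; apply: vDle => //; rewrite vN. Qed.
Lemma vDlt a b m : v a < m -> v b < m -> v (a + b) < m.
Proof. by move=> am bm; apply: le_lt_trans (vD a b) _; rewrite gt_max am. Qed.
Lemma vBlt a b m : v a < m -> v b < m -> v (a - b) < m.
Proof. by move=> am bm; apply: vDlt => //; rewrite vN. Qed.
Lemma vD_dom a b : v b < v a -> v (a + b) = v a.
Proof.
move=> ba; apply/eqP; rewrite eq_le vDle ?(ltW ba)//= leNgt.
apply/negP => H; have := vBlt H ba; rewrite addrK ltxx//.
Qed.
Definition vn x : R := Num.max (v x.1) (v x.2).

Lemma vn_ge0 x : 0 <= vn x. Proof. by rewrite le_max v_ge0. Qed.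
Lemma v1_le_vn x : v x.1 <= vn x. Proof. by rewrite le_max lexx. Qed.
Lemma v2_le_vn x : v x.2 <= vn x. Proof. by rewrite le_max lexx orbT. Qed.
Lemma vn_le x m : (vn x <= m) = (v x.1 <= m) && (v x.2 <= m). Proof. exact: ge_max. Qed.
Lemma vn_gt0 x : (0 < vn x) = nz x. Proof. by rewrite lt_max !v_gt0. Qed.
Lemma vn_sv c x : vn (sv c x) = v c * vn x.
Proof. by rewrite /vn /= !vM maxr_pMr// v_ge0. Qed.
Lemma vn_perp x : vn (perp x) = vn x. Proof. by rewrite /vn /= vN maxC. Qed.

Lemma v_wed x y : v (wed x y) <= vn x * vn y.
Proof.
by apply: vBle; rewrite vM ler_pM ?v_ge0 ?v1_le_vn ?v2_le_vn.
Qed.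
Lemma v_dot x y : v (dot x y) <= vn x * vn y.
Proof.
by apply: vDle; rewrite vM ler_pM ?v_ge0 ?v1_le_vn ?v2_le_vn.
Qed.

Lemma mnorm_ge g i j : v (g i j) <= mnorm v g.
Proof. by rewrite /mnorm (bigD1 (i, j))//= le_max lexx. Qed.

Lemma mnorm_ge0 g : 0 <= mnorm v g.
Proof. exact: le_trans (v_ge0 _) (mnorm_ge g 0 0). Qed.

Lemma mnorm_le g m : 0 <= m -> (forall i j, v (g i j) <= m) -> mnorm v g <= m.
Proof. by move=> m0 H; apply: bigmax_le => // -[i j] _; exact: H. Qed.

Lemma mnorm_attained g : exists ij : 'I_2 * 'I_2, v (g ij.1 ij.2) = mnorm v g.
Proof.
rewrite /mnorm; apply: contrapT => /forallNP H.
suff : \big[Num.max/0]_ij v (g ij.1 ij.2) < mnorm v g by rewrite ltxx.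
have nz_g : mnorm v g != 0.
  apply/eqP => g0; apply: (H (0, 0)); apply/eqP; rewrite eq_le -/(mnorm v g) mnorm_ge/=.
  by rewrite g0 v_ge0.
apply: bigmax_lt; first by rewrite lt0r nz_g mnorm_ge0.
by move=> ij _; rewrite lt_neqAle mnorm_ge andbT; apply/eqP; exact: H.
Qed.

Lemma mnormM g h : mnorm v (g * h) <= mnorm v g * mnorm v h.
Proof.
apply: mnorm_le => [|i j]; first by rewrite mulr_ge0 ?mnorm_ge0.
by rewrite mulr2E; apply: vDle; rewrite vM ler_pM ?v_ge0 ?mnorm_ge.
Qed.

Lemma mnorm_ge1 g : \det g = 1 -> 1 <= mnorm v g.
Proof.
move=> dg; rewrite leNgt; apply/negP => lt1.
have : v (\det g) < 1.
  rewrite det2; apply: vBlt; rewrite vM; apply: mulr_ilt1; rewrite ?v_ge0//;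
  exact: le_lt_trans (mnorm_ge _ _ _) lt1.
by rewrite dg v1 ltxx.
Qed.

Lemma mnorm_gt0 g : \det g = 1 -> 0 < mnorm v g.
Proof. by move=> /mnorm_ge1; exact: lt_le_trans. Qed.

Lemma mnormV_le g : \det g = 1 -> mnorm v (invmx g) <= mnorm v g.
Proof.
move=> dg; apply: mnorm_le => [|i j]; first exact: mnorm_ge0.
by move: j; apply: ord2P; move: i; apply: ord2P; rewrite !(invmx2E dg) ?vN mnorm_ge.
Qed.

Lemma mnormV g : \det g = 1 -> mnorm v (invmx g) = mnorm v g.
Proof.
move=> dg; apply/eqP; rewrite eq_le mnormV_le//=.
by rewrite -{1}(invmxK g) mnormV_le// det_invmx1.
Qed.

Lemma vn_mv g x : vn (mv g x) <= mnorm v g * vn x.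
Proof.
rewrite vn_le; apply/andP; split => /=; apply: vDle;
  by rewrite vM ler_pM ?v_ge0 ?mnorm_ge ?v1_le_vn ?v2_le_vn.
Qed.

Lemma vn_vm g x : vn (vm x g) <= vn x * mnorm v g.
Proof.
rewrite vn_le; apply/andP; split => /=; apply: vDle;
  by rewrite vM ler_pM ?v_ge0 ?mnorm_ge ?v1_le_vn ?v2_le_vn.
Qed.

Lemma vn_mv_ge g x : \det g = 1 -> vn x <= mnorm v g * vn (mv g x).
Proof.
move=> dg; rewrite -{1}(mvV x dg) (le_trans (vn_mv _ _))//.
by rewrite mnormV.
Qed.

Definition maxidx g : 'I_2 * 'I_2 := projT1 (cid (mnorm_attained g)).
Definition maxent g : k := g (maxidx g).1 (maxidx g).2.
(* Approximates the attracting direction when [mnorm v g] is large. *)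
Definition attv g : k * k := (g 0 (maxidx g).2 / maxent g, g 1 (maxidx g).2 / maxent g).
(* A linear form that almost vanishes on the repelling direction. *)
Definition repv g : k * k := (g (maxidx g).1 0 / maxent g, g (maxidx g).1 1 / maxent g).
Definition ebas (j : 'I_2) : k * k := if j == 0 then (1, 0) else (0, 1).

Lemma v_maxent g : v (maxent g) = mnorm v g.
Proof. exact: (projT2 (cid (mnorm_attained g))). Qed.

Lemma maxent_neq0 g : \det g = 1 -> maxent g != 0.
Proof. by move=> /mnorm_gt0; rewrite -v_maxent v_gt0. Qed.

Lemma vn_ebas j : vn (ebas j) = 1.
Proof.
by move: j; apply: ord2P; rewrite /vn /= v0 v1; [apply: max_l|apply: max_r]; rewrite ler01.
Qed.

Lemma attvE g : attv g = sv (maxent g)^-1 (mv g (ebas (maxidx g).2)).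
Proof.
rewrite /attv /sv /mv; move: (maxidx g).2; apply: ord2P; congr pair => /=; ring.
Qed.

Lemma repvE g : repv g = sv (maxent g)^-1 (vm (ebas (maxidx g).1) g).
Proof.
rewrite /repv /sv /vm; move: (maxidx g).1; apply: ord2P; congr pair => /=; ring.
Qed.

Lemma vn_col g : vn (mv g (ebas (maxidx g).2)) = mnorm v g.
Proof.
apply/eqP; rewrite eq_le (le_trans (vn_mv _ _)) ?vn_ebas ?mulr1//=.
rewrite -v_maxent /maxent; case: (maxidx g) => i j /=.
by move: j; apply: ord2P; move: i; apply: ord2P;
   rewrite /mv /vn /= ?mulr0 ?mulr1 ?addr0 ?add0r le_max lexx ?orbT.
Qed.

Lemma vn_row g : vn (vm (ebas (maxidx g).1) g) = mnorm v g.
Proof.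
apply/eqP; rewrite eq_le (le_trans (vn_vm _ _)) ?vn_ebas ?mul1r//=.
rewrite -v_maxent /maxent; case: (maxidx g) => i j /=.
by move: j; apply: ord2P; move: i; apply: ord2P;
   rewrite /vm /vn /= ?mul0r ?mul1r ?addr0 ?add0r le_max lexx ?orbT.
Qed.

Lemma vn_attv g : \det g = 1 -> vn (attv g) = 1.
Proof.
move=> dg; rewrite attvE vn_sv vV vn_col v_maxent mulVf// gt_eqF//.
exact: mnorm_gt0.
Qed.

Lemma vn_repv g : \det g = 1 -> vn (repv g) = 1.
Proof.
move=> dg; rewrite repvE vn_sv vV vn_row v_maxent mulVf// gt_eqF//.
exact: mnorm_gt0.
Qed.

(** [attv g] is proportional to a column of [g], so [perp (attv g)] kills that column; on the other
    column it takes the value [det g / maxent g] up to sign. *)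
Lemma attv_perp g : \det g = 1 -> exists (j : 'I_2) (e : k),
  v e = (mnorm v g)^-1 /\ vm (perp (attv g)) g = sv e (ebas j).
Proof.
move=> dg; have m0 := maxent_neq0 dg; rewrite -v_maxent -vV.
exists (if (maxidx g).2 == 0 then 1 else 0).
exists (if (maxidx g).2 == 0 then - (\det g / maxent g) else \det g / maxent g).
split; first by rewrite dg div1r; case: ifP; rewrite ?vN.
have i2 : forall i : 'I_2, i = 0 \/ i = 1 by apply: ord2P; [left|right].
move: m0; rewrite det2 /attv /perp /vm /sv /ebas /maxent.
by case: (i2 (maxidx g).1) => ->; case: (i2 (maxidx g).2) => -> /=;
  move: (g 0 0) (g 0 1) (g 1 0) (g 1 1) => a b c d m0; congr pair; field.
Qed.

(** If the maximal entry has index [(i, j)], then [maxent g * dot (repv g) (attv g)] is the quotient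
    of the [(i, j)] entries of [g ^ 2] and [g]. By Cayley-Hamilton it equals the trace, minus
    [1 / maxent g] when [i = j]. *)
Lemma tr_attv g : \det g = 1 ->
  v (\tr g - maxent g * dot (repv g) (attv g)) <= (mnorm v g)^-1.
Proof.
move=> dg; have m0 := maxent_neq0 dg; rewrite -v_maxent -vV mxtrace2.
have i2 : forall i : 'I_2, i = 0 \/ i = 1 by apply: ord2P; [left|right].
have [zE|e] : (g 0 0 + g 1 1 - maxent g * dot (repv g) (attv g) = 0 \/
  g 0 0 + g 1 1 - maxent g * dot (repv g) (attv g) = \det g / maxent g).
- move: m0; rewrite det2 /attv /repv /dot /maxent /=.
  case: (i2 (maxidx g).1) => ->; case: (i2 (maxidx g).2) => -> /=;
    move: (g 0 0) (g 0 1) (g 1 0) (g 1 1) => a b c d m0.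
  + by right; field.
  + by left; field.
  + by left; field.
  + by right; field.
- by rewrite zE v0 v_ge0.
- by rewrite e dg div1r.
Qed.

(** A matrix of large norm is nearly of rank one: the form [perp (attv g)], pulled back by [g], has
    size [1 / |g|]. *)
Lemma wed_attv g x : \det g = 1 -> v (wed (mv g x) (attv g)) <= vn x / mnorm v g.
Proof.
move=> dg; have [j [e [ve pe]]] := attv_perp dg.
have -> : wed (mv g x) (attv g) = dot (vm (perp (attv g)) g) x.
  by rewrite dot_vm /dot /perp /wed /=; ring.
rewrite pe mulrC (le_trans (v_dot _ _))// vn_sv vn_ebas mulr1 ve.
by rewrite lexx.
Qed.

Lemma wed_repv g x : \det g = 1 -> v (wed (vm x g) (repv g)) <= vn x / mnorm v g.
Proof.
move=> dg; have m0 := maxent_neq0 dg.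
have i2 : forall i : 'I_2, i = 0 \/ i = 1 by apply: ord2P; [left|right].
suff [y [ye ->]] : exists y, vn y <= vn x /\ wed (vm x g) (repv g) = y.1 / maxent g.
  by rewrite vM vV v_maxent ler_wpM2r ?invr_ge0 ?mnorm_ge0// (le_trans (v1_le_vn _)).
have [xE|xE] : wed (vm x g) (repv g) =
      (if (maxidx g).1 == 0 then x.2 else x.1) * \det g / maxent g \/
    wed (vm x g) (repv g) = - (if (maxidx g).1 == 0 then x.2 else x.1) * \det g / maxent g.
- move: m0; rewrite det2 /repv /wed /vm /maxent /=.
  case: (i2 (maxidx g).1) => ->; case: (i2 (maxidx g).2) => -> /=;
    move: (g 0 0) (g 0 1) (g 1 0) (g 1 1) => a b c d m0.
  + by right; field.
  + by right; field.
  + by left; field.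
  + by left; field.
- exists (if (maxidx g).1 == 0 then x.2 else x.1, 0); rewrite xE dg mulr1; split => //.
  by rewrite vn_le /= v0 vn_ge0 andbT; case: ifP; rewrite ?v1_le_vn ?v2_le_vn.
- exists (- (if (maxidx g).1 == 0 then x.2 else x.1), 0); rewrite xE dg mulr1; split => //.
  by rewrite vn_le /= v0 vn_ge0 andbT vN; case: ifP; rewrite ?v1_le_vn ?v2_le_vn.
Qed.

(** Take the entry of [g * h] in the row of the maximal entry of [g] and the column of the maximal
    entry of [h]: its absolute value is exactly the left-hand side. *)
Lemma mnorm_mul_ge g h : \det g = 1 -> \det h = 1 ->
  mnorm v g * mnorm v h * v (dot (repv g) (attv h)) <= mnorm v (g * h).
Proof.
move=> dg dh; rewrite (le_trans _ (mnorm_ge (g * h) (maxidx g).1 (maxidx h).2))//.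
have g0 := maxent_neq0 dg; have h0 := maxent_neq0 dh.
have -> : (g * h) (maxidx g).1 (maxidx h).2 = maxent g * maxent h * dot (repv g) (attv h).
  by rewrite mulr2E /dot /repv /attv /=; field; rewrite h0.
by rewrite !vM !v_maxent.
Qed.

(** A form nearly vanishing at [x] nearly vanishes at any [y] close to [x]: multiply [dot r y] by a
    coordinate of [x] of absolute value 1 and rewrite it through [dot r x] and [wed x y]. *)
Lemma v_dot_wed r x y d : vn r <= 1 -> vn x = 1 -> vn y <= 1 ->
  v (dot r x) < d -> v (wed x y) < d -> v (dot r y) < d.
Proof.
case: r x y => [r1 r2] [x1 x2] [y1 y2]; rewrite !vn_le /= => /andP[r11 r21] x1E /andP[y11 y21] dx wx.
have d0 : 0 < d by apply: le_lt_trans (v_ge0 _) dx.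
have vM_lt a b : v a <= 1 -> v b < d -> v (a * b) < d.
  by move=> a1 bd; rewrite vM (le_lt_trans _ bd)// ler_piMl ?v_ge0.
have : v x1 = 1 \/ v x2 = 1.
  by move: x1E; rewrite /vn /=; case: (leP (v x1) (v x2)) => _ <-; [right|left].
case=> xE; rewrite -[v _]mul1r -xE -vM.
  have -> : x1 * dot (r1, r2) (y1, y2) = y1 * dot (r1, r2) (x1, x2) + r2 * wed (x1, x2) (y1, y2).
    by rewrite /dot /wed /=; ring.
  by apply: vDlt; exact: vM_lt.
have -> : x2 * dot (r1, r2) (y1, y2) = y2 * dot (r1, r2) (x1, x2) - r1 * wed (x1, x2) (y1, y2).
  by rewrite /dot /wed /=; ring.
by apply: vBlt; exact: vM_lt.
Qed.

End Valued.

Lemma expr_small (R : realType) (q e : R) : 0 <= q < 1 -> 0 < e ->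
  exists N, forall n, (N <= n)%N -> q ^+ n < e.
Proof.
move=> /andP[q0 q1] e0.
have /cvgrPdist_lt /(_ e e0)[N _ HN] : q ^+ n @[n --> \oo] --> (0 : R).
  by apply: cvg_expr; rewrite ger0_norm.
exists N => n Nn; have := HN n Nn; rewrite /= sub0r normrN ger0_norm//.
exact: exprn_ge0.
Qed.

(** * Eigenvalues and fixed points of hyperbolic matrices *)

Section Hensel.
Variables (R : realType) (k : fieldType) (v : k -> R).
Hypothesis hv : complete_nonarch_abs v.

(** The map [x -> t - 1 / x] preserves the sphere of radius [v t] and contracts it by [(v t) ^ -2],
    hence at least by [q = (v t)^-1]. Iteration from [t] converges to a fixed point, which is the
    root of large absolute value. *)
Lemma quadratic_root (t : k) : 1 < v t -> exists2 l, l * l = t * l - 1 & v l = v t.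
Proof.
move=> t1; have t_gt0 : 0 < v t by apply: lt_trans t1.
have t0 : t != 0 by rewrite -(v_gt0 hv).
pose x := fix x n := if n is m.+1 then t - (x m)^-1 else t.
have xS n : x n.+1 = t - (x n)^-1 by [].
have vx n : v (x n) = v t.
  elim: n => //= n IH; rewrite vD_dom// vN// vV// IH.
  by rewrite (lt_trans _ t1)// invf_lt1.
have x0 n : x n != 0 by rewrite -(v_gt0 hv) vx.
pose q := (v t)^-1.
have q01 : 0 <= q < 1 by rewrite invr_ge0 v_ge0//= invf_lt1.
have [q0 q1] := andP q01.
have stepx n : v (x n.+1 - x n) <= q ^+ n.
  elim: n => [|n IH].
    by rewrite /= addrC addrA addNr sub0r vN// vV// expr0; exact: ltW.
  have -> : x n.+2 - x n.+1 = (x n.+1 - x n) / (x n.+1 * x n).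
    have -> : x n.+2 - x n.+1 = (x n)^-1 - (x n.+1)^-1.
      by transitivity ((t - (x n.+1)^-1) - (t - (x n)^-1)) => //; ring.
    have := x0 n.+1; have := x0 n; move: (x n.+1) (x n) => a b b0 a0.
    by field; apply/andP.
  rewrite vM// vV// vM// !vx exprSr; apply: ler_pM => //.
  - exact: v_ge0.
  - by rewrite invr_ge0 mulr_ge0// ltW.
  - by rewrite /q lef_pV2 ?posrE ?mulr_gt0// ler_peMl ?(ltW t1)// ltW.
have cauchy N n : (N <= n)%N -> v (x n - x N) <= q ^+ N.
  move=> /subnK <-; elim: (n - N)%N => [|m IH].
    by rewrite add0n subrr v0// exprn_ge0.
  rewrite addSn -(subrK (x (m + N)%N) (x _.+1)) -addrA vDle//.
  apply: le_trans (stepx _) _; rewrite exprD ler_piMl ?exprn_ge0// exprn_ile1//.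
  exact: ltW.
have [l Hl] : exists l, forall e : R, 0 < e -> exists N, forall n, (N <= n)%N -> v (x n - l) < e.
  case: hv => _; apply => e e0; have [N HN] := expr_small q01 e0.
  exists N => m n Nm Nn; rewrite -(subrK (x N) (x m)) -addrA vDlt//.
    exact: le_lt_trans (cauchy _ _ Nm) (HN _ (leqnn _)).
  by rewrite -vN// opprB; exact: le_lt_trans (cauchy _ _ Nn) (HN _ (leqnn _)).
have vl : v l = v t.
  have [N HN] := Hl _ t_gt0; rewrite -(vx N) -(subrK (x N) l) addrC vD_dom//.
  by rewrite vx -vN// opprB HN.
exists l => //; apply/eqP; rewrite -subr_eq0 -(v_eq0 hv); apply/negPn/negP => nz_l.
have : 0 < v (l * l - (t * l - 1)) by rewrite v_gt0// -(v_eq0 hv).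
set d := v _ => d0.
have [N HN] := Hl (d / v t) (divr_gt0 d0 t_gt0).
have hN : v (x N - l) < d / v t by apply: HN.
have hN1 : v (x N.+1 - l) < d / v t by apply: HN; exact: leqnSn.
suff : v (l * l - (t * l - 1)) < d by rewrite ltxx.
(* The value of the polynomial at [l] is a combination of the errors at times [N] and [N + 1], with
   coefficients of absolute value [v t]; this contradicts its being of size [d]. *)
have -> : l * l - (t * l - 1) =
    - (x N.+1 - l) * l + (- (x N - l) * x N.+1 + t * (x N - l)).
  by rewrite xS; have := x0 N; move: (x N) => a a0; field.
have lt_d a b : v a < d / v t -> v b = v t -> v (a * b) < d.
  by move=> ad bt; rewrite vM// bt -ltr_pdivlMr.
apply: vDlt => //; first by apply: lt_d; rewrite ?vN.
apply: vDlt => //; first by apply: lt_d; rewrite ?vN.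
by rewrite mulrC; exact: lt_d.
Qed.

Lemma eigenvector (h : 'M[k]_2) l : \det h = 1 -> l * l = \tr h * l - 1 ->
  exists2 u, nz u & mv h u = sv l u.
Proof.
rewrite det2 mxtrace2 /mv /sv /nz; move: (h 0 0) (h 0 1) (h 1 0) (h 1 1) => a b c d dh hl.
have hl' : (l - a) * (l - d) = b * c.
  have -> : (l - a) * (l - d) = l * l - (a + d) * l + a * d by ring.
  by rewrite hl -dh; ring.
have [b0|b0] := eqVneq b 0; last first.
  exists (b, l - a); rewrite /= ?b0//; congr pair; first by ring.
  by rewrite [c * b]mulrC -hl'; ring.
have [c0|c0] := eqVneq c 0; last first.
  exists (l - d, c); rewrite /= ?c0 ?orbT//; congr pair; last by ring.
  by rewrite -hl'; ring.
move/eqP: hl'; rewrite b0 c0 mul0r mulf_eq0 !subr_eq0 => /orP[/eqP la|/eqP ld].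
  by exists (1, 0); rewrite /= ?oner_eq0// la; congr pair; ring.
by exists (0, 1); rewrite /= ?oner_eq0 ?orbT// ld; congr pair; ring.
Qed.

Lemma hyperbolic_eigen (h : 'M[k]_2) : \det h = 1 -> hyperbolic v h ->
  exists l up um, [/\ 1 < v l, nz up, nz um, mv h up = sv l up & mv h um = sv l^-1 um].
Proof.
move=> dh hyp; have [l lE vl] := quadratic_root hyp.
have l0 : l != 0 by rewrite -(v_gt0 hv) vl (lt_trans _ hyp).
have [up nup hup] := eigenvector dh lE.
have [|um num hum] := @eigenvector h l^-1 dh.
  have -> : \tr h = (l * l + 1) / l by rewrite lE subrK mulfK.
  by field.
by exists l, up, um; rewrite vl.
Qed.

Lemma nz_cpair (u : 'cV[k]_2) : (u != 0) = nz (cpair u).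
Proof.
apply/idP/idP; last by apply: contraTneq => ->; rewrite /nz /cpair !mxE eqxx.
apply: contraNT; rewrite negb_or !negbK => /andP[/eqP /= e0 /eqP /= e1].
by apply/eqP/cpair_inj; rewrite /cpair e0 e1 !mxE.
Qed.

Lemma cpairZ (u : 'cV[k]_2) l : cpair (l *: u) = sv l (cpair u).
Proof. by rewrite /cpair /sv !mxE. Qed.

Lemma is_attP (h : 'M[k]_2) z : is_att v h z <->
  exists l x, [/\ nz x, mv h x = sv l x, 1 < v l & z = pline x].
Proof.
split=> [[l [u [u0 hu l1 zE]]]|[l [x [x0 hx l1 zE]]]].
  by exists l, (cpair u); rewrite -nz_cpair -cpair_mul -cpairZ hu.
exists l, (cvec x); rewrite nz_cpair cvecK; split => //.
  by apply: cpair_inj; rewrite cpair_mul cpairZ cvecK.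
by rewrite line_cpair cvecK.
Qed.

Lemma is_repP (h : 'M[k]_2) z : \det h = 1 -> is_rep v h z <-> is_att v (invmx h) z.
Proof.
move=> dh; have uh : h \in unitmx by rewrite unitmxE dh unitr1.
split=> -[l [u [u0 hu l1 zE]]].
  have l0 : l != 0.
    apply: contraNneq u0 => l0; rewrite -[u](mulKmx uh) hu l0 scale0r.
    by rewrite mulmx0.
  exists l^-1, u; split => //.
    by rewrite -[in LHS](scalerK l0 u) -hu -scalemxAr mulKmx.
  by rewrite vV// invf_gt1// v_gt0.
have l0 : l != 0 by rewrite -(v_gt0 hv) (lt_trans _ l1).
exists l^-1, u; split => //.
  by rewrite -[in LHS](scalerK l0 u) -hu -scalemxAr mulKVmx.
by rewrite vV// invf_lt1// v_gt0.
Qed.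

Lemma repE (h : 'M[k]_2) : \det h = 1 -> rep v h = att v (invmx h).
Proof.
by move=> dh; rewrite /rep /att; congr xget; apply/funext => z; apply/propext; exact: is_repP.
Qed.

(** Apply [wed_attv] to an eigenvector of the attracting point: its eigenvalue has absolute value
    above 1 and only helps. *)
Lemma att_spec (h : 'M[k]_2) : \det h = 1 -> hyperbolic v h ->
  exists x, [/\ nz x, att v h = pline x & v (wed x (attv hv h)) <= vn v x / mnorm v h].
Proof.
move=> dh hyp; have [l [x [um [l1 nx _ hx _]]]] := hyperbolic_eigen dh hyp.
have /(xgetPex (None : P1 k)) : exists z, is_att v h z.
  by exists (pline x); apply/is_attP; exists l, x.
rewrite -/(att v h) => /is_attP[l' [y [ny hy l'1 ->]]]; exists y; split => //.
have := wed_attv hv y dh; rewrite hy.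
have -> : wed (sv l' y) (attv hv h) = l' * wed y (attv hv h) by rewrite /wed /sv /=; ring.
by rewrite vM//; apply: le_trans; rewrite ler_peMl ?v_ge0// ltW.
Qed.

End Hensel.

(** * The semigroup generated by the support *)

Lemma finite_inj_image (T : choiceType) (A : set T) (f : T -> T) :
  finite_set A -> {in A &, injective f} -> f @` A `<=` A -> f @` A = A.
Proof.
move=> /finite_seqP[s ->] finj fA; apply/seteqP; split => //.
have /uniq_min_size : uniq (map f (undup s)).
  rewrite map_inj_in_uniq ?undup_uniq// => x y; rewrite !mem_undup => xs ys.
  by apply: finj; rewrite inE.
move=> /(_ (undup s)); rewrite size_map leqnn => /(_ _ isT)[].
  move=> y /mapP[x]; rewrite !mem_undup => xs ->.
  by have /fA : (f @` [set` s]) (f x) by exists x.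
move=> _ eqs y /= ys; have : y \in map f (undup s) by rewrite eqs mem_undup.
by move=> /mapP[x]; rewrite mem_undup => xs ->; exists x.
Qed.

Section Semigroup.
Variables (R : realType) (k : fieldType) (v : k -> R).
Hypothesis hv : complete_nonarch_abs v.
Variables (p : nat -> R) (g : nat -> 'M[k]_2).
Hypothesis hSL : forall j, \det (g j) = 1.
Hypothesis hne : non_elementary v (gen_group [set g j | j in [set j | 0 < p j]]).

Definition gam (w : seq nat) : 'M[k]_2 := \prod_(j <- w) g j.
Definition posw (w : seq nat) := all (fun j => 0 < p j) w.

Lemma wt_gt0 w : posw w -> 0 < wt p w.
Proof.
rewrite /wt; elim: w => [|j w IH]; rewrite ?big_nil// big_cons /= => /andP[pj /IH].
exact: mulr_gt0.
Qed.

Lemma gam_nil : gam [::] = 1. Proof. by rewrite /gam big_nil. Qed.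
Lemma gam_cons j w : gam (j :: w) = g j * gam w. Proof. by rewrite /gam big_cons. Qed.
Lemma gam_cat w w' : gam (w ++ w') = gam w * gam w'. Proof. by rewrite /gam big_cat. Qed.
Lemma gam_rcons w j : gam (rcons w j) = gam w * g j.
Proof. by rewrite -cats1 gam_cat gam_cons gam_nil mulr1. Qed.
Lemma gam_flatten N w : gam (flatten (nseq N w)) = gam w ^+ N.
Proof. by elim: N => [|N IH]; rewrite ?gam_nil ?expr0// exprS /= gam_cat IH. Qed.
Lemma posw_flatten N w : posw w -> posw (flatten (nseq N w)).
Proof. by move=> pw; elim: N => //= N IH; rewrite /posw all_cat; apply/andP. Qed.
Lemma size_flatten_nseq N (w : seq nat) : size (flatten (nseq N w)) = (N * size w)%N.
Proof. by elim: N => //= N IH; rewrite size_cat IH mulSn. Qed.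

Lemma det_gam w : \det (gam w) = 1.
Proof.
elim: w => [|j w IH]; first by rewrite gam_nil det1.
by rewrite gam_cons det_mulmx hSL IH mul1r.
Qed.

Lemma gen_group_ind (H : set 'M[k]_2) :
  (forall j, 0 < p j -> H (g j)) -> H 1 -> (forall x y, H x -> H y -> H (x * y)) ->
  (forall x, H x -> H (invmx x)) ->
  forall x, gen_group [set g j | j in [set j | 0 < p j]] x -> H x.
Proof. by move=> Hg H1 HM HV x; apply; split => // _ [j pj <-]; exact: Hg. Qed.

Lemma cayley_hamilton2 (h y : 'M[k]_2) : \det h = 1 -> y = \tr h *: (h * y) - h * (h * y).
Proof.
move=> dh; rewrite -[LHS]scale1r -dh det2 mxtrace2.
by apply: mx2P; rewrite !(mxE, sum_ord2); ring.
Qed.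

Lemma invmx_mulK (x y : 'M[k]_2) : \det x = 1 -> invmx x * (x * y) = y.
Proof. by move=> dx; rewrite -[_ * _]/(invmx x *m (x *m y)) mulKmx// unitmxE dx unitr1. Qed.
Lemma mulK_invmx (x y : 'M[k]_2) : \det x = 1 -> x * (invmx x * y) = y.
Proof. by move=> dx; rewrite -[_ * _]/(x *m (invmx x *m y)) mulKVmx// unitmxE dx unitr1. Qed.

(* If all traces on the semigroup have absolute value at most 1, then by Cayley-Hamilton
   ([h^-1 = tr h - h]) so do all traces on the group. *)
Lemma hyperbolic_word : exists2 w, posw w & hyperbolic v (gam w).
Proof.
apply: contrapT => /forall2NP noh.
have trle w : posw w -> v (\tr (gam w)) <= 1.
  by move=> pw; have [//|/negP] := noh w; rewrite -leNgt.
(* [H] is the stabilizer of the set [bd] under left multiplication, hence a group. It remains to put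
   the letters in it and to use that [bd] contains 1. *)
pose bd (y : 'M[k]_2) := forall w, posw w -> v (\tr (gam w * y)) <= 1.
pose H := [set x : 'M[k]_2 | \det x = 1 /\ forall y, bd y <-> bd (x * y)].
have [[h Gh hyp] _] := hne.
have [dh /(_ 1)[+ _]] : H h.
  apply: gen_group_ind Gh.
  - move=> j pj; split => // y; split=> by_ w pw.
      rewrite (mulrA (gam w)) -gam_rcons; apply: by_; rewrite /posw all_rcons pj.
      exact: pw.
    (* Cayley-Hamilton expresses [y] through [h * y] and [h * (h * y)], so the inverse of a letter
       is traded for words in the semigroup and a coefficient [tr h] of absolute value at most 1. *)
    rewrite [y](cayley_hamilton2 y (hSL j)) mulrBr linearB /= -scalerAr mxtraceZ.
    apply: vBle => //.
      rewrite vM// mulr_ile1 ?v_ge0 ?by_//.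
      by have := @trle [:: j]; rewrite gam_cons gam_nil mulr1; apply; rewrite /posw /= pj.
    rewrite (mulrA (gam w)) -gam_rcons; apply: by_; rewrite /posw all_rcons pj.
    exact: pw.
  - by split=> [|y]; rewrite ?det1 ?mul1r.
  - move=> x y [dx Hx] [dy Hy]; split; first by rewrite det_mulmx dx dy mulr1.
    move=> z; rewrite -mulrA; split=> bz; first exact: (iffLR (Hx _) (iffLR (Hy _) bz)).
    exact: (iffRL (Hy _) (iffRL (Hx _) bz)).
  - move=> x [dx Hx]; split; first exact: det_invmx1.
    move=> y; split=> bz; first by apply: (iffRL (Hx _)); rewrite mulK_invmx.
    by rewrite -(mulK_invmx y dx); exact: (iffLR (Hx _)).
move=> bdh; have /bdh/(_ [::] isT) : bd 1 by move=> w pw; rewrite mulr1 trle.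
by rewrite gam_nil mul1r mulr1 leNgt hyp.
Qed.

(** A finite semigroup orbit would be stable under the group and give a finite group orbit. So the
    orbit is infinite, and some residue class of word lengths modulo [a] already contributes
    infinitely many points. The residue is fixed so that lengths can later be equalized by powers of
    a word of length [a]. *)
Lemma orbit_words (e : k * k) (a K : nat) : nz e -> (0 < a)%N ->
  exists (r : nat) (ws : 'I_K -> seq nat),
    [/\ forall i, posw (ws i), forall i, (size (ws i) %% a = r)%N &
        forall i j, i != j -> wed (mv (gam (ws i)) e) (mv (gam (ws j)) e) != 0].
Proof.
move=> ne a0.
pose O r : set (option k) := [set pline (mv (gam w) e) | w in [set w | posw w /\ (size w %% a = r)%N]].
have [r infO] : exists r, infinite_set (O r).
  apply: contrapT => /forallNP finO; have [_ /(_ (pline e))] := hne; apply.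
  pose Orb := \bigcup_(r in `I_a) O r.
  have finOrb : finite_set Orb.
    by apply: bigcup_finite => [|r _]; [exact: finite_II|apply: contrapT; exact: finO].
  have OrbP z : Orb z <-> exists2 w, posw w & z = pline (mv (gam w) e).
    split=> [[r _ [w [pw _] <-]]|[w pw ->]]; first by exists w.
    by exists (size w %% a)%N; [rewrite /= ltn_mod|exists w].
  have mob_inj x : \det x = 1 -> injective (mob x : option k -> option k).
    move=> dx z z' /(congr1 (mob (invmx x))).
    rewrite -!mobM ?det_invmx1//.
    have -> : invmx x * x = 1 by have := invmx_mulK 1 dx; rewrite mulr1.
    by rewrite !mobE !mv1 !homK.
  (* Injective self-maps of a finite set are onto: invariance under the letters upgrades to
     equality, which passes to inverses. *)
  have HG : forall x, gen_group [set g j | j in [set j | 0 < p j]] x ->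
     \det x = 1 /\ (mob x @` Orb = Orb :> set (option k)).
    apply: (@gen_group_ind [set x | \det x = 1 /\ (mob x @` Orb = Orb :> set (option k))]).
    - move=> j pj; split => //; apply: finite_inj_image => //.
        by move=> z z' _ _; exact: mob_inj.
      move=> _ [z /OrbP[w pw ->] <-]; apply/OrbP; exists (j :: w).
        by rewrite /posw /= pj.
      by rewrite mob_pline ?nz_mv ?det_gam// gam_cons mvM.
    - split; first exact: det1.
      rewrite -[RHS]image_id; apply: eq_imagel => z _.
      by rewrite mobE mv1 homK.
    - move=> x y [dx Hx] [dy Hy]; split; first by rewrite det_mulmx dx dy mulr1.
      rewrite -[RHS]Hx -[in RHS]Hy image_comp; apply: eq_imagel => z _.
      by rewrite mobM.
    - move=> x [dx Hx]; split; first exact: det_invmx1.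
      rewrite -[in LHS]Hx image_comp -[RHS]image_id; apply: eq_imagel => z _ /=.
      rewrite -mobM ?det_invmx1//.
      have -> : invmx x * x = 1 by have := invmx_mulK 1 dx; rewrite mulr1.
      by rewrite mobE mv1 homK.
  apply: sub_finite_set finOrb => _ [x Gx <-].
  have [_ <-] := HG x Gx; exists (pline e) => //.
  by apply/OrbP; exists [::] => //; rewrite gam_nil mv1.
have [B BO sB] := infinite_set_fset K infO.
have pick (i : 'I_K) : exists w, [/\ posw w, (size w %% a = r)%N &
    pline (mv (gam w) e) = nth None (finmap.enum_fset B) i].
  have : O r (nth None (finmap.enum_fset B) i).
    by apply: BO => /=; apply: mem_nth; apply: leq_trans sB.
  by move=> [w [pw sw] wE]; exists w.
have [ws Hws] := choice pick.
exists r, ws; split.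
- by move=> i; have [] := Hws i.
- by move=> i; have [] := Hws i.
- move=> i j ij; have [_ _ Hi] := Hws i; have [_ _ Hj] := Hws j.
  apply: contraNneq ij => /(pline_eqP (nz_mv (det_gam _) ne) (nz_mv (det_gam _) ne)).
  rewrite Hi Hj => /eqP; rewrite nth_uniq//; first by exact: leq_trans sB.
    by exact: leq_trans sB.
  exact: finmap.fset_uniq.
Qed.

End Semigroup.

(** * Words of equal length that separate directions and dilate *)

Section SeparatingWords.
Variables (R : realType) (k : fieldType) (v : k -> R).
Hypothesis hv : complete_nonarch_abs v.

Definition padd (x y : k * k) : k * k := (x.1 + y.1, x.2 + y.2).

Lemma vn_padd_le x y m : vn v x <= m -> vn v y <= m -> vn v (padd x y) <= m.
Proof.
rewrite !vn_le /= => /andP[x1 x2] /andP[y1 y2].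
by rewrite !vDle.
Qed.

Lemma vn_padd_dom x y : vn v y < vn v x -> vn v (padd x y) = vn v x.
Proof.
move=> yx; apply/eqP; rewrite eq_le vn_padd_le ?(ltW yx)//= leNgt; apply/negP => lt.
suff : vn v x < vn v x by rewrite ltxx.
move: lt yx; rewrite {1 3 4}/vn !gt_max /= => /andP[a1 a2] /andP[b1 b2].
by rewrite -{1}(addrK y.1 x.1) -{1}(addrK y.2 x.2) !vBlt.
Qed.

Lemma wed0_sv (x y : k * k) : nz x -> wed x y = 0 -> exists c, y = sv c x.
Proof.
case: x y => [x1 x2] [y1 y2]; rewrite /nz /wed /sv /= => /orP[]x0 /eqP; rewrite subr_eq0 => /eqP xy.
  exists (y1 / x1); congr pair; first by field.
  by apply: (mulfI x0); rewrite xy; field.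
exists (y2 / x2); congr pair; last by field.
by apply: (mulfI x0); rewrite -xy; field.
Qed.

Section Hyperbolic.
Variables (h : 'M[k]_2) (l : k) (ep em : k * k).
Hypotheses (dh : \det h = 1) (l1 : 1 < v l) (nep : nz ep) (nem : nz em).
Hypotheses (hep : mv h ep = sv l ep) (hem : mv h em = sv l^-1 em).

Lemma eigen_l0 : l != 0. Proof. by rewrite -(v_gt0 hv) (lt_trans _ l1). Qed.

Lemma eigen_wed : wed ep em != 0.
Proof.
apply/eqP => /(wed0_sv nep)[c emE].
have : sv l em = sv l^-1 em by rewrite -hem emE mvZ hep /sv /=; congr pair; ring.
move=> /(congr1 (vn v)); rewrite !vn_sv//.
have em0 : vn v em != 0 by rewrite gt_eqF// vn_gt0.
move=> /(mulIf em0); rewrite vV// => lV.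
have : (v l)^-1 < v l by rewrite (lt_trans _ l1)// invf_lt1// (lt_trans _ l1).
by rewrite -lV ltxx.
Qed.

Lemma expr_mv N : mv (h ^+ N) ep = sv (l ^+ N) ep /\ mv (h ^+ N) em = sv (l ^- N) em.
Proof.
have l0 := eigen_l0.
elim: N => [|N [IHp IHm]].
  by rewrite expr0 !mv1 invr1 /sv !mul1r -!surjective_pairing.
split; rewrite exprS mvM ?IHp ?IHm mvZ ?hep ?hem /sv /=; congr pair; rewrite ?exprS; field => //;
  by rewrite ?expf_neq0 ?l0.
Qed.

(* Away from the repelling point, [A h^N z] is a large multiple of a small perturbation of [A ep]. *)
Lemma push_direction (A : 'M[k]_2) (d t M : R) : \det A = 1 -> 0 < d -> 0 < t ->
  exists N0, forall N z, (N0 <= N)%N -> nz z -> d * vn v z <= v (wed z em) ->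
    exists s e, [/\ mv (A * h ^+ N) z = sv s (padd (mv A ep) e), vn v e < t & M * vn v z <= v s].
Proof.
move=> dA d0 t0; have D0 := eigen_wed; have l0 := eigen_l0.
have vD0 : 0 < v (wed ep em) by rewrite v_gt0.
(* [C * q ^+ N] bounds the perturbation [e]; [M'] replaces [M] by a positive number, so that one can
   divide by it. *)
pose q := (v l)^-1; pose C := vn v ep * vn v em * mnorm v A / d.
have vl_gt0 : 0 < v l by rewrite v_gt0.
have q01 : 0 <= q < 1 by rewrite invr_ge0 v_ge0//= invf_lt1.
have [q0 q1] := andP q01.
have C0 : 0 < C by rewrite divr_gt0// !mulr_gt0 ?vn_gt0// mnorm_gt0.
pose M' := Num.max M 1.
have M'0 : 0 < M' by rewrite lt_max ltr01 orbT.
have [N1 HN1] := expr_small q01 (divr_gt0 t0 C0).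
have dD0 : 0 < d / v (wed ep em) / M' by rewrite !divr_gt0.
have [N2 HN2] := expr_small q01 dD0.
exists (maxn N1 N2) => N z; rewrite geq_max => /andP[N1N N2N] nz_z zem.
have vz : 0 < vn v z by rewrite vn_gt0.
have vzem : 0 < v (wed z em) by apply: lt_le_trans zem; rewrite mulr_gt0.
have zem0 : wed z em != 0 by rewrite -(v_gt0 hv).
exists (wed z em / wed ep em * l ^+ N).
exists (sv (wed ep z / wed z em * (l ^- N * l ^- N)) (mv A em)); split.
- have [hp hm] := expr_mv N.
  (* Coordinates of [z] in the eigenbasis, by Cramer's rule. *)
  have zE : z = padd (sv (wed z em / wed ep em) ep) (sv (wed ep z / wed ep em) em).
    rewrite [LHS]surjective_pairing /padd /sv; congr pair => /=;
    by apply: (mulfI D0); move: D0; rewrite /wed => D0; field.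
  have mvD (B : 'M[k]_2) x y : mv B (padd x y) = padd (mv B x) (mv B y).
    by rewrite /mv /padd /=; congr pair; ring.
  rewrite mvM {1}zE mvD !mvZ hp hm mvD !mvZ.
  rewrite /padd /sv /=; congr pair; field; rewrite ?expf_neq0 ?l0 ?D0 ?zem0//.
- rewrite vn_sv// (vM hv (_ / _)) (vM hv (wed ep z)) (vM hv (l ^- N)) !(vV hv) (vX hv).
  have le1 : v (wed ep z) / v (wed z em) <= vn v ep / d.
    rewrite ler_pdivrMr// mulrAC ler_pdivlMr// (le_trans _ (ler_wpM2l (vn_ge0 hv _) zem))//.
    by rewrite mulrC mulrCA ler_wpM2l ?(ltW d0)// v_wed.
  have qN : q ^+ N = (v l ^+ N)^-1 by rewrite exprVn.
  have le2 : vn v (mv A em) <= mnorm v A * vn v em by apply: vn_mv.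
  have q2 : (v l ^+ N)^-1 * (v l ^+ N)^-1 <= q ^+ N.
    by rewrite -qN ler_piMl ?exprn_ge0// exprn_ile1// ltW.
  have le3 : vn v ep / d * q ^+ N * (mnorm v A * vn v em) < t.
    have -> : vn v ep / d * q ^+ N * (mnorm v A * vn v em) = q ^+ N * C.
      by rewrite /C; ring.
    by rewrite -ltr_pdivlMr// HN1.
  apply: le_lt_trans le3; apply: ler_pM => //; last 1 first.
  + apply: ler_pM => //; first by rewrite mulr_ge0 ?invr_ge0 ?v_ge0.
    by rewrite mulr_ge0// invr_ge0 exprn_ge0// v_ge0.
  + by rewrite !mulr_ge0 ?invr_ge0 ?exprn_ge0 ?v_ge0.
  + exact: vn_ge0.
- rewrite (vM hv (_ / _)) (vM hv (wed z em)) (vV hv) (vX hv).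
  have qN : q ^+ N = (v l ^+ N)^-1 by rewrite exprVn.
  have lN0 : 0 < v l ^+ N by rewrite exprn_gt0.
  have := HN2 N N2N; rewrite qN ltr_pdivlMr// mulrC ltr_pdivlMr// mulrAC ltr_pdivrMr// => HM.
  rewrite mulrAC ler_pdivlMr//.
  apply: (@le_trans _ _ (d * v l ^+ N * vn v z)).
    rewrite mulrAC ler_wpM2r ?(ltW vz)//; apply: le_trans (ltW HM).
    by rewrite ler_wpM2r ?v_ge0// le_max lexx.
  by rewrite mulrAC ler_wpM2r// ltW.
Qed.

(** By [push_direction] every image is nearly a multiple of [A i ep], so the separation of these
    fixed vectors persists. The constant [s] depends on them only and is chosen before [d] and
    [M]. *)
Lemma family_separated K (A : 'I_K -> 'M[k]_2) : (forall i, \det (A i) = 1) ->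
  (forall i j, i != j -> wed (mv (A i) ep) (mv (A j) ep) != 0) ->
  exists2 s : R, 0 < s & forall d M : R, 0 < d -> exists N0, forall N z,
    (forall i, N0 <= N i)%N -> nz z -> d * vn v z <= v (wed z em) ->
    (forall i, M * vn v z <= vn v (mv (A i * h ^+ N i) z)) /\
    (forall i j, i != j ->
      s * vn v (mv (A i * h ^+ N i) z) * vn v (mv (A j * h ^+ N j) z) <=
      v (wed (mv (A i * h ^+ N i) z) (mv (A j * h ^+ N j) z))).
Proof.
move=> dA Asep; pose f i := mv (A i) ep.
pose F := \big[Num.max/1]_i vn v (f i).
pose c0 := \big[Num.min/1]_i vn v (f i).
pose s0 := \big[Num.min/1]_(x : 'I_K * 'I_K | x.1 != x.2) v (wed (f x.1) (f x.2)).
have F_ge1 : 1 <= F by apply: bigmax_ge_id.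
have F_gt0 : 0 < F by apply: lt_le_trans F_ge1.
have fF i : vn v (f i) <= F by rewrite /F (bigD1 i)//= le_max lexx.
have c0_gt0 : 0 < c0.
  rewrite /c0; elim/big_ind: _ => // [x y x0 y0|i _]; first by rewrite lt_min x0.
  by rewrite vn_gt0// nz_mv.
have c0f i : c0 <= vn v (f i) by rewrite /c0 (bigD1 i)//= ge_min lexx.
have s0_gt0 : 0 < s0.
  rewrite /s0; elim/big_ind: _ => // [x y x0 y0|[i j] /= ij]; first by rewrite lt_min x0.
  by rewrite v_gt0// Asep.
have s0f i j : i != j -> s0 <= v (wed (f i) (f j)).
  by move=> ij; rewrite /s0 (bigD1 (i, j))//= ge_min lexx.
(* A perturbation below [c0] leaves the norm of each [f i] unchanged, and one below [s0 / F] leaves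
   the absolute value of each [wed (f i) (f j)] unchanged. *)
pose t := Num.min c0 (s0 / F).
have t_gt0 : 0 < t by rewrite lt_min c0_gt0 divr_gt0.
have tc0 : t <= c0 by rewrite ge_min lexx.
have tF : t * F <= s0 by rewrite -ler_pdivlMr// ge_min lexx orbT.
exists (s0 / (F * F)); first by rewrite divr_gt0 ?mulr_gt0.
move=> d M d0.
have [N0 HN0] := choice (fun i => push_direction (M / c0) (dA i) d0 t_gt0).
exists (\max_i N0 i) => N z Nge nz_z zem.
have Hi i : exists s e, [/\ mv (A i * h ^+ N i) z = sv s (padd (f i) e),
    vn v e < t & M / c0 * vn v z <= v s].
  by apply: HN0 => //; apply: leq_trans (Nge i); exact: leq_bigmax.
have vnE i e : vn v e < t -> vn v (padd (f i) e) = vn v (f i).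
  by move=> et; apply: vn_padd_dom; apply: lt_le_trans et _; apply: le_trans tc0 (c0f i).
split=> [i|i j ij].
  have [s [e [-> et sM]]] := Hi i; rewrite vn_sv// vnE//.
  apply: (@le_trans _ _ (M / c0 * vn v z * c0)); first by rewrite mulrAC divfK ?gt_eqF.
  apply: (@le_trans _ _ (v s * c0)); first by rewrite ler_wpM2r// ltW.
  by rewrite ler_wpM2l ?v_ge0.
have [s [e [-> et _]]] := Hi i; have [s' [e' [-> et' _]]] := Hi j.
rewrite !vn_sv// !vnE//.
have -> : wed (sv s (padd (f i) e)) (sv s' (padd (f j) e')) =
    s * s' * (wed (f i) (f j) + (wed e (padd (f j) e') + wed (f i) e')).
  by rewrite /wed /sv /padd /=; ring.
rewrite (vM hv (s * s')) (vM hv s) vD_dom//; last first.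
  apply: lt_le_trans (s0f _ _ ij); apply: lt_le_trans tF; apply: vDlt => //.
    apply: le_lt_trans (v_wed hv _ _) _; rewrite vnE//.
    by apply: (le_lt_trans (ler_wpM2l (vn_ge0 hv _) (fF j))); rewrite ltr_pM2r.
  apply: le_lt_trans (v_wed hv _ _) _; rewrite [t * F]mulrC.
  apply: (le_lt_trans (ler_wpM2r (vn_ge0 hv _) (fF i))); rewrite ltr_pM2l//.
have -> : s0 / (F * F) * (v s * vn v (f i)) * (v s' * vn v (f j)) =
   v s * v s' * (s0 * (vn v (f i) / F) * (vn v (f j) / F)).
  by field; rewrite gt_eqF.
rewrite ler_wpM2l ?mulr_ge0 ?v_ge0//; apply: le_trans (s0f _ _ ij).
rewrite -mulrA ler_piMr ?(ltW s0_gt0)// mulr_ile1 ?divr_ge0 ?vn_ge0 ?(ltW F_gt0)//.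
  by rewrite ler_pdivrMr// mul1r.
by rewrite ler_pdivrMr// mul1r.
Qed.

End Hyperbolic.

Variables (p : nat -> R) (g : nat -> 'M[k]_2).
Hypothesis hSL : forall j, \det (g j) = 1.
Hypothesis hne : non_elementary v (gen_group [set g j | j in [set j | 0 < p j]]).
Local Notation gam := (gam g).

(** A vector away from the repelling direction [em] is treated by words [vs i] followed by a power
    of the hyperbolic word; one close to [em] is first moved off by [b0]. The separation [s]
    precedes the dilation [M], because [norm_grows] chooses its dilation in terms of [s]. *)
Lemma separating_words K : exists2 s : R, 0 < s & forall M : R,
  exists (b : bool -> nat) (ws : bool -> 'I_K -> seq nat),
  [/\ forall c i, posw p (ws c i), forall c i, size (ws c i) = b c &
      forall z, nz z -> exists c,
        (forall i, M * vn v z <= vn v (mv (gam (ws c i)) z)) /\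
        (forall i j, i != j ->
          s * vn v (mv (gam (ws c i)) z) * vn v (mv (gam (ws c j)) z) <=
          v (wed (mv (gam (ws c i)) z) (mv (gam (ws c j)) z)))].
Proof.
have [w0 pw0 hyp] := hyperbolic_word hv hSL hne.
pose h := gam w0; have dh : \det h = 1 by apply: det_gam.
have [l [ep [em [l1 nep nem hep hem]]]] := hyperbolic_eigen hv dh hyp.
have a0 : (0 < size w0)%N.
  rewrite lt0n; apply: contraTN hyp => /nilP w0E; rewrite w0E gam_nil mxtrace1 -leNgt.
  by rewrite mulr2n vDle// v1.
have [r [vs [pvs svs sep]]] := orbit_words hSL hne K nep a0.
have [_ [us [pus _ sepu]]] := orbit_words hSL hne 2 nem a0.
(* Two words send [em] to distinct directions, so at least one of them moves it. *)
have [b0 pb0 b0em] : exists2 b0, posw p b0 & wed (mv (gam b0) em) em != 0.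
  have [e0|] := eqVneq (wed (mv (gam (us 0)) em) em) 0; last by exists (us 0).
  have [e1|] := eqVneq (wed (mv (gam (us 1)) em) em) 0; last by exists (us 1).
  exfalso; have /eqP := sepu 0 1 isT; apply.
  apply/(pline_eqP (nz_mv (det_gam hSL _) nem) (nz_mv (det_gam hSL _) nem)).
  move/(pline_eqP (nz_mv (det_gam hSL _) nem) nem): e0 => ->.
  by move/(pline_eqP (nz_mv (det_gam hSL _) nem) nem): e1 => ->.
have D0 := eigen_wed l1 nep nem hep hem.
pose B := gam b0; have dB : \det B = 1 by apply: det_gam.
pose D := v (wed ep em); have D_gt0 : 0 < D by rewrite v_gt0.
pose rho := v (wed (mv B em) em); have rho_gt0 : 0 < rho by rewrite v_gt0.
have B1 := mnorm_ge1 hv dB; have B_gt0 := mnorm_gt0 hv dB.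
have vep : 0 < vn v ep by rewrite vn_gt0.
have vem : 0 < vn v em by rewrite vn_gt0.
(* Three demands when [z] is within [d] of [em]: its [em] component carries the norm, the [B em]
   term dominates in [wed (B z) em], and [B z] ends up at distance at least [d] from [em]. The
   halvings make the first two inequalities strict. *)
pose d := Num.min (D / vn v ep / 2) (Num.min (D * (rho / vn v em) / (mnorm v B * vn v ep * vn v em) / 2)
   (rho / vn v em / mnorm v B)).
have d_gt0 : 0 < d by rewrite !lt_min; apply/and3P; split; rewrite ?(divr_gt0, mulr_gt0).
have [d1 d2 d3] : [/\ d * vn v ep < D, d * (mnorm v B * vn v ep * vn v em) < D * (rho / vn v em) &
    d * mnorm v B <= rho / vn v em].
  have half_lt (x : R) : 0 < x -> x / 2 < x by lra.
  rewrite -!ltr_pdivlMr ?mulr_gt0// -ler_pdivlMr//; split.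
  - apply: (@le_lt_trans _ _ (D / vn v ep / 2)); first by rewrite ge_min lexx.
    by rewrite half_lt// divr_gt0.
  - apply: (@le_lt_trans _ _ (D * (rho / vn v em) / (mnorm v B * vn v ep * vn v em) / 2)).
      by rewrite !ge_min lexx !orbT.
    by rewrite half_lt// ?(divr_gt0, mulr_gt0).
  - by rewrite !ge_min lexx !orbT.
have [s s_gt0 Hs] := family_separated l1 nep nem hep hem (fun i => det_gam hSL (vs i)) sep.
exists s => // M.
(* The factor [mnorm v B] compensates for a possible shortening of [z] by [B]. *)
have [N0 HN0] := Hs d (`|M| * mnorm v B) d_gt0.
pose Q := (\sum_i size (vs i) %/ size w0)%N.
(* The exponents equalize the quotients of the lengths by [size w0]; the remainders are all [r]. *)
pose N i := (N0 + (Q - size (vs i) %/ size w0))%N.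
have NE i : (size (vs i) + N i * size w0 = r + (N0 + Q) * size w0)%N.
  have leQ : (size (vs i) %/ size w0 <= Q)%N by rewrite /Q (bigD1 i)//= leq_addr.
  rewrite {1}(divn_eq (size (vs i)) (size w0)) svs addnAC -mulnDl addnC; congr (_ + _ * _)%N.
  by rewrite /N addnCA subnKC.
(* The last letters act first on a vector, so [b0] sits at the end of the word. *)
pose ws (c : bool) i := vs i ++ flatten (nseq (N i) w0) ++ (if c then b0 else [::]).
exists (fun c => (r + (N0 + Q) * size w0 + size (if c then b0 else [::]))%N), ws; split.
- move=> c i; rewrite /ws /posw !all_cat; apply/and3P; split; [exact: pvs|exact: posw_flatten|].
  by case: c.
- by move=> c i; rewrite /ws !size_cat size_flatten_nseq addnA NE.
move=> z nz_z.
have wsE c i : mv (gam (ws c i)) z = mv (gam (vs i) * h ^+ N i) (if c then mv B z else z).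
  rewrite /ws !gam_cat gam_flatten mulrA mvM.
  by case: c => //; rewrite gam_nil mv1.
have Nge i : (N0 <= N i)%N by rewrite leq_addr.
have vz : 0 < vn v z by rewrite vn_gt0.
have [zem|zem] := leP (d * vn v z) (v (wed z em)).
  exists false; have [Hg Hsep] := HN0 N z Nge nz_z zem; split=> [i|i j ij]; rewrite !wsE.
    apply: le_trans (Hg i); rewrite ler_wpM2r ?(ltW vz)//.
    by apply: le_trans (ler_norm M) _; rewrite ler_peMr.
  exact: Hsep.
exists true.
have nBz : nz (mv B z) by apply: nz_mv.
have zE : sv (wed ep em) z = padd (sv (wed z em) ep) (sv (wed ep z) em).
  by rewrite /padd /sv /wed /=; congr pair; ring.
have vepz : v (wed ep z) * vn v em = D * vn v z.
  have := congr1 (vn v) zE; rewrite vn_sv// -/D.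
  have -> : padd (sv (wed z em) ep) (sv (wed ep z) em) = padd (sv (wed ep z) em) (sv (wed z em) ep).
    by rewrite /padd /=; congr pair; ring.
  move=> DzE; rewrite -[LHS]vn_sv//.
  have lt1 : vn v (sv (wed z em) ep) < D * vn v z.
    rewrite vn_sv//; apply: (@lt_trans _ _ (d * vn v z * vn v ep)); first by rewrite ltr_pM2r.
    by rewrite mulrAC ltr_pM2r.
  rewrite DzE; apply/esym/vn_padd_dom.
  rewrite ltNge; apply/negP => le2.
  have : D * vn v z < D * vn v z.
    by rewrite {1}DzE (le_lt_trans _ lt1)// vn_padd_le.
  by rewrite ltxx.
have vBz : v (wed (mv B z) em) = rho / vn v em * vn v z.
  have zE' : wed ep em * wed (mv B z) em =
      wed ep z * wed (mv B em) em + wed z em * wed (mv B ep) em.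
    have -> : wed ep em * wed (mv B z) em = wed (mv B (sv (wed ep em) z)) em.
      by rewrite mvZ /wed /sv /=; ring.
    by rewrite zE /wed /mv /padd /sv /=; ring.
  have vE : v (wed ep z * wed (mv B em) em) = D * (rho / vn v em) * vn v z.
    by rewrite vM// -/rho -(mulfK (lt0r_neq0 vem) (v (wed ep z))) vepz; field; rewrite lt0r_neq0.
  have := congr1 v zE'; rewrite (vM hv (wed ep em)) -/D (vD_dom hv (a := wed ep z * _)) ?vE.
    by rewrite -[D * _ * _]mulrA => H; apply: (mulfI (lt0r_neq0 D_gt0)).
  rewrite (vM hv (wed z em)).
  apply: (@le_lt_trans _ _ (d * vn v z * (mnorm v B * vn v ep * vn v em))).
    apply: ler_pM; rewrite ?v_ge0 ?(ltW zem)//.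
    by apply: le_trans (v_wed hv _ _) _; rewrite ler_wpM2r ?vn_ge0// vn_mv.
  by rewrite mulrAC ltr_pM2r.
have zemB : d * vn v (mv B z) <= v (wed (mv B z) em).
  rewrite vBz; apply: (@le_trans _ _ (d * (mnorm v B * vn v z))).
    by rewrite ler_wpM2l ?(ltW d_gt0)// vn_mv.
  by rewrite mulrA ler_wpM2r// ltW.
have [Hg Hsep] := HN0 N (mv B z) Nge nBz zemB; split=> [i|i j ij]; rewrite !wsE.
  apply: le_trans (Hg i); rewrite -mulrA.
  apply: (@le_trans _ _ (`|M| * vn v z)); first by rewrite ler_wpM2r ?(ltW vz)// ler_norm.
  by rewrite ler_wpM2l// vn_mv_ge.
exact: Hsep.
Qed.

End SeparatingWords.

(** * Non-concentration and transversality *)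

Section InverseWalk.
Variables (R : realType) (k : fieldType) (v : k -> R) (p : nat -> R) (g : nat -> 'M[k]_2).
Hypothesis hSL : forall j, \det (g j) = 1.

Lemma invmx_mul2 (a b : 'M[k]_2) : \det a = 1 -> \det b = 1 ->
  invmx (a * b) = invmx b * invmx a.
Proof.
move=> da db; have dab : \det (a * b) = 1 by rewrite det_mulmx da db mulr1.
by apply: mx2P; rewrite !mulr2E !(invmx2E da) !(invmx2E db) !(invmx2E dab) !mulr2E; ring.
Qed.

Lemma det_ginv j : \det (invmx (g j)) = 1. Proof. exact: det_invmx1. Qed.

Lemma gam_inv w : gam (fun j => invmx (g j)) (rev w) = invmx (gam g w).
Proof.
elim: w => [|j w IH]; first by rewrite !gam_nil invmx1.
by rewrite rev_cons gam_rcons IH gam_cons invmx_mul2// det_gam.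
Qed.

Lemma gam_inv_rev w : invmx (gam g (rev w)) = gam (fun j => invmx (g j)) w.
Proof. by rewrite -gam_inv revK. Qed.

Lemma non_elementary_inv : non_elementary v (gen_group [set g j | j in [set j | 0 < p j]]) ->
  non_elementary v (gen_group [set invmx (g j) | j in [set j | 0 < p j]]).
Proof.
have gen_in (S : set 'M[k]_2) x : S x -> gen_group S x by move=> Sx H [SH _ _ _]; exact: SH.
have genV (S : set 'M[k]_2) x : gen_group S x -> gen_group S (invmx x).
  by move=> Sx H HH; case: (HH) => [_ _ _ HV]; apply: HV; exact: Sx.
have sub_gen (S T : set 'M[k]_2) : S `<=` gen_group T -> gen_group S `<=` gen_group T.
  move=> ST x Sx H HT; case: (HT) => [TH H1 HM HV]; apply: Sx; split => // y /ST; exact.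
suff -> : gen_group [set invmx (g j) | j in [set j | 0 < p j]] =
          gen_group [set g j | j in [set j | 0 < p j]] by [].
apply/seteqP; split; apply: sub_gen => _ [j pj <-].
- by apply: genV; apply: gen_in; exists j.
- by rewrite -(invmxK (g j)); apply: genV; apply: gen_in; exists j.
Qed.

End InverseWalk.

(** * Seminorms on linear forms and nearness to a direction *)

Section Seminorm.
Variables (R : realType) (k : fieldType) (v : k -> R).
Hypothesis hv : complete_nonarch_abs v.
Implicit Types (N : k * k -> R) (x y : k * k).

Definition nn N : R := Num.max (N (1, 0)) (N (0, 1)).

(* A point of the Berkovich line is studied through the seminorm it induces on linear forms. *)
Definition seminorm2 N := [/\ forall x, 0 <= N x, forall c x, N (sv c x) = v c * N x,
  forall x y, N (padd x y) <= N x + N y & 0 < nn N].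
Definition pull N (g : 'M[k]_2) : k * k -> R := fun x => N (vm x g).
(** [perp y] is the form vanishing at [y]; [near] says that [N] almost kills it. For the seminorm of
    a point of [P^1(k)] this is the distance of directions ([near_ptnorm]). *)
Definition near N y d := N (perp y) < d * nn N * vn v y.

Lemma seminorm2_le N x : seminorm2 N -> N x <= 2 * vn v x * nn N.
Proof.
move=> [N0 NZ ND nN]; have xE : x = padd (sv x.1 (1, 0)) (sv x.2 (0, 1)).
  by case: x => a b; rewrite /padd /sv /=; congr pair; ring.
rewrite {1}xE; apply: le_trans (ND _ _) _; rewrite !NZ -mulrA mulr_natl mulr2n lerD//.
  by apply: ler_pM; rewrite ?v_ge0 ?v1_le_vn ?N0// le_max lexx.
by apply: ler_pM; rewrite ?v_ge0 ?v2_le_vn ?N0// le_max lexx orbT.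
Qed.

Lemma pullM N (g h : 'M[k]_2) : pull N (g * h) = pull (pull N h) g.
Proof. by apply/funext => x; rewrite /pull vmM. Qed.

Lemma seminorm2_pull N (g : 'M[k]_2) : \det g = 1 -> seminorm2 N -> seminorm2 (pull N g).
Proof.
move=> dg sN; have [N0 NZ ND nN] := sN; split.
- by move=> x; exact: N0.
- by move=> c x; rewrite -NZ /pull; congr N; rewrite /vm /sv /=; congr pair; ring.
- move=> x y; apply: le_trans (ND _ _); rewrite le_eqVlt; apply/orP; left; apply/eqP.
  by congr N; rewrite /vm /padd /=; congr pair; ring.
- have vmK x : x = vm (vm x (invmx g)) g.
    rewrite -vmM; have -> : invmx g * g = 1.
      by rewrite -[LHS]/(invmx g *m g) mulVmx// unitmxE dg unitr1.
    by case: x => a b; rewrite /vm !scalar2E /=; congr pair; ring.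
  rewrite ltNge; apply/negP => nle.
  have p1 : N (vm (1, 0) g) = 0.
    by apply/eqP; rewrite eq_le N0 andbT; apply: le_trans nle; rewrite /nn /pull le_max lexx.
  have p2 : N (vm (0, 1) g) = 0.
    by apply/eqP; rewrite eq_le N0 andbT; apply: le_trans nle; rewrite /nn /pull le_max lexx orbT.
  have Nz x : N x <= 0.
    rewrite (vmK x); move: (vm x _) => y.
    have -> : vm y g = padd (sv y.1 (vm (1, 0) g)) (sv y.2 (vm (0, 1) g)).
      by rewrite /padd /sv /vm /=; congr pair; ring.
    by apply: le_trans (ND _ _) _; rewrite !NZ p1 p2 !mulr0 addr0.
  by move: nN; rewrite /nn lt_max !ltNge !Nz.
Qed.

(** Each basis form times [wed y y'] is a combination of [perp y] and [perp y']. A seminorm small on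
    both would be small on all forms unless [wed y y'] is small. *)
Lemma near_disjoint N y y' d : seminorm2 N -> nz y -> nz y' ->
  near N y d -> near N y' d -> v (wed y y') < 2 * d * vn v y * vn v y'.
Proof.
move=> [N0 NZ ND nN] ny ny' nr nr'.
have vy : 0 < vn v y by rewrite vn_gt0.
have vy' : 0 < vn v y' by rewrite vn_gt0.
have key a b : v a <= vn v y' -> v b <= vn v y ->
    v a * N (perp y) + v b * N (perp y') < 2 * d * vn v y * vn v y' * nn N.
  move=> ay by_.
  apply: (@le_lt_trans _ _ (vn v y' * N (perp y) + vn v y * N (perp y'))).
    by rewrite lerD// ler_wpM2r.
  have -> : 2 * d * vn v y * vn v y' * nn N =
    vn v y' * (d * nn N * vn v y) + vn v y * (d * nn N * vn v y') by ring.
  by rewrite ltrD// ltr_pM2l.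
rewrite -(ltr_pM2r nN).
have h1 : v (wed y y') * N (1, 0) < 2 * d * vn v y * vn v y' * nn N.
  apply: le_lt_trans (key (- y'.1) y.1 _ _); rewrite ?vN// ?v1_le_vn//.
  rewrite -(vN hv y'.1) -!NZ; apply: le_trans (ND _ _); rewrite le_eqVlt; apply/orP; left; apply/eqP.
  by congr N; rewrite /padd /sv /perp /wed /=; congr pair; ring.
have h2 : v (wed y y') * N (0, 1) < 2 * d * vn v y * vn v y' * nn N.
  apply: le_lt_trans (key (- y'.2) y.2 _ _); rewrite ?vN// ?v2_le_vn//.
  rewrite -(vN hv y'.2) -!NZ; apply: le_trans (ND _ _); rewrite le_eqVlt; apply/orP; left; apply/eqP.
  by congr N; rewrite /padd /sv /perp /wed /=; congr pair; ring.
have [E|E] : nn N = N (1, 0) \/ nn N = N (0, 1).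
- by rewrite /nn maxEle; case: ifP; [right|left].
- by rewrite {1}E.
- by rewrite {1}E.
Qed.

(** One factor [|g|], with the 2 of [seminorm2_le], comes from comparing [nn] before and after the
    pull-back; the other from comparing [y] with its image. *)
Lemma near_pull N (g : 'M[k]_2) y d : \det g = 1 -> seminorm2 N -> 0 <= d ->
  near (pull N g) y d -> near N (mv (invmx g) y) (d * (2 * mnorm v g ^+ 2)).
Proof.
move=> dg sN d0; rewrite /near /pull (perp_vm _ dg) => /lt_le_trans; apply.
have le1 : nn (fun x => N (vm x g)) <= 2 * mnorm v g * nn N.
  have [_ _ _ nN] := sN.
  have He x : vn v x = 1 -> N (vm x g) <= 2 * mnorm v g * nn N.
    move=> x1; apply: le_trans (seminorm2_le _ sN) _; rewrite ler_wpM2r ?(ltW nN)//.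
    by rewrite ler_wpM2l// (le_trans (vn_vm _ _ _))// x1 mul1r.
  by rewrite /nn ge_max !He//; [exact: (vn_ebas hv 1)|exact: (vn_ebas hv 0)].
have le2 : vn v y <= mnorm v g * vn v (mv (invmx g) y).
  by have := vn_mv_ge hv y (det_invmx1 dg); rewrite mnormV.
have nn0 : 0 <= nn (fun x => N (vm x g)) by have [N0 _ _ _] := sN; rewrite le_max N0.
apply: (@le_trans _ _ (d * (2 * mnorm v g * nn N) * (mnorm v g * vn v (mv (invmx g) y)))).
  apply: ler_pM => //; [by rewrite mulr_ge0|exact: vn_ge0|].
  by rewrite ler_wpM2l.
by rewrite le_eqVlt; apply/orP; left; apply/eqP; ring.
Qed.

Lemma near_mono N y d d' : seminorm2 N -> d <= d' -> near N y d -> near N y d'.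
Proof.
move=> [_ _ _ nN] dd'; rewrite /near => /lt_le_trans; apply.
by rewrite ler_wpM2r ?vn_ge0// ler_wpM2r// ltW.
Qed.

Definition ptnorm x : k * k -> R := fun y => v (dot y x).

Lemma nn_ptnorm x : nn (ptnorm x) = vn v x.
Proof. by rewrite /nn /ptnorm /dot /vn /= !mul1r !mul0r addr0 add0r. Qed.

Lemma seminorm2_ptnorm x : nz x -> seminorm2 (ptnorm x).
Proof.
move=> nx; split.
- by move=> y; exact: v_ge0.
- by move=> c y; rewrite -vM// /ptnorm; congr v; rewrite /dot /sv /=; ring.
- move=> y y'; have -> : ptnorm x (padd y y') = v (dot y x + dot y' x).
    by rewrite /ptnorm; congr v; rewrite /dot /padd /=; ring.
  by apply: le_trans (vD hv _ _) _; rewrite ge_max lerDl lerDr !v_ge0.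
- by rewrite nn_ptnorm vn_gt0.
Qed.

Lemma pull_ptnorm x g : pull (ptnorm x) g = ptnorm (mv g x).
Proof. by apply/funext => y; rewrite /pull /ptnorm dot_vm. Qed.

Lemma near_ptnorm x y d : near (ptnorm x) y d = (v (wed x y) < d * vn v x * vn v y).
Proof.
rewrite /near nn_ptnorm /ptnorm; congr (_ < _).
by congr v; rewrite /dot /perp /wed /=; ring.
Qed.

(** On [perp (attv g)] the pulled-back seminorm is at most [nn N / |g|], while on a basis form it is
    [|g|] times the value of [N] at [repv g], hence at least [|g| * d * nn N]. *)
Lemma near_contract N (g : 'M[k]_2) d : \det g = 1 -> seminorm2 N -> 0 < d ->
  ~ N (repv hv g) < d * nn N ->
  forall e, 1 < e * d * mnorm v g ^+ 2 -> near (pull N g) (attv hv g) e.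
Proof.
move=> dg sN d0 /negP; rewrite -leNgt => far e eg.
have [N0 NZ ND nN] := sN; have g0 := mnorm_gt0 hv dg.
have [j [c [vc cE]]] := attv_perp hv dg.
rewrite /near vn_attv// mulr1 {1}/pull cE NZ vc.
have e0 : 0 < e.
  rewrite ltNge; apply/negP => e0; move: eg; rewrite ltNge => /negP; apply.
  by rewrite (@le_trans _ _ 0)// mulr_le0_ge0 ?exprn_ge0 ?(ltW g0)// mulr_le0_ge0// ltW.
apply: (@le_lt_trans _ _ ((mnorm v g)^-1 * nn N)).
  rewrite ler_wpM2l ?invr_ge0 ?(ltW g0)//.
  by move: j {cE}; apply: ord2P; rewrite /nn le_max lexx ?orbT.
have ge1 : mnorm v g * (d * nn N) <= nn (pull N g).
  apply: (@le_trans _ _ (mnorm v g * N (repv hv g))); first by rewrite ler_wpM2l// ltW.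
  rewrite -(v_maxent hv) -NZ repvE.
  have -> : sv (maxent hv g) (sv (maxent hv g)^-1 (vm (ebas k (maxidx hv g).1) g)) =
      vm (ebas k (maxidx hv g).1) g.
    by rewrite /sv /= !(mulrA (maxent hv g)) divff ?(maxent_neq0 hv dg)// !mul1r.
  by rewrite /nn /pull; move: (maxidx hv g).1; apply: ord2P; rewrite le_max lexx ?orbT.
apply: (@lt_le_trans _ _ (e * (mnorm v g * (d * nn N)))); last by rewrite ler_wpM2l// ltW.
rewrite mulrC ltr_pdivrMr//.
have -> : e * (mnorm v g * (d * nn N)) * mnorm v g = e * d * mnorm v g ^+ 2 * nn N by ring.
by rewrite -{1}[nn N]mul1r ltr_pM2r.
Qed.

End Seminorm.

(** * No direction carries much mass, and norms grow *)

Section Regularity.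
Variables (R : realType) (k : fieldType) (v : k -> R).
Hypothesis hv : complete_nonarch_abs v.
Variables (p : nat -> R) (g : nat -> 'M[k]_2).
Hypothesis p_ge0 : forall j, 0 <= p j.
Hypothesis p_sum1 : (\esum_(j in [set: nat]) (p j)%:E)%E = 1%E.
Hypothesis hSL : forall j, \det (g j) = 1.
Hypothesis hne : non_elementary v (gen_group [set g j | j in [set j | 0 < p j]]).
Local Notation gam := (gam g).
Local Notation det_gam := (det_gam hSL).

Lemma posw_rev w : posw p (rev w) = posw p w. Proof. by rewrite /posw all_rev. Qed.

(** Removing a prefix moves the target direction by the inverse of the prefix, so the separation is
    needed under inverses: words for the inverse walk are read backwards. Injectivity is added
    because [wprob_step] counts distinct words. *)
Lemma separating_words_inv K : exists2 s : R, 0 < s & forall M : R,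
  exists (b : bool -> nat) (ws : bool -> 'I_K -> seq nat),
  [/\ forall c, injective (ws c), forall c i, 0 < wt p (ws c i), forall c i, size (ws c i) = b c &
      forall z, nz z -> exists c,
        (forall i, M * vn v z <= vn v (mv (invmx (gam (ws c i))) z)) /\
        (forall i j, i != j ->
          s * vn v (mv (invmx (gam (ws c i))) z) * vn v (mv (invmx (gam (ws c j))) z) <=
          v (wed (mv (invmx (gam (ws c i))) z) (mv (invmx (gam (ws c j))) z)))].
Proof.
have [s s0 Hs] := separating_words hv (det_ginv hSL) (non_elementary_inv hne) K.
exists s => // M; have [b [ws [pws sws Hz]]] := Hs M.
have nz1 : nz (1 : k, 0 : k) by rewrite /nz /= oner_eq0.
have Hz' z : nz z -> exists c, (forall i, M * vn v z <= vn v (mv (invmx (gam (rev (ws c i)))) z)) /\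
        (forall i j, i != j ->
          s * vn v (mv (invmx (gam (rev (ws c i)))) z) * vn v (mv (invmx (gam (rev (ws c j)))) z) <=
          v (wed (mv (invmx (gam (rev (ws c i)))) z) (mv (invmx (gam (rev (ws c j)))) z))).
  move=> /Hz[c [H1 H2]]; exists c; split=> [i|i j ij]; rewrite !gam_inv_rev//.
  exact: H2.
have inj c : (exists2 z, nz z & forall i j, i != j ->
          s * vn v (mv (invmx (gam (rev (ws c i)))) z) * vn v (mv (invmx (gam (rev (ws c j)))) z) <=
          v (wed (mv (invmx (gam (rev (ws c i)))) z) (mv (invmx (gam (rev (ws c j)))) z))) ->
    injective (ws c).
  move=> [z nzz Hij] i j ij; apply/eqP; apply: contraT => /(Hij i j); rewrite ij.
  have -> : wed (mv (invmx (gam (rev (ws c j)))) z) (mv (invmx (gam (rev (ws c j)))) z) = 0.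
    by rewrite /wed; ring.
  rewrite v0// leNgt !mulr_gt0// vn_gt0// nz_mv// det_invmx1//; exact: det_gam.
have [good|] := pselect (forall c, injective (ws c)).
  exists b, (fun c i => rev (ws c i)); split => //.
  - by move=> c i j /(can_inj revK) /(good c).
  - by move=> c i; apply: wt_gt0; rewrite posw_rev.
  - by move=> c i; rewrite size_rev.
(* A family which is not injective separates no vector, so the other one may be used throughout. *)
move=> /existsNP[c1 bad].
have other z : nz z -> (forall i, M * vn v z <= vn v (mv (invmx (gam (rev (ws (~~ c1) i)))) z)) /\
        (forall i j, i != j ->
          s * vn v (mv (invmx (gam (rev (ws (~~ c1) i)))) z) * vn v (mv (invmx (gam (rev (ws (~~ c1) j)))) z) <=
          v (wed (mv (invmx (gam (rev (ws (~~ c1) i)))) z) (mv (invmx (gam (rev (ws (~~ c1) j)))) z))).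
  move=> nzz; have [c [H1 H2]] := Hz' z nzz.
  have [cE|cE] := eqVneq c c1; first by exfalso; apply: bad; apply: inj; exists z => //; rewrite -cE.
  by have -> : ~~ c1 = c by case: (c) (c1) cE => -[].
exists (fun=> b (~~ c1)), (fun _ i => rev (ws (~~ c1) i)); split.
- have injo : injective (ws (~~ c1)) by apply: inj; exists (1, 0) => //; exact: (other _ nz1).2.
  by move=> _ i j /(can_inj revK) /injo.
- by move=> c i; apply: wt_gt0; rewrite posw_rev.
- by move=> c i; rewrite size_rev.
- by move=> z /other H; exists true.
Qed.

(** The data are all pairs of a seminorm and a direction, whence the uniformity. A prefix changes
    only the direction, and [near_pull] gives the loss of scale. *)
Lemma near_unlikely (e : R) : 0 < e -> exists2 d : R, 0 < d & exists n0, forall n N y,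
  (n0 <= n)%N -> seminorm2 v N -> nz y ->
  (wprob p n [set w | near v (pull N (gam w)) y d] <= e%:E)%E.
Proof.
move=> e0.
pose I := ({N : k * k -> R | seminorm2 v N} * {y : k * k | nz y})%type.
pose Ev (i : I) (d : R) : set (seq nat) := [set w | near v (pull (sval i.1) (gam w)) (sval i.2) d].
have sP (i : I) w : seminorm2 v (pull (sval i.1) (gam w)).
  by apply: seminorm2_pull => //; [exact: det_gam|exact: (svalP i.1)].
have shift (i : I) w d w' : 0 <= d -> Ev i d (w ++ w') ->
    near v (pull (sval i.1) (gam w')) (mv (invmx (gam w)) (sval i.2)) (d * (2 * mnorm v (gam w) ^+ 2)).
  move=> d0; rewrite /Ev /= gam_cat pullM => nr.
  by apply: near_pull => //; exact: det_gam.
have [|||d d0 [n0 H]] := @concentration _ _ p_ge0 p_sum1 I Ev (fun w => 2 * mnorm v (gam w) ^+ 2) _ _ _ _ e0.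
- by move=> i d d' w dd'; apply: near_mono.
- move=> i w.
  have nyw : nz (mv (invmx (gam w)) (sval i.2)).
    by apply: nz_mv (svalP i.2); apply: det_invmx1; exact: det_gam.
  exists (i.1, exist (fun y => nz y) _ nyw) => d w' d0; exact: shift.
- move=> K; have [s s0 Hs] := separating_words_inv K.
  have [b [ws [injw wtw szw Hz]]] := Hs 0.
  pose Mx := \big[Num.max/1]_(x : bool * 'I_K) (2 * mnorm v (gam (ws x.1 x.2)) ^+ 2).
  have Mx0 : 0 < Mx by apply: (lt_le_trans ltr01); apply: bigmax_ge_id.
  have MxP c a : 2 * mnorm v (gam (ws c a)) ^+ 2 <= Mx by rewrite /Mx (bigD1 (c, a))//= le_max lexx.
  (* After any of the finitely many prefixes the scale is at most [s / 2], where two nearby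
     directions contradict the separation [s] by [near_disjoint]. *)
  exists (s / 2 / Mx); first by rewrite !divr_gt0.
  exists b, ws; split => // i; have [c [_ Hc]] := Hz _ (svalP i.2).
  exists c => a a' w' aa' Ea Ea'.
  have d0 : 0 <= s / 2 / Mx by rewrite !divr_ge0 ?(ltW s0) ?(ltW Mx0).
  have nr x : Ev i (s / 2 / Mx) (ws c x ++ w') ->
      near v (pull (sval i.1) (gam w')) (mv (invmx (gam (ws c x))) (sval i.2)) (s / 2).
    move=> /(shift _ _ _ _ d0); apply: near_mono => //.
    apply: (le_trans (ler_wpM2l d0 (MxP c x))); rewrite divfK// gt_eqF//.
  have nzi x : nz (mv (invmx (gam (ws c x))) (sval i.2)).
    by apply: nz_mv (svalP i.2); apply: det_invmx1; exact: det_gam.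
  have := near_disjoint hv (sP i w') (nzi a) (nzi a') (nr _ Ea) (nr _ Ea').
  by rewrite (_ : 2 * (s / 2) = s) ?ltNge ?Hc//; field.
exists d => //; exists n0 => n N y nn0 sN ny.
exact: (H n (exist _ N sN, exist (fun y => nz y) y ny) nn0).
Qed.

(** The left factor [u^-1] makes the events stable under removal of a prefix. If two prefixes led to
    small norms with the same continuation, the quotient [X^-1 X'] would be bounded; but [X x] and
    [X' x] are long and separated, so their [wed], and with it the quotient, is large. *)
Lemma norm_grows (M e : R) : 0 < e -> exists n0, forall n, (n0 <= n)%N ->
  (wprob p n [set w | (mnorm v (gam w) <= M)%R] <= e%:E)%E.
Proof.
move=> e0.
pose I := {u : 'M[k]_2 | \det u = 1}.
pose Ev (i : I) (d : R) : set (seq nat) := [set w | mnorm v (invmx (sval i) * gam w) <= M].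
have shiftE (u : 'M[k]_2) w w' : \det u = 1 ->
    invmx u * gam (w ++ w') = invmx (invmx (gam w) * u) * gam w'.
  move=> du; rewrite gam_cat invmx_mul2 ?det_invmx1 ?det_gam//.
  by rewrite invmxK mulrA.
have dsh (i : I) w : \det (invmx (gam w) * sval i) = 1.
  by rewrite det_mulmx det_invmx1 ?det_gam// (svalP i) mulr1.
have [|||d d0 [n0 H]] := @concentration _ _ p_ge0 p_sum1 I Ev (fun=> 1) _ _ _ _ e0.
- by [].
- by move=> i w; exists (exist (fun u : 'M[k]_2 => \det u = 1) _ (dsh i w)) => d w' _; rewrite /Ev /= shiftE// (svalP i).
- move=> K; have [s s0 Hs] := separating_words_inv K.
  pose M1 := Num.max M 1.
  have M1_ge1 : 1 <= M1 by rewrite le_max lexx orbT.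
  have M1_gt0 : 0 < M1 by apply: lt_le_trans M1_ge1.
  (* Chosen so that [s * M' ^ 2 = M1 ^ 2 * (s + 2 + s^-1)] exceeds [M1 ^ 2]. *)
  pose M' := M1 * (1 + s^-1).
  have M'0 : 0 < M' by rewrite mulr_gt0// addr_gt0// invr_gt0.
  have M'M : M1 * M1 < s * M' * M'.
    have -> : s * M' * M' = M1 * M1 * (s + 2 + s^-1) by rewrite /M'; field; rewrite gt_eqF.
    rewrite ltr_pMr ?mulr_gt0//; have : 0 < s^-1 by rewrite invr_gt0.
    by lra.
  have [b [ws [injw wtw szw Hz]]] := Hs M'.
  exists 1 => //; exists b, ws; split => // -[u du].
  (* This basis vector selects a column of [u] of full norm, so [u x] has norm at least 1 whatever
     [u] is. *)
  pose x := ebas k (maxidx hv u).2.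
  have vx : vn v x = 1 by apply: vn_ebas.
  have vz : 1 <= vn v (mv u x) by rewrite /x vn_col mnorm_ge1.
  have nzz : nz (mv u x) by rewrite -(vn_gt0 hv) (lt_le_trans ltr01).
  have [c [Hg Hc]] := Hz _ nzz; exists c => a a' w' aa'.
  rewrite /Ev /= !shiftE//.
  set X := invmx (gam (ws c a)) * u; set X' := invmx (gam (ws c a')) * u => Ea Ea'.
  have dX : \det X = 1 by exact: (dsh (exist (fun u : 'M[k]_2 => \det u = 1) u du)).
  have dX' : \det X' = 1 by exact: (dsh (exist (fun u : 'M[k]_2 => \det u = 1) u du)).
  have MM : mnorm v (invmx X * X') <= M1 * M1.
    have -> : invmx X * X' = (invmx X * gam w') * invmx (invmx X' * gam w').
      rewrite (invmx_mul2 (det_invmx1 dX') (det_gam w')) (invmxK X') -(mulrA (invmx X)).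
      by rewrite (mulK_invmx X' (det_gam w')).
    apply: (le_trans (mnormM hv _ _)).
    rewrite mnormV ?det_mulmx ?det_invmx1 ?det_gam ?mulr1//.
    by apply: ler_pM; rewrite ?mnorm_ge0// le_max ?Ea ?Ea'.
  have wedle : v (wed (mv X x) (mv X' x)) <= mnorm v (invmx X * X').
    have -> : mv X' x = mv X (mv (invmx X * X') x) by rewrite -mvM mulK_invmx.
    rewrite wed_mv dX mul1r; apply: (le_trans (v_wed hv _ _)); rewrite vx mul1r.
    by apply: (le_trans (vn_mv hv _ _)); rewrite vx mulr1.
  have := Hc a a' aa'; rewrite -!mvM -/X -/X' => le1.
  have ga y : M' <= vn v (mv (invmx (gam (ws c y)) * u) x).
    by rewrite mvM; apply: le_trans (Hg y); rewrite ler_peMr ?(ltW M'0).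
  have : s * M' * M' <= M1 * M1.
    apply: le_trans MM; apply: le_trans wedle; apply: le_trans le1.
    apply: ler_pM; [by rewrite mulr_ge0 ?(ltW s0) ?(ltW M'0)|exact: ltW| |exact: ga].
    by rewrite ler_wpM2l ?(ltW s0)//; exact: ga.
  by rewrite leNgt M'M.
exists n0 => n nn0.
have := H n (exist (fun u : 'M[k]_2 => \det u = 1) 1%:M (det1 _ _)) nn0; rewrite /Ev /= invmx1.
by apply: le_trans; apply: le_wprob => // w _ /=; rewrite mul1r.
Qed.

Lemma point_near_unlikely (e : R) : 0 < e -> exists2 d : R, 0 < d & exists n0, forall n x y,
  (n0 <= n)%N -> nz x -> nz y ->
  (wprob p n [set w | (v (wed (mv (gam w) x) y) < d * vn v (mv (gam w) x) * vn v y)%R] <= e%:E)%E.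
Proof.
move=> e0; have [d d0 [n0 H]] := near_unlikely e0; exists d => //; exists n0 => n x y nn0 nx ny.
apply: le_trans (H n (ptnorm v x) y nn0 (seminorm2_ptnorm hv nx) ny).
by apply: le_wprob => // w _ /=; rewrite pull_ptnorm near_ptnorm.
Qed.

Lemma nz_ebas j : nz (ebas k j). Proof. by rewrite -(vn_gt0 hv) vn_ebas. Qed.

(** [attv] is a multiple of one of the two columns; which one depends on the word, so both are
    controlled. *)
Lemma attv_near_unlikely (e : R) : 0 < e -> exists2 d : R, 0 < d & exists n0, forall n y,
  (n0 <= n)%N -> nz y ->
  (wprob p n [set w | (v (wed (attv hv (gam w)) y) < d * vn v y)%R] <= e%:E)%E.
Proof.
move=> e0; have e20 : 0 < e / 2 by rewrite divr_gt0.
have [d d0 [n0 H]] := point_near_unlikely e20; exists d => //; exists n0 => n y nn0 ny.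
have := leeD (H n _ y nn0 (nz_ebas 0) ny) (H n _ y nn0 (nz_ebas 1) ny).
rewrite -EFinD -splitr; apply: le_trans; apply: le_trans (wprobU p_ge0 _ _ _).
apply: le_wprob => // w _ /=.
have g0 := mnorm_gt0 hv (det_gam w); have := vn_col hv (gam w).
rewrite attvE; set j := (maxidx hv (gam w)).2 => vc.
have -> : wed (sv (maxent hv (gam w))^-1 (mv (gam w) (ebas k j))) y =
    (maxent hv (gam w))^-1 * wed (mv (gam w) (ebas k j)) y by rewrite /wed /sv /=; ring.
rewrite vM// vV// v_maxent mulrC ltr_pdivrMr// mulrAC -vc.
by move: j vc; apply: ord2P => vc H'; [left|right].
Qed.

End Regularity.

(** * Attracting directions are transversal to repelling forms *)

Section Transversality.
Variables (R : realType) (k : fieldType) (v : k -> R).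
Hypothesis hv : complete_nonarch_abs v.
Variables (p : nat -> R) (g : nat -> 'M[k]_2).
Hypothesis p_ge0 : forall j, 0 <= p j.
Hypothesis p_sum1 : (\esum_(j in [set: nat]) (p j)%:E)%E = 1%E.
Hypothesis hSL : forall j, \det (g j) = 1.
Hypothesis hne : non_elementary v (gen_group [set g j | j in [set j | 0 < p j]]).
Local Notation gam := (gam g).
Local Notation det_gam := (det_gam hSL).

Lemma wprob_rev n (A : set (seq nat)) : wprob p n [set w | A (rev w)] = wprob p n A.
Proof. by rewrite /wprob -[RHS]wexp_rev. Qed.

(** Through [perp], the rows of [r_n] are images of fixed vectors under [r_n^-1], that is under the
    inverse walk read backwards, to which the bound for columns applies. *)
Lemma repv_near_unlikely (e : R) : 0 < e -> exists2 d : R, 0 < d & exists n0, forall n y,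
  (n0 <= n)%N -> nz y ->
  (wprob p n [set w | (v (dot (repv hv (gam w)) y) < d * vn v y)%R] <= e%:E)%E.
Proof.
move=> e0; have e20 : 0 < e / 2 by rewrite divr_gt0.
have [d d0 [n0 H]] := point_near_unlikely hv p_ge0 p_sum1 (det_ginv hSL) (non_elementary_inv hne) e20.
exists d => //; exists n0 => n y nn0 ny.
(* [perp] sends [(0, 1)] and [(-1, 0)] to the two basis forms. *)
have n1 : nz (0 : k, 1 : k) by rewrite /nz /= oner_eq0 orbT.
have n2 : nz (-1 : k, 0 : k) by rewrite /nz /= oppr_eq0 oner_eq0.
have := leeD (H n _ y nn0 n1 ny) (H n _ y nn0 n2 ny).
rewrite -EFinD -splitr; apply: le_trans; apply: le_trans (wprobU p_ge0 _ _ _).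
rewrite -wprob_rev.
apply: le_wprob => // w _ /=.
have g0 := mnorm_gt0 hv (det_gam (rev w)); have := vn_row hv (gam (rev w)).
rewrite -(gam_inv_rev hSL) repvE; set i := (maxidx hv (gam (rev w))).1 => vr.
have -> : dot (sv (maxent hv (gam (rev w)))^-1 (vm (ebas k i) (gam (rev w)))) y =
    (maxent hv (gam (rev w)))^-1 * dot (vm (ebas k i) (gam (rev w))) y.
  by rewrite /dot /sv /=; ring.
rewrite vM// vV// v_maxent mulrC ltr_pdivrMr// mulrAC -vr.
have dotE x : v (dot (perp x) y) = v (wed x y).
  by rewrite -(vN hv (wed x y)); congr v; rewrite /dot /perp /wed /=; ring.
have e1 : ebas k 0 = perp (0, 1) by rewrite /perp /= oppr0.
have e2 : ebas k 1 = perp (-1, 0) by rewrite /perp /= opprK.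
move: i vr; apply: ord2P => vr.
  rewrite e1 (perp_vm _ (det_gam _)) dotE (vn_perp hv) => H'; left; exact: H'.
rewrite e2 (perp_vm _ (det_gam _)) dotE (vn_perp hv) => H'; right; exact: H'.
Qed.

(** Cut the word into a prefix and a suffix. When both have large norm and are themselves in general
    position, [attv] of the product is close to that of the prefix and [repv] to that of the suffix.
    The suffix is independent of the prefix, so its [repv] rarely almost vanishes at a direction
    fixed by the prefix. *)
Lemma transversal (e : R) : 0 < e -> exists2 d : R, 0 < d & exists n0, forall n,
  (n0 <= n)%N ->
  (wprob p n [set w | (v (dot (repv hv (gam w)) (attv hv (gam w))) < d)%R] <= e%:E)%E.
Proof.
move=> e0; have e40 : 0 < e / 4 by rewrite divr_gt0.
have [d1 d10 [n1 H1]] := repv_near_unlikely e40.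
have [d2 d20 [n2 H2]] := attv_near_unlikely hv p_ge0 p_sum1 hSL hne e40.
pose d := Num.min d1 d2; have d_gt0 : 0 < d by rewrite lt_min d10.
have dd1 : d <= d1 by rewrite ge_min lexx.
have dd2 : d <= d2 by rewrite ge_min lexx orbT.
(* For norms [a > M] and [b] this gives [b / a < d * (a * b * d)], where [a * b * d] is the lower
   bound for the norm of the product. *)
pose M := 1 + (d * d)^-1.
have dd0 : 0 < d * d by rewrite mulr_gt0.
have M_ge1 : 1 <= M by rewrite lerDl invr_ge0 ltW.
have [n3 H3] := norm_grows hv p_ge0 p_sum1 hSL hne M e40.
exists d => //; pose m := maxn n1 (maxn n2 n3); exists (m + m)%N => n mn.
have mn' : (m <= n)%N by apply: leq_trans mn; rewrite leq_addr.
have nm : (m <= n - m)%N by rewrite leq_subRL.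
rewrite -(subnKC mn').
pose A := [set w : seq nat | M < mnorm v (gam w)].
have e34 : 0 <= e / 4 + (e / 4 + e / 4) by rewrite !addr_ge0// ltW.
apply: (@le_trans _ _ ((e / 4 + (e / 4 + e / 4))%:E + wprob p m (~` A))%E); last first.
  apply: (@le_trans _ _ ((e / 4 + (e / 4 + e / 4))%:E + (e / 4)%:E)%E); last first.
    by rewrite -EFinD lee_fin; lra.
  rewrite leeD2l//; apply: le_trans (H3 m _); last by rewrite !leq_max leqnn !orbT.
  by apply: le_wprob => // w _ /= /negP; rewrite -leNgt.
apply: wprob_cat_le => // w _ Aw.
have dw := det_gam w.
have att1 := vn_attv hv dw; have rep1 := vn_repv hv dw.
have natt : nz (attv hv (gam w)) by rewrite -(vn_gt0 hv) att1.
(* [wed x y] is the value at [x] of [repv] of the prefix. *)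
pose y := (- (repv hv (gam w)).2, (repv hv (gam w)).1).
have ny1 : vn v y = 1 by rewrite -rep1 /vn /y /= vN// maxC.
have ny : nz y by rewrite -(vn_gt0 hv) ny1.
have n1m : (n1 <= n - m)%N by apply: leq_trans nm; rewrite leq_max leqnn.
have n2m : (n2 <= n - m)%N by apply: leq_trans nm; rewrite !leq_max leqnn orbT.
have n3m : (n3 <= n - m)%N by apply: leq_trans nm; rewrite !leq_max leqnn !orbT.
have := leeD (H1 _ _ n1m natt) (leeD (H2 _ _ n2m ny) (H3 _ n3m)).
rewrite -!EFinD; apply: le_trans.
apply: le_trans (leeD (lexx _) (wprobU p_ge0 _ _ _)).
apply: le_trans (wprobU p_ge0 _ _ _).
apply: le_wprob => // w' _ /= lt_d.
have dw' := det_gam w'.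
have att1' := vn_attv hv dw'; have rep1' := vn_repv hv dw'.
have [small|big] := leP (mnorm v (gam w')) M; first by right; right.
have [c2|c2] := ltP (v (wed (attv hv (gam w')) y)) (d2 * vn v y); first by right; left.
(* Outside the other two events, two uses of [v_dot_wed] transfer a small pairing from the product
   to [repv] of the suffix and [attv] of the prefix. *)
left; rewrite att1 mulr1; apply: lt_le_trans dd1.
have far : d <= v (dot (repv hv (gam w)) (attv hv (gam w'))).
  apply: le_trans dd2 _; move: c2; rewrite ny1 mulr1 => /le_trans; apply.
  by rewrite le_eqVlt; apply/orP; left; apply/eqP; congr v; rewrite /wed /dot /y /=; ring.
have dww' : \det (gam (w ++ w')) = 1 by apply: det_gam.
have gE := gam_cat g w w'.
have nge : mnorm v (gam w) * mnorm v (gam w') * d <= mnorm v (gam (w ++ w')).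
  rewrite gE; apply: le_trans (mnorm_mul_ge hv dw dw'); rewrite ler_wpM2l// mulr_ge0 ?mnorm_ge0//.
have m0 := mnorm_gt0 hv dw; have m0' := mnorm_gt0 hv dw'; have m0'' := mnorm_gt0 hv dww'.
have sm a b : M < a -> 0 < b -> b / a < d * (a * b * d).
  move=> Ma b0; have a0 : 0 < a by apply: lt_trans Ma; apply: lt_le_trans M_ge1.
  rewrite ltr_pdivrMr//.
  have -> : d * (a * b * d) * a = b * (d * d * (a * a)) by ring.
  rewrite ltr_pMr//; apply: (@lt_le_trans _ _ (d * d * M)).
    by rewrite /M mulrDr mulr1 mulfV ?gt_eqF// ltrDr.
  by rewrite ler_wpM2l ?(ltW dd0)// (le_trans (ltW Ma))// ler_peMl ?(ltW a0)// (le_trans M_ge1)// ltW.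
apply: (v_dot_wed hv (x := attv hv (gam (w ++ w')))).
- by rewrite rep1'.
- exact: vn_attv.
- by rewrite att1.
- have comm (a b : k * k) : dot a b = dot b a by rewrite /dot; ring.
  rewrite comm; apply: (v_dot_wed hv (x := repv hv (gam (w ++ w')))).
  + by rewrite vn_attv.
  + exact: vn_repv.
  + by rewrite rep1'.
  + by rewrite comm.
  + rewrite repvE.
    set i := (maxidx hv _).1.
    have -> : wed (sv (maxent hv (gam (w ++ w')))^-1 (vm (ebas k i) (gam (w ++ w')))) (repv hv (gam w')) =
       (maxent hv (gam (w ++ w')))^-1 * wed (vm (vm (ebas k i) (gam w)) (gam w')) (repv hv (gam w')).
      by rewrite gE vmM /wed /sv /=; ring.
    rewrite vM// vV// v_maxent mulrC ltr_pdivrMr//.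
    apply: (le_lt_trans (wed_repv hv _ dw')).
    apply: (@le_lt_trans _ _ (mnorm v (gam w) / mnorm v (gam w'))).
      rewrite ler_wpM2r ?invr_ge0 ?mnorm_ge0//.
      by apply: (le_trans (vn_vm hv _ _)); rewrite vn_ebas// mul1r.
    apply: lt_le_trans (sm _ _ big m0) _; rewrite ler_wpM2l ?(ltW d_gt0)//.
    by rewrite [_ * mnorm v (gam w)]mulrC.
- rewrite attvE; set j := (maxidx hv _).2.
  have -> : wed (sv (maxent hv (gam (w ++ w')))^-1 (mv (gam (w ++ w')) (ebas k j))) (attv hv (gam w)) =
     (maxent hv (gam (w ++ w')))^-1 * wed (mv (gam w) (mv (gam w') (ebas k j))) (attv hv (gam w)).
    by rewrite gE mvM /wed /sv /=; ring.
  rewrite vM// vV// v_maxent mulrC ltr_pdivrMr//.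
  apply: (le_lt_trans (wed_attv hv _ dw)).
  apply: (@le_lt_trans _ _ (mnorm v (gam w') / mnorm v (gam w))).
    rewrite ler_wpM2r ?invr_ge0 ?mnorm_ge0//.
    by apply: (le_trans (vn_mv hv _ _)); rewrite vn_ebas// mulr1.
  by apply: lt_le_trans (sm _ _ Aw m0') _; rewrite ler_wpM2l ?(ltW d_gt0).
Qed.

(** The error in [tr_attv] is at most [1 / |h| <= 1], while the main term exceeds 1. *)
Lemma tr_dominant (h : 'M[k]_2) (d : R) : \det h = 1 -> 0 < d -> d^-1 < mnorm v h ->
  d <= v (dot (repv hv h) (attv hv h)) ->
  v (\tr h) = mnorm v h * v (dot (repv hv h) (attv hv h)) /\ hyperbolic v h.
Proof.
move=> dh d0 hd tv; have h1 := mnorm_ge1 hv dh; have h0 := mnorm_gt0 hv dh.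
have big : 1 < mnorm v h * v (dot (repv hv h) (attv hv h)).
  apply: (@lt_le_trans _ _ (mnorm v h * d)); last by rewrite ler_wpM2l// ltW.
  by rewrite -ltr_pdivrMr// div1r.
suff trE : v (\tr h) = mnorm v h * v (dot (repv hv h) (attv hv h)).
  by split => //; rewrite /hyperbolic trE.
rewrite -{1}(v_maxent hv) -vM//.
rewrite -[\tr h](subrK (maxent hv h * dot (repv hv h) (attv hv h))) addrC vD_dom//.
apply: (le_lt_trans (tr_attv hv dh)); rewrite vM// v_maxent.
by apply: le_lt_trans big; rewrite invf_le1.
Qed.

End Transversality.

(** * Laws of large numbers *)

Section Prob.
Variables (R : realType) (k : fieldType) (v : k -> R).
Variables (p : nat -> R) (g : nat -> 'M[k]_2).
Hypothesis p_ge0 : forall j, 0 <= p j.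
Hypothesis p_sum1 : (\esum_(j in [set: nat]) (p j)%:E)%E = 1%E.

Lemma weightE n (t : n.-tuple nat) : weight p t = wt p t.
Proof. by rewrite /weight /wt big_tuple. Qed.

Lemma rnE n (t : n.-tuple nat) : rn g t = gam g t.
Proof. by rewrite /rn /gam big_tuple. Qed.

Lemma esum_wexp n (A : set 'M[k]_2) (F : 'M[k]_2 -> R) : (forall x, 0 <= F x) ->
  (\esum_(t in [set t : n.-tuple nat | A (rn g t)]) (weight p t * F (rn g t))%:E)%E =
  wexp p n (fun w => (\1_[set w | A (gam g w)] w * F (gam g w))%:E).
Proof.
move=> F0; rewrite wexp_esum// => [|w]; last by rewrite lee_fin mulr_ge0.
rewrite esum_mkcond; apply: eq_esum => t _; rewrite weightE rnE indicE.
have [At|At] := pselect (A (gam g t)).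
  by rewrite !mem_set//= ?rnE// mul1r EFinM.
by rewrite !memNset//= ?rnE// mul0r mule0.
Qed.

Lemma ProbE n (A : set 'M[k]_2) : Prob p g n A = wprob p n [set w | A (gam g w)].
Proof.
rewrite /Prob /wprob.
rewrite -(eq_esum (a := fun t => (weight p t * 1)%:E)); last by move=> t _; rewrite mulr1.
rewrite (esum_wexp n A (F := fun=> 1))//.
by apply: eq_wexp => w _; rewrite mulr1.
Qed.

Lemma wprob_cvg1 (A : nat -> set (seq nat)) :
  (forall e : R, 0 < e -> exists n0, forall n, (n0 <= n)%N -> (wprob p n (~` A n) <= e%:E)%E) ->
  wprob p n (A n) @[n --> \oo] --> 1%E.
Proof.
move=> H.
suff : fine (wprob p n (A n)) @[n --> \oo] --> (1 : R).
  move=> h; apply/fine_cvgP; split => //.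
  by apply: nearW => n; exact: wprob_fin.
apply/cvgrPdist_le => e e0; have [n0 Hn0] := H e e0.
near=> n; have nn0 : (n0 <= n)%N by near: n; exists n0.
have := wprobC p_ge0 p_sum1 n (A n).
rewrite -{1}(fineK (wprob_fin p_ge0 p_sum1 n (A n))) -(fineK (wprob_fin p_ge0 p_sum1 n (~` A n))).
rewrite -EFinD => -[sumE].
have := Hn0 n nn0; rewrite -(fineK (wprob_fin p_ge0 p_sum1 n (~` A n))) lee_fin => le_e.
have ge0 : 0 <= fine (wprob p n (~` A n)) by apply: fine_ge0; exact: wprob_ge0.
by rewrite -sumE addrC addKr ger0_norm.
Unshelve. all: by end_near. Qed.

Lemma wprob_markov n (F : seq nat -> R) (a : R) : 0 < a -> (forall w, 0 <= F w) ->
  (a%:E * wprob p n [set w | (a <= F w)%R] <= wexp p n (fun w => (F w)%:E))%E.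
Proof.
move=> a0 F0; rewrite /wprob -wexpZl//.
apply: le_wexp => // [w|w _]; first by rewrite -EFinM lee_fin mulr_ge0// ltW.
rewrite -EFinM lee_fin indicE; have [aF|aF] := leP a (F w).
  by rewrite mem_set//= mulr1.
by rewrite memNset ?mulr0//=; apply/negP; rewrite -ltNge.
Qed.

End Prob.

(** * A weak law of large numbers in mean for block sums *)

Section WeakLaw.
Variables (R : realType) (p : nat -> R).
Hypothesis p_ge0 : forall j, 0 <= p j.
Hypothesis p_sum1 : (\esum_(j in [set: nat]) (p j)%:E)%E = 1%E.
Variable (m : nat).

Fixpoint blocksum (f : seq nat -> R) (N : nat) (w : seq nat) : R :=
  if N is N'.+1 then f (take m w) + blocksum f N' (drop m w) else 0.

Lemma blocksum_ge0 f N w : (forall w, 0 <= f w) -> 0 <= blocksum f N w.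
Proof. by move=> f0; elim: N w => //= N IH w; rewrite addr_ge0. Qed.

Lemma blocksumD f1 f2 N w :
  blocksum (fun w => f1 w + f2 w) N w = blocksum f1 N w + blocksum f2 N w.
Proof. by elim: N w => [|N IH] w /=; rewrite ?addr0// IH addrACA. Qed.

Lemma wexp_block N (F : R -> R -> R) f : (forall a b, 0 <= a -> 0 <= b -> 0 <= F a b) ->
  (forall w, 0 <= f w) ->
  wexp p (N.+1 * m) (fun w => (F (f (take m w)) (blocksum f N (drop m w)))%:E) =
  wexp p m (fun w => wexp p (N * m) (fun w' => (F (f w) (blocksum f N w'))%:E)).
Proof.
move=> F0 f0; rewrite mulSn wexp_cat; apply: eq_wexp => w sw.
apply: eq_wexp => w' _; rewrite take_size_cat// drop_size_cat//.
Qed.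

Lemma wexp_fin_add n (F : seq nat -> R) (c : R) : (forall w, 0 <= F w) -> 0 <= c ->
  wexp p n (fun w => (c + F w)%:E) = (c%:E + wexp p n (fun w => (F w)%:E))%E.
Proof.
move=> F0 c0; rewrite -(wexp_cst p_ge0 p_sum1 n c) -wexpD//.
Qed.

Lemma wexp_blocksum f (mu : R) N : (forall w, 0 <= f w) ->
  wexp p m (fun w => (f w)%:E) = mu%:E ->
  wexp p (N * m) (fun w => (blocksum f N w)%:E) = (N%:R * mu)%:E.
Proof.
move=> f0 fmu; elim: N => [|N IH]; first by rewrite mul0n mul0r.
rewrite (wexp_block N (F := fun a b => a + b))//; last by move=> *; rewrite addr_ge0.
under eq_wexp => w _.
  rewrite wexp_fin_add//; last by move=> w'; exact: blocksum_ge0.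
  rewrite IH addeC.
  over.
have mu0 : 0 <= mu by rewrite -lee_fin -fmu wexp_ge0.
rewrite wexpD//; last by move=> _; rewrite lee_fin mulr_ge0.
by rewrite wexp_cst// fmu -EFinD; congr EFin; rewrite mulrS mulrDl mul1r addrC.
Qed.

(** By independence of the blocks the cross terms contribute [2 * mu * (N * mu)] at each step, and a
    squared block at most [B ^ 2]. *)
Lemma wexp_blocksum_sqr f (mu B : R) N : (forall w, 0 <= f w) -> (forall w, f w <= B) ->
  wexp p m (fun w => (f w)%:E) = mu%:E ->
  (wexp p (N * m) (fun w => (blocksum f N w ^+ 2)%:E) <= ((N%:R * mu) ^+ 2 + N%:R * B ^+ 2)%:E)%E.
Proof.
move=> f0 fB fmu; have mu0 : 0 <= mu by rewrite -lee_fin -fmu wexp_ge0.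
have B0 : 0 <= B by apply: le_trans (f0 [::]) (fB _).
elim: N => [|N IH]; first by rewrite mul0n /= !mul0r expr0n /= add0r.
rewrite (wexp_block N (F := fun a b => (a + b) ^+ 2))//; last first.
  by move=> *; rewrite exprn_ge0// addr_ge0.
apply: (@le_trans _ _ (wexp p m (fun w => ((B ^+ 2 + ((N%:R * mu) ^+ 2 + N%:R * B ^+ 2)) + 2 * (N%:R * mu) * f w)%:E))).
  apply: le_wexp => // [w|w _].
    by apply: wexp_ge0 => // w'; rewrite lee_fin exprn_ge0// addr_ge0 ?blocksum_ge0.
  apply: (@le_trans _ _ (wexp p (N * m) (fun w' => (B ^+ 2 + (2 * f w * blocksum f N w' + blocksum f N w' ^+ 2))%:E))).
    apply: le_wexp => // [w'|w' _].
      by rewrite lee_fin exprn_ge0// addr_ge0 ?blocksum_ge0.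
    rewrite lee_fin sqrrD -addrA lerD//; last by rewrite -mulrA -mulr_natl.
    by rewrite lerXn2r ?nnegrE.
  rewrite wexp_fin_add ?exprn_ge0//; last first.
    by move=> w'; rewrite addr_ge0 ?exprn_ge0 ?mulr_ge0 ?blocksum_ge0.
  rewrite -addrA EFinD leeD2l//.
  under eq_wexp do rewrite EFinD EFinM.
  rewrite wexpD//; [|by move=> w'; rewrite -EFinM lee_fin !mulr_ge0 ?blocksum_ge0
                    |by move=> w'; rewrite lee_fin exprn_ge0 ?blocksum_ge0].
  rewrite wexpZl//; last by move=> w'; rewrite lee_fin blocksum_ge0.
  rewrite (wexp_blocksum _ f0 fmu) addeC EFinD leeD//.
  by rewrite -EFinM lee_fin mulrAC.
under eq_wexp do rewrite EFinD EFinM.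
rewrite wexpD//; [|by move=> w'; rewrite lee_fin !addr_ge0 ?mulr_ge0 ?exprn_ge0
                  |by move=> w'; rewrite -EFinM lee_fin !mulr_ge0].
rewrite wexpZl// fmu wexp_cst// -EFinM -EFinD lee_fin.
by rewrite mulrS; have := sqr_ge0 mu; lra.
Qed.

(** From [(1 - a |x|) ^ 2 >= 0] follows [|x| <= 1 / a + a x ^ 2]; with [a = 1 / (N e)] the variance
    bound [N B ^ 2] gives the claim without square roots. *)
Lemma wexp_blocksum_abs f (mu B : R) N (e : R) : (forall w, 0 <= f w) -> (forall w, f w <= B) ->
  wexp p m (fun w => (f w)%:E) = mu%:E -> 0 < e ->
  (wexp p (N * m) (fun w => `|blocksum f N w - N%:R * mu|%:E) <= (N%:R * e + B ^+ 2 / e)%:E)%E.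
Proof.
move=> f0 fB fmu e0.
have [->|Npos] := posnP N.
  rewrite mul0n /= mul0r subr0 normr0 lee_fin mul0r add0r divr_ge0 ?exprn_ge0 ?(ltW e0)//.
  exact: le_trans (f0 [::]) (fB _).
have mu0 : 0 <= mu by rewrite -lee_fin -fmu wexp_ge0.
have N0 : 0 < N%:R :> R by rewrite ltr0n.
pose a := (N%:R * e)^-1; have a0 : 0 < a by rewrite invr_gt0 mulr_gt0.
have sq_le : (wexp p (N * m) (fun w => ((blocksum f N w - N%:R * mu) ^+ 2)%:E) <= (N%:R * B ^+ 2)%:E)%E.
  set V := wexp _ _ _.
  (* The variance identity, arranged so that both sides are sums of nonnegative terms. *)
  have VE : (V + (2 * (N%:R * mu) * (N%:R * mu))%:E =
      wexp p (N * m) (fun w => (blocksum f N w ^+ 2)%:E) + ((N%:R * mu) ^+ 2)%:E)%E.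
    rewrite -[in RHS](wexp_cst p_ge0 p_sum1 (N * m)) -[in RHS]wexpD//; last 2 first.
    - by move=> w; rewrite lee_fin exprn_ge0// blocksum_ge0.
    - by move=> w; rewrite lee_fin exprn_ge0// mulr_ge0// ltW.
    rewrite [in LHS]EFinM -(wexp_blocksum N f0 fmu) -wexpZl//; last by move=> w; rewrite lee_fin blocksum_ge0.
    rewrite /V -wexpD//; last 2 first.
    - by move=> w; rewrite lee_fin sqr_ge0.
    - by move=> w; rewrite -EFinM lee_fin !mulr_ge0 ?blocksum_ge0// ltW.
    by apply: eq_wexp => w _; rewrite -EFinM -!EFinD; congr EFin; ring.
  have := leeD (wexp_blocksum_sqr N f0 fB fmu) (lexx ((N%:R * mu) ^+ 2)%:E).
  rewrite -VE -EFinD -leeBrDr// -EFinB => /le_trans; apply.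
  by rewrite lee_fin; lra.
apply: (@le_trans _ _ (wexp p (N * m) (fun w => (a^-1 + a * (blocksum f N w - N%:R * mu) ^+ 2)%:E))).
  apply: le_wexp => // w _; rewrite lee_fin.
  set x := blocksum _ _ _ - _.
  have : 0 <= (1 - a * `|x|) ^+ 2 by rewrite sqr_ge0.
  have -> : (1 - a * `|x|) ^+ 2 = 1 - 2 * a * `|x| + a * (a * x ^+ 2).
    by rewrite -(real_normK (num_real x)); ring.
  move=> h; have h2 : 0 <= a * `|x| by rewrite mulr_ge0// ltW.
  by rewrite -(ler_pM2l a0) mulrDr mulfV ?gt_eqF//; lra.
have aV : 0 <= a^-1 by apply/ltW; rewrite invr_gt0.
rewrite wexp_fin_add//; last by move=> w; rewrite mulr_ge0 ?sqr_ge0 ?(ltW a0).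
under eq_wexp do rewrite EFinM.
rewrite wexpZl//; last by move=> w; rewrite lee_fin sqr_ge0.
rewrite /a invrK EFinD; apply: leeD => //.
apply: (le_trans (lee_wpmul2l _ sq_le)); first by rewrite lee_fin invr_ge0 mulr_ge0 ?ltW.
by rewrite -EFinM lee_fin invfM mulrACA mulVf ?gt_eqF// mul1r mulrC.
Qed.

(** Truncate: [f1] lives on finitely many words and is bounded, while [f2] has mean at most [e / 4]
    and is estimated by its mean alone. *)
Lemma weak_law_L1 f (mu e : R) : (forall w, 0 <= f w) ->
  wexp p m (fun w => (f w)%:E) = mu%:E -> 0 < e ->
  exists N0, forall N, (N0 <= N)%N ->
    (wexp p (N * m) (fun w => `|blocksum f N w - N%:R * mu|%:E) <= (N%:R * e)%:E)%E.
Proof.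
move=> f0 fmu e0; have e40 : 0 < e / 4 by rewrite divr_gt0.
have [|||A HA] := @wexp_tail _ p p_ge0 m (fun w => (f w)%:E) (e / 4) => //.
  by rewrite fmu ltry.
pose f1 w := if w \in A then f w else 0; pose f2 w := if w \in A then 0 else f w.
have f10 w : 0 <= f1 w by rewrite /f1; case: ifP.
have f20 w : 0 <= f2 w by rewrite /f2; case: ifP.
have fE : f = fun w => f1 w + f2 w.
  by apply/funext => w; rewrite /f1 /f2; case: ifP; rewrite ?addr0 ?add0r.
pose B := \big[Num.max/0]_(w <- A) f w.
have f1B w : f1 w <= B.
  rewrite /f1; case: ifP => wA; first exact: (@le_bigmax_seq _ _ _ _ _ _ predT).
  exact: bigmax_ge_id.
have le_mu : (wexp p m (fun w => (f1 w)%:E) + wexp p m (fun w => (f2 w)%:E) = mu%:E)%E.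
  by rewrite -fmu -wexpD//; apply: eq_wexp => w _; rewrite [in RHS]fE.
have fin1 : wexp p m (fun w => (f1 w)%:E) \is a fin_num.
  rewrite ge0_fin_numE ?wexp_ge0// (@le_lt_trans _ _ mu%:E) ?ltry//.
  by rewrite -le_mu leeDl// wexp_ge0.
have fin2 : wexp p m (fun w => (f2 w)%:E) \is a fin_num.
  rewrite ge0_fin_numE ?wexp_ge0// (@le_lt_trans _ _ mu%:E) ?ltry//.
  by rewrite -le_mu leeDr// wexp_ge0.
have [mu1 mu1E] : exists mu1, wexp p m (fun w => (f1 w)%:E) = mu1%:E.
  by exists (fine (wexp p m (fun w => (f1 w)%:E))); rewrite fineK.
have [mu2 mu2E] : exists mu2, wexp p m (fun w => (f2 w)%:E) = mu2%:E.
  by exists (fine (wexp p m (fun w => (f2 w)%:E))); rewrite fineK.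
have muE : mu1 + mu2 = mu by apply/eqP; rewrite -eqe EFinD -mu1E -mu2E le_mu.
have mu2_ge0 : 0 <= mu2 by rewrite -lee_fin -mu2E wexp_ge0.
have mu2_le : mu2 <= e / 4.
  rewrite -lee_fin -mu2E; apply: le_trans HA; apply: le_wexp => // w _.
  by rewrite /f2; case: ifP.
pose N0 := (Num.truncn (B ^+ 2 / (e / 4) / (e / 4))).+1.
exists N0 => N NN0.
have NB : B ^+ 2 / (e / 4) <= N%:R * (e / 4).
  rewrite -ler_pdivrMr//; apply: (@le_trans _ _ N0%:R); last by rewrite ler_nat.
  by apply/ltW/truncnS_gt.
apply: (@le_trans _ _ (wexp p (N * m) (fun w => (`|blocksum f1 N w - N%:R * mu1|%:E +
    (N%:R * mu2 + blocksum f2 N w)%:E)%E))).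
  apply: le_wexp => // w _; rewrite -EFinD lee_fin fE blocksumD -muE.
  have -> : blocksum f1 N w + blocksum f2 N w - N%:R * (mu1 + mu2) =
    (blocksum f1 N w - N%:R * mu1) + (blocksum f2 N w - N%:R * mu2) by ring.
  apply: (le_trans (ler_normD _ _)); rewrite lerD2l.
  apply: (le_trans (ler_normB _ _)); rewrite !ger0_norm ?blocksum_ge0 ?mulr_ge0//.
  by rewrite addrC.
rewrite wexpD//; last by move=> w; rewrite lee_fin addr_ge0 ?blocksum_ge0 ?mulr_ge0.
rewrite wexp_fin_add ?mulr_ge0//; last by move=> w; exact: blocksum_ge0.
rewrite (wexp_blocksum N f20 mu2E).
apply: (@le_trans _ _ ((N%:R * (e / 4) + B ^+ 2 / (e / 4))%:E + ((N%:R * mu2)%:E + (N%:R * mu2)%:E))%E).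
  by rewrite leeD2r// wexp_blocksum_abs.
have : N%:R * mu2 <= N%:R * (e / 4) by rewrite ler_wpM2l.
by rewrite -!EFinD lee_fin; lra.
Qed.

End WeakLaw.

(** The limit is the infimum of the quotients. The further clauses record this at finite times,
    where [lognorm_L1] needs it. *)
Lemma fekete (R : realType) (a : nat -> R) : (forall n, 0 <= a n) ->
  (forall m n, a (m + n)%N <= a m + a n) ->
  exists2 l : R, a n / n%:R @[n --> \oo] --> (l : R^o) &
    0 <= l /\ (forall n, n%:R * l <= a n) /\
    (forall e, 0 < e -> exists2 m, (0 < m)%N & a m <= m%:R * (l + e)).
Proof.
move=> a0 aD.
pose S := [set a n / n%:R | n in [set n | 0 < n]%N].
have infS : has_inf S.
  split; first by exists (a 1%N / 1); exists 1%N.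
  by exists 0 => _ [n _ <-]; rewrite divr_ge0.
pose l := inf S.
have l0 : 0 <= l by apply: lb_le_inf infS.1 _ => _ [n _ <-]; rewrite divr_ge0.
have le_l n : n%:R * l <= a n.
  have [->|n0] := posnP n; first by rewrite mul0r.
  by rewrite mulrC -ler_pdivlMr ?ltr0n//; apply: ge_inf infS.2 _ _; exists n.
have near_l e : 0 < e -> exists2 m, (0 < m)%N & a m <= m%:R * (l + e).
  move=> e0; have [_ [m m0 <-] /ltW] := inf_adherent e0 infS; exists m => //.
  by rewrite mulrC -ler_pdivrMr ?ltr0n.
exists l; last by [].
apply/cvgrPdist_le => e e0; have e20 : 0 < e / 2 by rewrite divr_gt0.
have [m m0 Hm] := near_l _ e20.
have mR : 0 < m%:R :> R by rewrite ltr0n.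
have aM q r : a (q * m + r)%N <= q%:R * a m + a r.
  elim: q => [|q IH]; first by rewrite mul0n add0n mul0r add0r.
  rewrite mulSn -addnA (le_trans (aD _ _))// mulrS mulrDl mul1r -addrA lerD2l//.
pose C := \sum_(r < m) a r.
have C0 : 0 <= C by apply: sumr_ge0.
have aC r : (r < m)%N -> a r <= C.
  by move=> rm; rewrite /C (bigD1 (Ordinal rm))//= lerDl sumr_ge0.
near=> n.
have n0 : (0 < n)%N by near: n; exists 1%N.
have nC : C <= n%:R * (e / 2).
  near: n; exists (Num.truncn (C / (e / 2))).+1 => // n /= Cn.
  rewrite -ler_pdivrMr//; apply: (@le_trans _ _ (Num.truncn (C / (e / 2))).+1%:R).
    exact/ltW/truncnS_gt.
  by rewrite ler_nat.
have nR : 0 < n%:R :> R by rewrite ltr0n.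
have lea : l <= a n / n%:R by rewrite ler_pdivlMr// mulrC.
rewrite distrC ger0_norm ?subr_ge0// lerBlDr ler_pdivrMr//.
rewrite {1}(divn_eq n m); apply: (le_trans (aM _ _)).
apply: (@le_trans _ _ (n%:R * (l + e / 2) + n%:R * (e / 2))); last by lra.
apply: lerD; last by apply: le_trans nC; apply: aC; rewrite ltn_mod.
apply: (@le_trans _ _ ((n %/ m)%:R * (m%:R * (l + e / 2)))); first by rewrite ler_wpM2l.
rewrite mulrA -natrM ler_wpM2r ?ler_nat ?leq_trunc_div//.
by rewrite addr_ge0// ltW.
Unshelve. all: by end_near. Qed.

(** * The Lyapunov exponent and the growth of traces *)

Section Lyapunov.
Variables (R : realType) (k : fieldType) (v : k -> R).
Hypothesis hv : complete_nonarch_abs v.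
Variables (p : nat -> R) (g : nat -> 'M[k]_2).
Hypothesis p_ge0 : forall j, 0 <= p j.
Hypothesis p_sum1 : (\esum_(j in [set: nat]) (p j)%:E)%E = 1%E.
Hypothesis hSL : forall j, \det (g j) = 1.
Hypothesis moment : (\esum_(j in [set: nat]) (p j * ln (mnorm v (g j)))%:E < +oo)%E.

Definition lognorm (w : seq nat) : R := ln (mnorm v (gam g w)).

Lemma lognorm_ge0 w : 0 <= lognorm w.
Proof. by rewrite ln_ge0// mnorm_ge1// det_gam. Qed.

Lemma lognorm_cat w w' : lognorm (w ++ w') <= lognorm w + lognorm w'.
Proof.
have d u := det_gam hSL u; have m0 u := mnorm_gt0 hv (d u).
rewrite /lognorm -lnM ?posrE// ler_ln ?posrE ?mulr_gt0//.
by rewrite gam_cat mnormM.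
Qed.

Lemma ElogE n : Elog v p g n = wexp p n (fun w => (lognorm w)%:E).
Proof.
rewrite /Elog wexp_esum//; last by move=> w; rewrite lee_fin lognorm_ge0.
by apply: eq_esum => t _; rewrite weightE rnE EFinM.
Qed.

Lemma lognorm_moment1 : (wexp p 1 (fun w => (lognorm w)%:E) < +oo)%E.
Proof.
rewrite /= nneseries_esumT; last first.
  by move=> j; rewrite mule_ge0 ?lee_fin ?lognorm_ge0.
rewrite (eq_esum (b := fun j => (p j * ln (mnorm v (g j)))%:E))// => j _.
by rewrite EFinM /lognorm gam_cons gam_nil mulr1.
Qed.

Lemma wexp_lognormD m n : (wexp p (m + n) (fun w => (lognorm w)%:E) <=
  wexp p m (fun w => (lognorm w)%:E) + wexp p n (fun w => (lognorm w)%:E))%E.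
Proof.
have l0 w : (0 <= (lognorm w)%:E)%E by rewrite lee_fin lognorm_ge0.
have -> : wexp p m (fun w => (lognorm w)%:E) =
    wexp p m (fun w => wexp p n (fun=> (lognorm w)%:E)).
  by apply: eq_wexp => w _; rewrite wexp_cst.
have -> : wexp p n (fun w => (lognorm w)%:E) =
    wexp p m (fun=> wexp p n (fun w => (lognorm w)%:E)).
  by rewrite wexp_swap//; apply: eq_wexp => w _; rewrite wexp_cst.
rewrite -wexpD//; [|by move=> w; exact: wexp_ge0..].
rewrite wexp_cat; apply: le_wexp => // [w|w _]; first exact: wexp_ge0.
rewrite -wexpD//; apply: le_wexp => // w' _.
by rewrite -EFinD lee_fin lognorm_cat.
Qed.

Lemma lognorm_moment n : (wexp p n (fun w => (lognorm w)%:E) \is a fin_num)%E.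
Proof.
rewrite ge0_fin_numE; last by apply: wexp_ge0 => // w; rewrite lee_fin lognorm_ge0.
elim: n => [|n IH]; first by rewrite /= ltry.
by rewrite -addn1 (le_lt_trans (wexp_lognormD _ _))// lte_add_pinfty// lognorm_moment1.
Qed.

Let a n : R := fine (Elog v p g n).

Lemma aE n : wexp p n (fun w => (lognorm w)%:E) = (a n)%:E.
Proof. by rewrite /a ElogE fineK// lognorm_moment. Qed.

Lemma chi_spec : 0 <= chi v p g /\ (forall n, n%:R * chi v p g <= a n) /\
  (forall e, 0 < e -> exists2 m, (0 < m)%N & a m <= m%:R * (chi v p g + e)).
Proof.
have [|m n|l al H] := @fekete R a.
- by move=> n; rewrite -lee_fin -aE; apply: wexp_ge0 => // w; rewrite lee_fin lognorm_ge0.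
- by rewrite -lee_fin EFinD -!aE wexp_lognormD.
suff -> : chi v p g = l by [].
exact/cvg_lim.
Qed.

Lemma lognorm_blocksum m N w : size w = (N * m)%N -> lognorm w <= blocksum m lognorm N w.
Proof.
elim: N w => [|N IH] w /= sw.
  by move/size0nil: sw => ->; rewrite /lognorm gam_nil (_ : mnorm v 1 = 1) ?ln1//;
    apply/eqP; rewrite eq_le mnorm_ge1 ?det1// andbT mnorm_le// => i j;
    rewrite mxE; case: (_ == _); rewrite ?v1 ?v0.
rewrite -{1}(cat_take_drop m w) (le_trans (lognorm_cat _ _))// lerD2l IH// size_drop sw.
by rewrite mulSn addKn.
Qed.

(** Subadditivity and the law for blocks bound the excess of [lognorm] over [n chi] from above.
    Since the mean is never below [n chi], a small positive part forces a small negative part. *)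
Lemma lognorm_L1 (e : R) : 0 < e -> exists n0, forall n, (n0 <= n)%N ->
  (wexp p n (fun w => `|lognorm w - n%:R * chi v p g|%:E) <= (n%:R * e)%:E)%E.
Proof.
move=> e0; have e80 : 0 < e / 8 by rewrite divr_gt0.
have [chi0 [chi_le chi_near]] := chi_spec; set c := chi v p g in chi0 chi_le chi_near *.
have a0 n : 0 <= a n by apply: le_trans (chi_le n); rewrite mulr_ge0.
have [m m0 Hm] := chi_near _ e80.
have mR : 0 < m%:R :> R by rewrite ltr0n.
have me0 : 0 < m%:R * (e / 8) by rewrite mulr_gt0.
have [N0 HN0] := weak_law_L1 p_ge0 p_sum1 lognorm_ge0 (aE m) me0.
pose C := \sum_(r < m) a r.
have aC r : (r < m)%N -> a r <= C.
  by move=> rm; rewrite /C (bigD1 (Ordinal rm))//= lerDl sumr_ge0.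
pose n1 := (Num.truncn (C / (e / 8))).+1.
exists (maxn (N0 * m) n1) => n; rewrite geq_max => /andP[N0n n1n].
pose N := (n %/ m)%N; pose q := (n %% m)%N.
have NN0 : (N0 <= N)%N by rewrite leq_divRL.
have nE : n = (N * m + q)%N by apply: divn_eq.
have qC : a q <= n%:R * (e / 8).
  apply: (@le_trans _ _ C); first by apply: aC; rewrite ltn_mod.
  rewrite -ler_pdivrMr//; apply: (@le_trans _ _ n1%:R); last by rewrite ler_nat.
  exact/ltW/truncnS_gt.
have NmR : N%:R * m%:R <= n%:R :> R by rewrite -natrM ler_nat leq_trunc_div.
pose pos w := Num.max (lognorm w - n%:R * c) 0.
have pos0 w : 0 <= pos w by rewrite le_max lexx orbT.
have abs0 w : 0 <= `|lognorm w - n%:R * c| by [].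
(* Three errors of size [n * (e / 8)]: the fluctuation of the block sum, the excess of the block
   mean over [m chi], and the mean of the incomplete last block. *)
have posE : (wexp p n (fun w => (pos w)%:E) <= (n%:R * (3 * (e / 8)))%:E)%E.
  apply: (@le_trans _ _ ((N%:R * (m%:R * (e / 8)))%:E + ((n%:R * (e / 8))%:E + (n%:R * (e / 8))%:E))%E); last first.
    have : N%:R * (m%:R * (e / 8)) <= n%:R * (e / 8) by rewrite mulrA ler_wpM2r// ltW.
    by rewrite -!EFinD lee_fin; lra.
  rewrite {1}nE wexp_cat.
  apply: (@le_trans _ _ (wexp p (N * m) (fun w => (`|blocksum m lognorm N w - N%:R * a m|%:E + (n%:R * (e / 8) + a q)%:E)%E))).
    apply: le_wexp => // [w|w sw]; first by apply: wexp_ge0 => // w'; rewrite lee_fin.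
    rewrite -EFinD.
    apply: (@le_trans _ _ (wexp p q (fun w' => (`|blocksum m lognorm N w - N%:R * a m| + n%:R * (e / 8) + lognorm w')%:E))).
      apply: le_wexp => // [w'|w' _]; first (by rewrite lee_fin); rewrite lee_fin /pos ge_max; apply/andP; split; last first.
        by rewrite !addr_ge0 ?lognorm_ge0// mulr_ge0// ltW.
      have h1 := lognorm_cat w w'; have h2 := lognorm_blocksum sw.
      have h3 := ler_norm (blocksum m lognorm N w - N%:R * a m).
      have h4 : N%:R * a m <= n%:R * c + n%:R * (e / 8).
        apply: (@le_trans _ _ (N%:R * (m%:R * (c + e / 8)))); first by rewrite ler_wpM2l.
        by rewrite -mulrDr mulrA ler_wpM2r// addr_ge0// ltW.
      by lra.
    rewrite wexp_fin_add//; [|exact: lognorm_ge0|by rewrite addr_ge0// mulr_ge0// ltW].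
    by rewrite aE -EFinD lee_fin addrA.
  rewrite wexpD//; last by move=> w; rewrite lee_fin addr_ge0// mulr_ge0// ltW.
  rewrite wexp_cst//; apply: leeD; first exact: HN0.
  by rewrite -EFinD lee_fin lerD2l.
(* This integrates [|x| + x = 2 * max(x, 0)] for [x = lognorm w - n chi]. *)
have key : (wexp p n (fun w => `|lognorm w - n%:R * c|%:E) + (a n)%:E =
    2%:E * wexp p n (fun w => (pos w)%:E) + (n%:R * c)%:E)%E.
  rewrite -aE -(wexp_cst p_ge0 p_sum1 n (n%:R * c)) -wexpZl// -!wexpD//;
    try by move=> w; rewrite -?EFinM lee_fin ?mulr_ge0 ?lognorm_ge0.
  apply: eq_wexp => w _; rewrite -EFinM -!EFinD; congr EFin; rewrite /pos.
  by case: (leP 0 (lognorm w - n%:R * c)) => h; [rewrite ger0_norm//|rewrite ltr0_norm//]; lra.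
have : (wexp p n (fun w => `|lognorm w - n%:R * c|%:E) + (a n)%:E <=
    2%:E * wexp p n (fun w => (pos w)%:E) + (a n)%:E)%E.
  by rewrite key leeD2l// lee_fin.
rewrite leeD2rE// => /le_trans; apply.
apply: (@le_trans _ _ (2%:E * (n%:R * (3 * (e / 8)))%:E)%E).
  by apply: lee_wpmul2l => //; rewrite lee_fin.
rewrite -EFinM lee_fin.
have : 0 <= n%:R * e by rewrite mulr_ge0// ltW.
lra.
Qed.

Hypothesis hne : non_elementary v (gen_group [set g j | j in [set j | 0 < p j]]).

(** On the likely event the trace is the norm times a pairing between [d] and 1, whose logarithm is
    bounded and disappears after division by [n]. *)
Lemma trace_growth (eps : R) : 0 < eps ->
  Prob p g n [set h | \tr h != 0 /\ `|ln (v (\tr h)) / n%:R - chi v p g| < eps]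
    @[n --> \oo] --> 1%E.
Proof.
move=> eps0; under eq_cvg do rewrite ProbE//.
apply: (wprob_cvg1 p_ge0 p_sum1
  (A := fun n => [set w | \tr (gam g w) != 0 /\ `|ln (v (\tr (gam g w))) / n%:R - chi v p g| < eps])).
move=> e e0; have e30 : 0 < e / 3 by rewrite divr_gt0.
have [d d0 [n1 H1]] := transversal hv p_ge0 p_sum1 hSL hne e30.
have [n2 H2] := norm_grows hv p_ge0 p_sum1 hSL hne d^-1 e30.
have eps20 : 0 < eps / 2 by rewrite divr_gt0.
have ee0 : 0 < (eps / 2) * (e / 3) by rewrite mulr_gt0.
have [n3 H3] := lognorm_L1 ee0.
pose n4 := (Num.truncn (`|ln d| / (eps / 2))).+1.
exists (maxn (maxn n1 n2) (maxn n3 n4)) => n; rewrite !geq_max => /andP[/andP[n1n n2n] /andP[n3n n4n]].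
have n0 : 0 < n%:R :> R by rewrite ltr0n (leq_trans _ n4n).
have d4 : `|ln d| < n%:R * (eps / 2).
  rewrite -ltr_pdivrMr//; apply: (@lt_le_trans _ _ n4%:R); last by rewrite ler_nat.
  exact: truncnS_gt.
pose B := [set w | n%:R * (eps / 2) <= `|lognorm w - n%:R * chi v p g|].
have PB : (wprob p n B <= (e / 3)%:E)%E.
  have ne0 : 0 < n%:R * (eps / 2) by rewrite mulr_gt0.
  have := le_trans (wprob_markov p_ge0 n ne0 (fun w => normr_ge0 (lognorm w - n%:R * chi v p g))) (H3 n n3n).
  by rewrite (mulrA n%:R (eps / 2)) [X in (_ <= X)%E]EFinM lee_pmul2l// lte_fin.
have := leeD (H1 n n1n) (leeD (H2 n n2n) PB).
rewrite -!EFinD (_ : e / 3 + (e / 3 + e / 3) = e); last by field.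
apply: le_trans; apply: le_trans (leeD (lexx _) (wprobU p_ge0 _ _ _)).
apply: le_trans (wprobU p_ge0 _ _ _).
apply: le_wprob => // w _ /= bad.
have [tv|tv] := ltP (v (dot (repv hv (gam g w)) (attv hv (gam g w)))) d; first by left.
have [ns|ns] := leP (mnorm v (gam g w)) d^-1; first by right; left.
right; right; rewrite /B /= leNgt; apply/negP => close; apply: bad.
have dw := det_gam hSL w; have m0 := mnorm_gt0 hv dw.
have [trE hyp] := tr_dominant dw d0 ns tv.
have tv0 := lt_le_trans d0 tv.
split; first by rewrite -(v_gt0 hv) trE mulr_gt0.
rewrite trE lnM ?posrE// -/(lognorm w).
have tv1 : v (dot (repv hv (gam g w)) (attv hv (gam g w))) <= 1.
  by apply: (le_trans (v_dot hv _ _)); rewrite vn_repv ?vn_attv ?mulr1.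
have lnd : `|ln (v (dot (repv hv (gam g w)) (attv hv (gam g w))))| <= `|ln d|.
  rewrite !ler0_norm ?ln_le0 ?(le_trans tv)// lerN2 ler_ln ?posrE//.
have -> : (lognorm w + ln (v (dot (repv hv (gam g w)) (attv hv (gam g w))))) / n%:R - chi v p g =
   ((lognorm w - n%:R * chi v p g) + ln (v (dot (repv hv (gam g w)) (attv hv (gam g w))))) / n%:R.
  by field; rewrite gt_eqF.
rewrite normrM (@ger0_norm _ (n%:R^-1)) ?invr_ge0 ?(ltW n0)// ltr_pdivrMr//.
by apply: (le_lt_trans (ler_normD _ _)); lra.
Qed.

End Lyapunov.

(** * The Berkovich line and the action on it *)

Lemma fmap_ultra (T U : choiceType) (f : T -> U) (F : set_system T) :
  UltraFilter F -> UltraFilter (f @ F).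
Proof.
move=> UF; have PF := @ultra_proper _ _ UF.
split; first exact: fmap_proper_filter.
move=> G PG FG; apply/seteqP; split=> [A GA|]; last exact: FG.
have [//|FA] := in_ultra_setVsetC (f @^-1` A) UF.
have /FG GA' : (f @ F) (~` A) by exact: FA.
have : G (A `&` ~` A) by exact: filterI.
by rewrite setICr => /filter_not_empty.
Qed.

Section BerkovichTopology.
Variables (R : realType) (k : fieldType) (v : k -> R).
Hypothesis hv : complete_nonarch_abs v.

Lemma A1an_seminorm (s : A1an v) : is_mseminorm v (set_val s).
Proof. exact: (set_valP s). Qed.

Definition mkA1 (x : {poly k} -> R) (Hx : is_mseminorm v x) : A1an v :=
  exist (fun y : PtwsFun R k => y \in [set y | is_mseminorm v y]) x (mem_set Hx).

Lemma mkA1E x Hx f : set_val (@mkA1 x Hx) f = x f.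
Proof. by []. Qed.

Lemma A1an_eq (s t : A1an v) : (forall f, set_val s f = set_val t f) -> s = t.
Proof. by move=> st; apply: val_inj; apply/funext => f; exact: st. Qed.

Lemma cvg_A1an (F : set_system (A1an v)) (t : A1an v) : Filter F ->
  (forall f (e : R), 0 < e -> F [set s | `|set_val t f - set_val s f| < e]) -> F --> t.
Proof.
move=> FF H U [_ [[W oW <-] Wt WU]].
apply: filterS WU _.
pose G : set_system (PtwsFun R k) := set_val @ F.
have FG : Filter G by exact: fmap_filter.
suff : G --> (set_val t : PtwsFun R k).
  by apply; apply: open_nbhs_nbhs.
apply/cvg_sup => f V [_ [[B oB <-] Bt BV]].
have /nbhs_ballP[e /= e0 eB] : nbhs (set_val t f : R^o) B by apply: open_nbhs_nbhs.
suff : F (set_val @^-1` V) by [].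
by apply: filterS (H f e e0) => s /= sE; apply: BV; exact: eB.
Qed.

Lemma ev_continuous f : continuous (fun s : A1an v => set_val s f : R^o).
Proof.
move=> s U sU.
have : nbhs (set_val s : PtwsFun R k) [set x : PtwsFun R k | U (x f)].
  exact: (@proj_continuous {poly k} (fun=> Rtop R) f (set_val s) U sU).
exact: (@initial_continuous (A1an v) (PtwsFun R k) set_val).
Qed.

Section Convergence.
Variables (I : Type) (F : set_system I) (FF : Filter F) (x : I -> P1an v).

Lemma cvg_P1an_Some (s : A1an v) :
  (forall f (e : R), 0 < e -> F [set i | exists2 t, x i = Some t & `|set_val s f - set_val t f| < e]) ->
  x @ F --> (Some s : P1an v).
Proof.
move=> H U /= sU.
pose t i : A1an v := if x i is Some t then t else s.
have Ft : t @ F --> s.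
  apply: cvg_A1an => f e e0.
  change (F [set i | `|set_val s f - set_val (t i) f| < e]).
  apply: filterS (H f e e0) => i [u xu ue].
  by rewrite /= /t xu.
have H1 : F [set i | U (Some (t i))].
  by have /Ft : nbhs s (Some @^-1` U) by exact: sU.
change (F (x @^-1` U)).
apply: filterS (filterI H1 (H 0 1 ltr01)) => i /= [Ui [u xu _]].
by move: Ui; rewrite /t xu.
Qed.

Lemma P1an_cvg_Some (s : A1an v) : x @ F --> (Some s : P1an v) ->
  forall f (e : R), 0 < e -> F [set i | exists2 t, x i = Some t & `|set_val s f - set_val t f| < e].
Proof.
move=> H f e e0.
have : nbhs (Some s : P1an v) (Some @` [set t : A1an v | `|set_val s f - set_val t f| < e]).
  apply: one_point_compactification_some_nbhs.
  have /cvgrPdist_lt /(_ e e0) := @ev_continuous f s.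
  by [].
move=> /H HF; have {}HF : F (x @^-1` (Some @` [set t : A1an v | `|set_val s f - set_val t f| < e])) by [].
by apply: filterS HF => i [t tE xE]; exists t.
Qed.

(** Evaluation at [X] is bounded on a compact set, so a neighbourhood of infinity contains all
    points where it exceeds some bound. *)
Lemma cvg_P1an_None :
  (forall M : R, F [set i | forall t, x i = Some t -> M < set_val t 'X]) ->
  x @ F --> (None : P1an v).
Proof.
move=> H U [K [cK clK] KU].
have [M HM] : exists M : R, forall s, K s -> set_val s 'X <= M.
  have := continuous_compact (continuous_subspaceT (@ev_continuous 'X)) cK.
  move=> /compact_bounded [M [_ HM]]; exists (M + 1) => s Ks.
  apply: (le_trans (ler_norm _)); apply: HM; first by rewrite ltrDl.
  by exists s.
suff : F (x @^-1` U) by [].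
apply: filterS (H M) => i Hi; apply: KU.
case xi: (x i) => [t|]; last by right.
left; exists t => // Kt; have := Hi t xi.
by rewrite ltNge HM.
Qed.

End Convergence.

(** A bound on [X] bounds each polynomial uniformly in the seminorm, which places discs inside a
    product of compact intervals. *)
Lemma msem_bound f (M : R) : 0 <= M -> exists C : R, forall S : {poly k} -> R, is_mseminorm v S ->
  S 'X <= M -> S f <= C.
Proof.
move=> M0; elim/poly_ind: f => [|f c [C HC]].
  by exists 0 => S [SC _ _ _] _; rewrite SC v0.
exists (Num.max C 0 * M + v c) => S sS SX; have [SC S0 SM SD] := sS.
apply: (le_trans (SD _ _)); rewrite SC SM lerD2r//.
apply: ler_pM => //; rewrite le_max HC//.
Qed.

Lemma msem_sub S f h : is_mseminorm v S -> `|S f - S h| <= S (f - h).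
Proof.
move=> [SC S0 SM SD].
have SN a : S (- a) = S a.
  have -> : - a = (-1)%:P * a by rewrite polyCN mulN1r.
  by rewrite SM SC vN1// mul1r.
have le a b : S a - S b <= S (a - b).
  by rewrite lerBlDr -{1}(subrK b a); apply: SD.
by rewrite ler_norml le andbT lerNl opprB -(SN (f - h)) opprB.
Qed.

(** Along an ultrafilter every evaluation converges by [msem_bound], and the conditions defining a
    multiplicative seminorm pass to the limit. *)
Lemma compact_disc (M : R) : compact [set s : A1an v | set_val s 'X <= M].
Proof.
have [M0|M0] := leP 0 M; last first.
  have -> : [set s : A1an v | set_val s 'X <= M] = set0.
    apply/seteqP; split=> // s /= sM.
    have [_ S0 _ _] := A1an_seminorm s.
    by have := lt_le_trans M0 (S0 'X); rewrite ltNge sM.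
  exact: compact0.
rewrite compact_ultra => F UF FM.
have lim f : exists l : R, (fun s : A1an v => set_val s f : R^o) @ F --> (l : R^o).
  have [C HC] := msem_bound f M0.
  have cC : compact (`[0, C]%classic : set R^o) by exact: segment_compact.
  rewrite compact_ultra in cC.
  have UG : UltraFilter ((fun s : A1an v => set_val s f : R^o) @ F) by exact: fmap_ultra.
  have [|l [_ lF]] := cC _ UG; last by exists l.
  suff : F [set s | set_val s f \in `[0, C]] by [].
  apply: filterS FM => s /= sM; rewrite in_itv /=.
  by have [_ S0 _ _] := A1an_seminorm s; rewrite S0 HC//; exact: A1an_seminorm.
have [x Hx] := choice lim.
have PF : ProperFilter F by exact: ultra_proper.
have limE f l : (fun s : A1an v => set_val s f : R^o) @ F --> (l : R^o) -> x f = l.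
  by move=> fl; apply: (cvg_unique _ (Hx f) fl) => //; exact: norm_hausdorff.
have sx : is_mseminorm v x.
  split.
  - move=> c; apply: limE.
    rewrite (_ : (fun s : A1an v => _) = fun=> v c); first exact: cvg_cst.
    by apply/funext => s; have [-> _ _ _] := A1an_seminorm s.
  - move=> f; apply: (ler_cvg_to (@cvg_cst _ (0 : R^o) _ F _) (Hx f)).
    by apply: nearW => s; have [_ S0 _ _] := A1an_seminorm s.
  - move=> f h; apply: limE.
    rewrite (_ : (fun s : A1an v => _) = fun s : A1an v => set_val s f * set_val s h).
      exact: cvgM (Hx f) (Hx h).
    by apply/funext => s; have [_ _ -> _] := A1an_seminorm s.
  - move=> f h; apply: (ler_cvg_to (Hx (f + h)) (cvgD (Hx f) (Hx h))).
    by apply: nearW => s; have [_ _ _ SD] := A1an_seminorm s; exact: SD.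
exists (mkA1 sx); split.
  rewrite /= mkA1E; exact: (ler_cvg_to (Hx 'X) (@cvg_cst _ (M : R^o) _ F _)).
apply: cvg_A1an => f e e0; rewrite mkA1E.
by have /cvgrPdist_lt /(_ e e0) := Hx f.
Qed.

Lemma P1an_cvg_None (I : Type) (F : set_system I) (FF : Filter F) (x : I -> P1an v) :
  x @ F --> (None : P1an v) ->
  forall M : R, F [set i | forall t, x i = Some t -> M < set_val t 'X].
Proof.
move=> H M.
pose K := [set s : A1an v | set_val s 'X <= M].
have clK : closed K.
  apply: (@closed_comp _ _ (fun s : A1an v => set_val s 'X : R^o) [set y : R^o | y <= M]).
    by move=> s _; exact: ev_continuous.
  exact: closed_le.
have : nbhs (None : P1an v) (Some @` (~` K) `|` [set None]).
  by exists K => //; split => //; exact: compact_disc.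
move=> /H HF; have {}HF : F (x @^-1` (Some @` (~` K) `|` [set None])) by [].
apply: filterS HF => i /= [[s Ks sE] t xt|-> //].
by move: xt Ks; rewrite -sE => -[->] /negP; rewrite -ltNge.
Qed.

End BerkovichTopology.

(** * Berkovich points compared with points of the projective line *)

Section BerkovichPoints.
Variables (R : realType) (k : fieldType) (v : k -> R).
Hypothesis hv : complete_nonarch_abs v.
Local Notation A1an := (A1an v).
Local Notation P1an := (P1an v).

Definition linp (x : k * k) : {poly k} := 'X * x.1%:P + x.2%:P.

(** The form [x.1 * X + x.2] evaluated at the point; at infinity, which is [[1 : 0]], only the
    leading coefficient survives. Up to a positive factor this extends [ptnorm] to the Berkovich
    line ([ptN_berk]). *)
Definition ptN (xi : P1an) : k * k -> R :=
  fun x => if xi is Some s then set_val (s : A1an) (linp x) else v x.1.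

Lemma ptN_seminorm xi : seminorm2 v (ptN xi).
Proof.
case: xi => [s|]; rewrite /ptN.
- have [SC S0 SM SD] := A1an_seminorm s; split => //.
  + move=> c x; rewrite -SC -SM; congr (set_val s _).
    by rewrite /linp /sv /= !polyCM; ring.
  + move=> x y; apply: le_trans (SD _ _); rewrite le_eqVlt; apply/orP; left; apply/eqP.
    by congr (set_val s _); rewrite /linp /padd /= !polyCD; ring.
  + by rewrite /nn lt_max /linp /= mulr0 add0r SC v1// ltr01 orbT.
- split.
  + by move=> x; exact: v_ge0.
  + by move=> c x; rewrite /= vM.
  + move=> x y /=; apply: (le_trans (vD hv _ _)); rewrite ge_max lerDl lerDr.
    by rewrite !v_ge0.
  + by rewrite /nn lt_max /= v1// ltr01.
Qed.

Lemma eval_mseminorm z : is_mseminorm v (fun f => v f.[z]).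
Proof.
split=> [c|f|f h|f h]; rewrite ?hornerC ?hornerM ?hornerD ?vM ?v_ge0//.
by apply: (le_trans (vD hv _ _)); rewrite ge_max lerDl lerDr !v_ge0.
Qed.

Lemma berk_pt_Some z : exists2 t : A1an, berk_pt v (Some z) = Some t &
  forall f, set_val t f = v f.[z].
Proof.
have : exists y : P1an, iota_rel (Some z) y.
  by exists (Some (mkA1 (eval_mseminorm z))); exists (mkA1 (eval_mseminorm z)).
by move=> /(xgetPex (None : P1an)) [t [tE Ht]]; exists t.
Qed.

Lemma berk_pt_None : berk_pt v (None : P1 k) = None.
Proof.
have : exists y : P1an, iota_rel (None : P1 k) y by exists None.
by move=> /(xgetPex (None : P1an)).
Qed.

Lemma ptN_berk y : nz y -> exists2 c : R, 0 < c &
  forall x, ptN (berk_pt v (pline y)) x = c * ptnorm v y x.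
Proof.
case: y => a b; rewrite /nz /pline /=; case: (eqVneq b 0) => [->|b0] /= ny.
  rewrite orbF in ny; exists (v a)^-1; first by rewrite invr_gt0 v_gt0.
  move=> x; rewrite berk_pt_None /ptN /ptnorm /dot /= mulr0 addr0 vM// mulrCA mulVf ?mulr1//.
  by rewrite v_eq0.
have [t -> tE] := berk_pt_Some (a / b); exists (v b)^-1; first by rewrite invr_gt0 v_gt0.
move=> x; rewrite /ptN tE -vV// -vM//; congr v.
by rewrite /linp /dot !hornerE /=; field.
Qed.

Lemma near_scale N N' (c : R) y d : 0 < c -> (forall x, N' x = c * N x) ->
  near v N' y d = near v N y d.
Proof.
move=> c0 H; rewrite /near H; have -> : nn N' = c * nn N by rewrite /nn !H maxr_pMr// ltW.
have -> : d * (c * nn N) * vn v y = c * (d * nn N * vn v y) by ring.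
by rewrite ltr_pM2l.
Qed.

Lemma near_berk x y d : nz x ->
  near v (ptN (berk_pt v (pline x))) y d = (v (wed x y) < d * vn v x * vn v y).
Proof.
by move=> nx; have [c c0 H] := ptN_berk nx; rewrite (near_scale _ _ c0 H) near_ptnorm.
Qed.

(** A seminorm almost vanishing at [X - z] almost evaluates every polynomial at [z]. The induction
    follows the Horner scheme and is uniform over seminorms and over bounded [z]. *)
Lemma msem_close f (M e : R) : 0 <= M -> 0 < e -> exists2 d : R, 0 < d &
  forall S z, is_mseminorm v S -> v z <= M -> S ('X - z%:P) < d -> S (f - f.[z]%:P) < e.
Proof.
move=> M0; elim/poly_ind: f e => [|f c IH] e e0.
  exists 1 => // S z [SC _ _ _] _ _.
  by rewrite horner0 subr0 SC v0.
have [C HC] := msem_bound hv f M0.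
have C0 : 0 <= C.
  apply: le_trans (HC _ (eval_mseminorm 0) _); first exact: v_ge0.
  by rewrite hornerX v0.
have M10 : 0 < M + 1 by rewrite ltr_wpDl.
have C10 : 0 < C + 1 by rewrite ltr_wpDl.
have e10 : 0 < e / 2 / (M + 1) by rewrite !divr_gt0.
have [d d0 Hd] := IH _ e10.
exists (Num.min 1 (Num.min d (e / 2 / (C + 1)))).
  by rewrite !lt_min ltr01 d0 !divr_gt0.
move=> S z sS zM; rewrite !lt_min => /and3P[S1 Sd Se]; have [SC S0 SM SD] := sS.
have SX : S 'X <= M + 1.
  rewrite -(subrK z%:P 'X) addrC (le_trans (SD _ _))// SC lerD// ltW//.
have fz : v f.[z] <= C by apply: (HC _ (eval_mseminorm z)); rewrite hornerX.
have -> : f * 'X + c%:P - (f * 'X + c%:P).[z]%:P =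
   (f - f.[z]%:P) * 'X + f.[z]%:P * ('X - z%:P).
  by rewrite !hornerE !(polyCD, polyCM); ring.
apply: (le_lt_trans (SD _ _)); rewrite !SM SC.
have h1 : S (f - f.[z]%:P) * S 'X < e / 2.
  apply: (@le_lt_trans _ _ (S (f - f.[z]%:P) * (M + 1))); first by rewrite ler_wpM2l.
  by rewrite -ltr_pdivlMr// Hd.
have h2 : v f.[z] * S ('X - z%:P) <= e / 2.
  apply: (@le_trans _ _ ((C + 1) * (e / 2 / (C + 1)))); last by rewrite mulrC divfK// gt_eqF.
  by apply: ler_pM; rewrite ?v_ge0 ?S0 ?(ltW Se)// (le_trans fz)// lerDl.
by lra.
Qed.

(** Replaces the triangle inequality of a metric: points asymptotically near to points of [P^1(k)]
    have the same limits as these, finite or infinite. *)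
Lemma near_cvg (I : Type) (F : set_system I) (FF : Filter F) (xi : I -> P1an) (y : I -> k * k)
  (zeta : P1an) : (forall i, nz (y i)) ->
  (forall d : R, 0 < d -> F [set i | near v (ptN (xi i)) (y i) d]) ->
  (fun i => berk_pt v (pline (y i))) @ F --> zeta -> xi @ F --> zeta.
Proof.
move=> ny nr; case: zeta => [s|] cvy.
- have cvy' := P1an_cvg_Some FF cvy.
  pose M := set_val s 'X + 1.
  have sX : 0 <= set_val s 'X by have [_ S0 _ _] := A1an_seminorm s.
  have M1 : 1 <= M by rewrite lerDr.
  have M0 : 0 < M by apply: lt_le_trans M1.
  have yE i t : berk_pt v (pline (y i)) = Some t -> (y i).2 != 0 /\
      (forall f, set_val t f = v f.[(y i).1 / (y i).2]).
    rewrite /pline; case: eqP => [_|_]; first by rewrite berk_pt_None.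
    by have [t' -> tE] := berk_pt_Some ((y i).1 / (y i).2) => -[<-].
  apply: cvg_P1an_Some => f e e0.
  have e20 : 0 < e / 2 by rewrite divr_gt0.
  have [d d0 Hd] := msem_close f (ltW M0) e20.
  (* From [d' * M <= 1 / 2] the term [S (X - z)] on the right is absorbed and the point at infinity
     excluded; from [d' * M ^ 2 <= d / 4] what remains is below [d]. *)
  pose d' := Num.min (M^-1 / 2) (d / (4 * M ^+ 2)).
  have d'0 : 0 < d' by rewrite lt_min !divr_gt0 ?invr_gt0 ?mulr_gt0 ?exprn_gt0.
  apply: filterS (filterI (nr d' d'0) (filterI (cvy' f _ e20) (cvy' 'X _ ltr01))) => i /=.
  move=> [nri [[t tE tf] [t' t'E tX]]].
  have [y20 ft] := yE i t tE.
  have tt' : t = t' by move: t'E; rewrite tE => -[].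
  set z := (y i).1 / (y i).2 in ft.
  have vz : v z <= M.
    move: tX; rewrite -tt' ft hornerX ltr_norml => /andP[h _]; rewrite /M; lra.
  have vy2 : 0 < v (y i).2 by rewrite v_gt0.
  have vny : vn v (y i) <= v (y i).2 * M.
    rewrite vn_le ler_peMr ?v_ge0// andbT.
    have -> : (y i).1 = (y i).2 * z by rewrite /z mulrC divfK.
    by rewrite vM// ler_wpM2l ?v_ge0.
  have d'M : d' * M <= 2^-1.
    by rewrite -ler_pdivlMr// mulrC ge_min lexx.
  move: nri; rewrite /near; case xiE: (xi i) => [u|]; last first.
    rewrite /nn /ptN /= v0// v1// (max_l ler01) mulr1 => lt1.
    have := lt_le_trans lt1 (ler_wpM2l (ltW d'0) vny).
    rewrite mulrCA -[ltLHS]mulr1 ltr_pM2l// => h; exfalso.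
    have : 1 < 2^-1 :> R by apply: lt_le_trans d'M.
    by lra.
  move=> lt1; have [SC S0 SM SD] := A1an_seminorm u.
  have linE : linp (perp (y i)) = (y i).2%:P * ('X - z%:P).
    rewrite /linp /perp /= polyCN.
    have -> : (y i).1 = z * (y i).2 by rewrite /z divfK.
    by rewrite polyCM; ring.
  have uX : set_val u 'X <= set_val u ('X - z%:P) + M.
    by rewrite -{1}(subrK z%:P 'X) (le_trans (SD _ _))// SC lerD2l.
  have nnu : nn (ptN (Some u)) <= set_val u ('X - z%:P) + M.
    rewrite /nn ge_max /ptN /linp /= mulr1 addr0 uX mulr0 add0r SC v1//=.
    by rewrite (le_trans M1)// lerDr.
  have lt2 : set_val u ('X - z%:P) < d' * M * (set_val u ('X - z%:P) + M).
    rewrite -(ltr_pM2l vy2); move: lt1; rewrite [X in X < _ -> _]/= linE SM SC => /lt_le_trans; apply.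
    have -> : v (y i).2 * (d' * M * (set_val u ('X - z%:P) + M)) =
       d' * (set_val u ('X - z%:P) + M) * (v (y i).2 * M) by ring.
    apply: ler_pM => //; [|exact: vn_ge0|by rewrite ler_wpM2l// ltW].
    by rewrite mulr_ge0 ?(ltW d'0)// le_max; have [-> _ _ _] := ptN_seminorm (Some u).
  have lt3 : set_val u ('X - z%:P) < d.
    have h1 : d' * M * set_val u ('X - z%:P) <= 2^-1 * set_val u ('X - z%:P) by rewrite ler_wpM2r.
    have h2 : d' * M * M <= d / 4.
      rewrite -mulrA -expr2 -ler_pdivlMr ?exprn_gt0// ge_min; apply/orP; right.
      by rewrite invfM mulrA.
    by move: lt2; rewrite mulrDr; lra.
  exists u => //.
  have h1 := Hd (set_val u) z (A1an_seminorm u) vz lt3.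
  have h2 : `|v f.[z] - set_val u f| < e / 2.
    rewrite distrC; apply: le_lt_trans h1.
    have := msem_sub hv f f.[z]%:P (A1an_seminorm u); rewrite SC.
    by [].
  move: tf; rewrite ft => tf.
  rewrite -(subrK (v f.[z]) (set_val s f)) -addrA.
  by apply: (le_lt_trans (ler_normD _ _)); rewrite [e]splitr ltrD.
- have cvy' := P1an_cvg_None hv FF cvy.
  apply: cvg_P1an_None => M.
  pose M1 := Num.max M 1.
  have M11 : 1 <= M1 by rewrite le_max lexx orbT.
  have M10 : 0 < M1 by apply: lt_le_trans M11.
  (* If [X] were at most [M1] at the point, nearness would bound [perp y] by [v y.1 / 2], and
     [M1 * v y.2] is at most the other half: together they are too small for [v y.1]. *)
  have d0 : 0 < (2 * M1)^-1 by rewrite invr_gt0 mulr_gt0.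
  apply: filterS (filterI (nr _ d0) (cvy' (2 * M1))) => i /= [nri yi] t xt.
  rewrite ltNge; apply/negP => tM.
  move: nri; rewrite /near xt; have [SC S0 SM SD] := A1an_seminorm t.
  have tM1 : set_val t 'X <= M1 by rewrite le_max tM.
  have nnt : nn (ptN (Some t)) <= M1.
    by rewrite /nn ge_max /ptN /linp /= mulr1 addr0 mulr0 add0r SC v1// tM1 M11.
  have y2le : 2 * M1 * v (y i).2 <= v (y i).1.
    have [y0|y0] := eqVneq (y i).2 0; first by rewrite y0 v0// mulr0 v_ge0.
    have [u uE uf] := berk_pt_Some ((y i).1 / (y i).2).
    have := yi u; rewrite /pline (negbTE y0) uf hornerX => /(_ uE).
    by rewrite vM// vV// ltr_pdivlMr ?v_gt0// => /ltW.
  have y10 : 0 < v (y i).1.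
    rewrite v_gt0//; apply/eqP => y1.
    move: y2le; rewrite y1 v0// pmulr_rle0 ?mulr_gt0// => y2.
    have : v (y i).2 = 0 by apply/eqP; rewrite eq_le y2 v_ge0.
    by move=> /eqP; rewrite v_eq0// => y2E; have := ny i; rewrite /nz y1 eqxx y2E.
  have vny : vn v (y i) = v (y i).1.
    rewrite /vn max_l//; apply: le_trans y2le; rewrite ler_peMl ?v_ge0//.
    by lra.
  rewrite vny => lt1.
  have lt2 : set_val t (linp (perp (y i))) < v (y i).1 / 2.
    apply: lt_le_trans lt1 _.
    rewrite mulrC ler_wpM2l ?v_ge0// (le_trans (ler_wpM2l (ltW d0) nnt))//.
    by rewrite invfM -mulrA mulVf ?mulr1// gt_eqF.
  have : v (y i).1 <= set_val t (linp (perp (y i))) + set_val t ('X * (y i).2%:P).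
    rewrite -(vN hv) -SC.
    have -> : (- (y i).1)%:P = linp (perp (y i)) + - 1%:P * ('X * (y i).2%:P).
      by rewrite /linp /perp /=; ring.
    apply: (le_trans (SD _ _)); rewrite lerD2l SM -polyCN SC vN// v1// mul1r//.
  rewrite SM SC => lt3.
  have : set_val t 'X * v (y i).2 <= M1 * v (y i).2 by rewrite ler_wpM2r ?v_ge0.
  by lra.
Qed.

Lemma berk_nbhs (y : k * k) (U : set P1an) : nz y -> nbhs (berk_pt v (pline y)) U ->
  exists2 d : R, 0 < d & forall xi, near v (ptN xi) y d -> U xi.
Proof.
move=> ny yU; apply: contrapT => /forall2NP H.
have bad n : exists xi, near v (ptN xi) y n.+1%:R^-1 /\ ~ U xi.
  have [/negP|/existsNP[xi /not_implyP[h1 h2]]] := H n.+1%:R^-1; first by rewrite invr_gt0 ltr0n.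
  by exists xi.
have [xi Hxi] := choice bad.
have : xi @ \oo --> berk_pt v (pline y).
  have cst : (fun=> berk_pt v (pline y)) @ \oo --> berk_pt v (pline y) by exact: cvg_cst.
  apply: (@near_cvg _ _ _ xi (fun=> y) _ _ _ cst) => // d d0; exists (Num.truncn d^-1) => // n /= dn.
  have [h _] := Hxi n; apply: near_mono h => //; first exact: ptN_seminorm.
  rewrite -[d]invrK lef_pV2 ?posrE ?invr_gt0//; apply: (@le_trans _ _ (Num.truncn d^-1).+1%:R).
    exact/ltW/truncnS_gt.
  by rewrite ler_nat.
by move=> /(_ U yU) [N _ /(_ N (leqnn _))]; have [_] := Hxi N.
Qed.

Lemma continuous_bounded (f : P1an -> R) : continuous (f : P1an -> R^o) ->
  exists2 C : R, 0 < C & forall xi, `|f xi| <= C.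
Proof.
move=> cf; have := continuous_compact (continuous_subspaceT cf) one_point_compactification_compact.
move=> /compact_bounded[M [_ HM]]; exists (`|M| + 1); first by rewrite ltr_wpDl.
move=> xi; apply: HM; last by exists xi.
by apply: (le_lt_trans (ler_norm M)); rewrite ltrDl.
Qed.

(** Compactness, used through an ultrafilter since sequences need not have convergent subsequences:
    a sequence of counterexamples has, by [near_cvg], a common limit for both arguments. *)
Lemma unif_continuous_berk (f : P1an -> R) : continuous (f : P1an -> R^o) ->
  forall e : R, 0 < e -> exists2 d : R, 0 < d & forall xi y, nz y -> near v (ptN xi) y d ->
    `|f xi - f (berk_pt v (pline y))| < e.
Proof.
move=> cf e e0; apply: contrapT => /forall2NP H.
have bad n : exists xy : P1an * (k * k), [/\ nz xy.2, near v (ptN xy.1) xy.2 n.+1%:R^-1 &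
    ~ `|f xy.1 - f (berk_pt v (pline xy.2))| < e].
  have [/negP|] := H n.+1%:R^-1; first by rewrite invr_gt0 ltr0n.
  move=> /existsNP[xi /existsNP[y /not_implyP[ny /not_implyP[h1 h2]]]].
  by exists (xi, y).
have [xy Hxy] := choice bad.
have [G [UG GF]] := ultraFilterLemma (_ : ProperFilter (\oo : set_system nat)).
have PG := @ultra_proper _ _ UG.
have cpt : compact [set: P1an] := one_point_compactification_compact.
rewrite compact_ultra in cpt.
have UG' : UltraFilter ((fun n => berk_pt v (pline (xy n).2)) @ G) by exact: fmap_ultra.
have [|zeta [_ Hz]] := cpt _ UG'; first exact: filterT.
have Hx : (fun n => (xy n).1) @ G --> zeta.
  apply: near_cvg Hz => [n|d d0]; first by have [] := Hxy n.
  apply: GF; exists (Num.truncn d^-1) => // n /= dn.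
  have [_ h _] := Hxy n; apply: near_mono h => //; first exact: ptN_seminorm.
  rewrite -[d]invrK lef_pV2 ?posrE ?invr_gt0//; apply: (@le_trans _ _ (Num.truncn d^-1).+1%:R).
    exact/ltW/truncnS_gt.
  by rewrite ler_nat.
have e20 : 0 < e / 2 by rewrite divr_gt0.
have f1 : (fun n => f (xy n).1 : R^o) @ G --> (f zeta : R^o).
  exact: (cvg_comp _ _ Hx (cf zeta)).
have f2 : (fun n => f (berk_pt v (pline (xy n).2)) : R^o) @ G --> (f zeta : R^o).
  exact: (cvg_comp _ _ Hz (cf zeta)).
have /cvgrPdist_lt/(_ _ e20) g1 := f1; have /cvgrPdist_lt/(_ _ e20) g2 := f2.
have : G [set n | `|f (xy n).1 - f (berk_pt v (pline (xy n).2))| < e].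
  apply: filterS (filterI g1 g2) => n /= [h1 h2].
  rewrite -(subrK (f zeta) (f (xy n).1)) -addrA (le_lt_trans (ler_normD _ _))//.
  by rewrite [e]splitr ltrD// distrC.
move=> /filter_ex[n]; have [_ _] := Hxy n.
by [].
Qed.

End BerkovichPoints.

(** * The action of matrices on the Berkovich line *)

Section Action.
Variables (R : realType) (k : fieldType) (v : k -> R).
Hypothesis hv : complete_nonarch_abs v.
Local Notation A1an := (A1an v).
Local Notation P1an := (P1an v).
Local Notation P1anB := (P1anB v).

Section Homogenization.
Variable g : 'M[k]_2.
Hypothesis dg : \det g = 1.
Local Notation numg := ('X * (g 0 0)%:P + (g 0 1)%:P).
Local Notation deng := ('X * (g 1 0)%:P + (g 1 1)%:P).

(** Homogenization in a prescribed degree [n], which makes the pull-back additive; in degree [deg f]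
    it is [hpull]. *)
Definition hpulln n (f : {poly k}) : {poly k} :=
  \sum_(i < n.+1) f`_i *: (numg ^+ i * deng ^+ (n - i)).

Lemma deng_neq0 : deng != 0.
Proof.
apply/eqP => d0.
have d1 : g 1 1 = 0.
  have := congr1 (fun f : {poly k} => f.[0]) d0.
  by rewrite !hornerE.
have c0 : g 1 0 = 0.
  have := congr1 (fun f : {poly k} => f.[1]) d0.
  by rewrite !hornerE d1 addr0.
by move: dg; rewrite det2 c0 d1 !mulr0 subrr => /eqP; rewrite eq_sym oner_eq0.
Qed.

Lemma hpullE f : hpull g f = hpulln (size f).-1 f.
Proof.
rewrite /hpull /hpulln; have [->|f0] := eqVneq f 0.
  rewrite size_poly0 big_ord0 big_ord1 coef0 scale0r//.
by rewrite prednK// lt0n size_poly_eq0.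
Qed.

Local Notation tf := (@tofrac {poly k}).

Let comm_tf : commr_rmorph (tf \o polyC) (tf numg / tf deng).
Proof. by move=> a; exact: mulrC. Qed.

Let phi : {rmorphism {poly k} -> {fraction {poly k}}} := horner_morph comm_tf.

(** In the fraction field the pull-back is the substitution of [numg / deng] times [deng ^ n]. As a
    substitution is a ring morphism, multiplicativity follows. *)
Lemma hpullnF n (f : {poly k}) : (size f <= n.+1)%N ->
  tf (hpulln n f) = tf deng ^+ n * phi f.
Proof.
move=> sf; have D0 : tf deng != 0 by rewrite tofrac_eq0 deng_neq0.
rewrite /phi /= /horner_morph (@horner_coef_wide _ n.+1); last first.
  exact: leq_trans (size_poly _ _) sf.
rewrite /hpulln rmorph_sum mulr_sumr; apply: eq_bigr => i _.
rewrite coef_map /= -mul_polyC !rmorphM !rmorphXn /=.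
have le_in : (i <= n)%N by rewrite -ltnS.
have -> : tf deng ^+ n = tf deng ^+ (n - i) * tf deng ^+ i by rewrite -exprD subnK.
rewrite exprMn exprVn.
have Di : tf deng ^+ i != 0 by rewrite expf_neq0.
have aux (K : fieldType) (a c d e : K) : d != 0 -> a * (c * e) = e * d * (a * (c / d)).
  by move=> d0; field.
exact: aux.
Qed.

Lemma hpullnM n m (f h : {poly k}) : (size f <= n.+1)%N -> (size h <= m.+1)%N ->
  hpulln (n + m) (f * h) = hpulln n f * hpulln m h.
Proof.
move=> sf sh; apply/eqP; rewrite -tofrac_eq tofracM hpullnF.
  by rewrite (rmorphM phi) exprD mulrACA (hpullnF sf) (hpullnF sh).
have [->|f0] := eqVneq f 0; first by rewrite mul0r size_poly0.
have [->|h0] := eqVneq h 0; first by rewrite mulr0 size_poly0.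
rewrite size_mul//; move: f0 h0 sf sh; rewrite -!size_poly_gt0.
by case: (size f) (size h) => // a [//|b] _ _; rewrite !ltnS addSn addnS /= => *; rewrite ltnS leq_add.
Qed.

Lemma hpullnD n f h : hpulln n (f + h) = hpulln n f + hpulln n h.
Proof. by rewrite /hpulln -big_split; apply: eq_bigr => i _; rewrite coefD scalerDl. Qed.

Lemma hpullnX n m (f : {poly k}) : (size f <= n.+1)%N -> hpulln (n + m) f = hpulln n f * deng ^+ m.
Proof.
move=> sf; rewrite -{1}[f]mulr1 hpullnM//; last by rewrite size_poly1.
congr (_ * _); rewrite /hpulln big_ord_recl /= big1 ?addr0 => [|i _].
  by rewrite coef1 scale1r mul1r subn0.
by rewrite coef1 /= scale0r.
Qed.

Section Seminorm.
Variables (S : {poly k} -> R) (sS : is_mseminorm v S) (D0 : S deng != 0).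

Definition actS (f : {poly k}) : R := S (hpull g f) / S deng ^+ (size f).-1.

Lemma msem_X f n : S (f ^+ n) = S f ^+ n.
Proof.
have [SC _ SM _] := sS.
by elim: n => [|n IH]; rewrite ?expr0 -?polyC1 ?SC ?v1// !exprS SM IH.
Qed.

(** Raising the degree multiplies the pull-back by a power of [deng], which the normalization
    cancels. *)
Lemma actSE n (f : {poly k}) : (size f <= n.+1)%N -> actS f = S (hpulln n f) / S deng ^+ n.
Proof.
move=> sf; rewrite /actS hpullE.
have le_n : ((size f).-1 <= n)%N by case: (size f) sf.
rewrite -(subnKC le_n) hpullnX; last by case: (size f).
have [SC _ SM _] := sS.
rewrite SM msem_X exprD invfM mulrACA divff ?mulr1// expf_neq0//.
Qed.

Lemma actS_mseminorm : is_mseminorm v actS.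
Proof.
have [SC S0 SM SD] := sS.
have D_gt0 : 0 < S deng by rewrite lt0r D0 S0.
split.
- move=> c; rewrite (@actSE 0) ?size_polyC_leq1//.
  by rewrite /hpulln big_ord1 coefC /= subnn !expr0 mulr1 -mul_polyC mulr1 SC divr1.
- by move=> f; rewrite /actS divr_ge0// exprn_ge0.
- move=> f h.
  have sz (q : {poly k}) : (size q <= (size q).-1.+1)%N by case: (size q).
  rewrite (@actSE ((size f).-1 + (size h).-1)); last first.
    have [->|f0] := eqVneq f 0; first by rewrite mul0r size_poly0.
    have [->|h0] := eqVneq h 0; first by rewrite mulr0 size_poly0.
    rewrite size_mul//; move: f0 h0; rewrite -!size_poly_gt0.
    by case: (size f) (size h) => // a [//|b] _ _; rewrite addnS.
  rewrite hpullnM// SM exprD invfM mulrACA.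
  by rewrite -!actSE.
- move=> f h; pose n := maxn (size f) (size h).
  have sf : (size f <= n.+1)%N by rewrite leqW// leq_maxl.
  have sh : (size h <= n.+1)%N by rewrite leqW// leq_maxr.
  rewrite !(@actSE n)//; last by apply: (leq_trans (size_polyD _ _)); rewrite geq_max sf.
  by rewrite -mulrDl hpullnD ler_wpM2r// invr_ge0 exprn_ge0.
Qed.

End Seminorm.

Lemma act_Some (s : A1an) : set_val s deng != 0 ->
  exists2 t : A1an, act g (Some s : P1an) = Some t & forall f, set_val t f = actS (set_val s) f.
Proof.
move=> D0.
have : exists y : P1an, act_rel g (Some s) y.
  exists (Some (mkA1 (actS_mseminorm (A1an_seminorm s) D0))).
  rewrite /act_rel (negbTE D0).
  by exists (mkA1 (actS_mseminorm (A1an_seminorm s) D0)).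
move=> /(xgetPex (None : P1an)); rewrite -/(act g (Some s : P1an)) /act_rel (negbTE D0).
by move=> [t [tE tf]]; exists t.
Qed.

Lemma act_Some0 (s : A1an) : set_val s deng = 0 -> act g (Some s : P1an) = None.
Proof.
move=> D0.
have : exists y : P1an, act_rel g (Some s) y.
  by exists None; rewrite /act_rel D0 eqxx.
by move=> /(xgetPex (None : P1an)); rewrite -/(act g (Some s : P1an)) /act_rel D0 eqxx.
Qed.

Lemma act_None : act g (None : P1an) = berk_pt v (mob g None).
Proof.
have : exists y : P1an, act_rel g None y by exists (berk_pt v (mob g None)).
by move=> /(xgetPex (None : P1an)).
Qed.

(** On linear forms the action is the pull-back up to a positive scalar, so all estimates on [pull]
    and [near] apply to Berkovich points. *)
Lemma ptN_act (xi : P1an) : exists2 c : R, 0 < c & forall x, ptN (act g xi) x = c * pull (ptN xi) g x.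
Proof.
case: xi => [s|].
- have [SC S0 SM SD] := A1an_seminorm s.
  have linE x : linp (vm x g) = x.1%:P * numg + x.2%:P * deng.
    by rewrite /linp /vm /= !(polyCD, polyCM); ring.
  have [D0|D0] := eqVneq (set_val s deng) 0.
    rewrite act_Some0//.
    (* Determinant 1 writes 1 as a combination of [deng] and [numg], so they cannot both vanish. *)
    have num0 : 0 < set_val s numg.
      have : 1 <= v (g 1 0) * set_val s numg.
        rewrite -[leLHS](v1 hv) -SC.
        have -> : 1%:P = (g 0 0)%:P * deng + (- g 1 0)%:P * numg.
          by rewrite -dg det2 !(polyCD, polyCN, polyCM); ring.
        by apply: (le_trans (SD _ _)); rewrite !SM !SC D0 mulr0 add0r vN.
      by move=> h; rewrite lt0r S0 andbT; apply: contraTneq h => ->; rewrite mulr0 -ltNge ltr01.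
    exists (set_val s numg)^-1; first by rewrite invr_gt0.
    move=> x; rewrite /pull /ptN linE.
    have -> : set_val s (x.1%:P * numg + x.2%:P * deng) = v x.1 * set_val s numg.
      apply/eqP; rewrite -subr_eq0 -normr_le0 -SC -SM.
      apply: (le_trans (msem_sub hv _ _ (A1an_seminorm s))).
      by rewrite addrC addKr SM D0 mulr0.
    by rewrite mulrCA mulVf ?mulr1// gt_eqF.
  have D_gt0 : 0 < set_val s deng by rewrite lt0r D0 S0.
  have [t -> tf] := act_Some D0.
  exists (set_val s deng)^-1; first by rewrite invr_gt0.
  move=> x; rewrite /pull /ptN linE tf (@actSE _ (A1an_seminorm s) D0 1); last first.
    rewrite /linp (leq_trans (size_polyD _ _))// geq_max (leqW (size_polyC_leq1 _)) andbT.
    by rewrite mulrC mul_polyC (leq_trans (size_scale_leq _ _))// size_polyX.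
  rewrite /hpulln !big_ord_recl big_ord0 addr0 expr1 mulrC; congr (_ * set_val s _).
  rewrite /linp /= !coefD !coefXM !coefC /= add0r addr0 !expr0 !expr1 mul1r mulr1.
  by rewrite -!mul_polyC; ring.
- rewrite act_None mobE /= .
  have nzm : nz (mv g (1, 0)) by apply: nz_mv => //; rewrite /nz /= oner_eq0.
  have [c c0 H] := ptN_berk hv nzm; exists c => // x; rewrite H; congr (_ * _).
  rewrite /ptnorm /pull /ptN -dot_vm; congr v; rewrite /dot /=; ring.
Qed.

Lemma cvg_actS (F : set_system A1an) (FF : Filter F) (s : A1an) f : set_val s deng != 0 ->
  (forall h, (fun u : A1an => set_val u h : R^o) @ F --> (set_val s h : R^o)) ->
  (fun u : A1an => actS (set_val u) f : R^o) @ F --> (actS (set_val s) f : R^o).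
Proof.
move=> D0 H; apply: cvgM; first exact: H.
apply: cvgV; first by rewrite expf_neq0.
elim: (size f).-1 => [|n IH].
  by under eq_cvg do rewrite expr0; rewrite expr0; exact: cvg_cst.
by under eq_cvg do rewrite exprS; rewrite exprS; apply: cvgM.
Qed.

Lemma act_continuous_at (s : A1an) : set_val s deng != 0 ->
  {for s, continuous (fun s : A1an => act g (Some s : P1an))}.
Proof.
move=> D0; have [t tE tf] := act_Some D0; rewrite /prop_for /continuous_at tE.
have FF := nbhs_filter s.
apply: (cvg_P1an_Some FF) => f e e0.
have cev h : (fun u : A1an => set_val u h : R^o) @ nbhs s --> (set_val s h : R^o).
  exact: ev_continuous.
have cA := cvg_actS (f := f) FF D0 cev.
have D_gt0 : 0 < `|set_val s deng| by rewrite normr_gt0.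
have /cvgrPdist_lt /(_ e e0) h1 := cA.
have /cvgrPdist_lt /(_ _ D_gt0) h2 := cev deng.
apply: filterS (filterI h1 h2) => u /= [u1 u2].
have Du : set_val u deng != 0 by apply: contraTneq u2 => ->; rewrite subr0 ltxx.
by have [t' t'E t'f] := act_Some Du; exists t' => //; rewrite tf t'f.
Qed.

Lemma measurable_Some (A : set A1an) : open A -> measurable (Some @` A : set P1anB).
Proof. by move=> oA; apply: sub_sigma_algebra; exact: one_point_compactification_open_some. Qed.

Lemma measurable_infty : measurable ([set None] : set P1anB).
Proof.
have -> : [set None] = ~` (Some @` [set: A1an]) :> set P1anB.
  by apply/seteqP; split=> [_ -> [//]|[s|]//]; case; exists s.
by apply: measurableC; apply: measurable_Some; exact: openT.
Qed.

(** Continuity away from the pole suffices: the zero set of [deng] is measurable and goes to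
    infinity, and infinity itself is one more measurable piece. *)
Lemma measurable_act : measurable_fun setT (act g : P1anB -> P1anB).
Proof.
apply: (@measurability _ _ P1anB P1anB setT (act g) (@open P1an) erefl).
move=> _ [U oU <-]; rewrite setTI.
pose V := [set s : A1an | set_val s deng != 0 /\ U (act g (Some s : P1an))].
pose Z := [set s : A1an | set_val s deng != 0].
have oZ : open Z.
  apply: (@open_comp _ _ (fun s : A1an => set_val s deng : R^o) [set y | y != 0]).
    by move=> s _; exact: ev_continuous.
  exact: open_neq.
have oV : open V.
  rewrite openE => s [D0 Us]; rewrite /interior.
  have n1 : nbhs s Z by apply: open_nbhs_nbhs.
  have n2 : nbhs s [set u : A1an | U (act g (Some u : P1an))].
    by apply: (act_continuous_at D0); apply: open_nbhs_nbhs.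
  by apply: filterS (filterI n1 n2).
have mE (b : Prop) (A : set P1anB) : measurable A -> measurable [set x : P1anB | A x /\ b].
  move=> mA; have [hb|hb] := pselect b.
    by rewrite (_ : [set x | _] = A)//; apply/seteqP; split=> x //= [].
  by rewrite (_ : [set x | _] = set0)//; apply/seteqP; split=> x //= [].
have -> : act g @^-1` U = (Some @` V : set P1anB) `|`
   ([set x : P1anB | (~` (Some @` Z) `&` ~` [set None]) x /\ U None] `|`
    [set x : P1anB | [set None] x /\ U (act g (None : P1an))]).
  apply/seteqP; split=> [[s|] /= Ux|x].
  - have [D0|D0] := eqVneq (set_val s deng) 0; last by left; exists s.
    have UN : U (None : P1an) by rewrite -(act_Some0 D0).
    right; left; split => //; split; last by [].
    by move=> [u Zu [us]]; move: Zu; rewrite us /Z /= D0 eqxx.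
  - by right; right.
  - move=> [[s [D0 Us] <-]//|[[[nZ nN] UN]|[-> //]]].
    case: x nZ nN => [s|] nZ nN; last by exfalso; apply: nN.
    rewrite /= act_Some0//; apply/eqP; apply: contraT => D0.
    by exfalso; apply: nZ; exists s.
apply: measurableU; first exact: measurable_Some.
apply: measurableU; apply: mE; last exact: measurable_infty.
by apply: measurableI; apply: measurableC; [exact: measurable_Some|exact: measurable_infty].
Qed.

End Homogenization.

Lemma cvg_ev_lin (F : set_system A1an) (FF : Filter F) (s : A1an) f h (c : R) :
  (forall h, (fun u : A1an => set_val u h : R^o) @ F --> (set_val s h : R^o)) ->
  (fun u : A1an => c * set_val u f - set_val u h : R^o) @ F --> (c * set_val s f - set_val s h : R^o).
Proof. by move=> H; apply: cvgB => //; apply: cvgM => //; exact: cvg_cst. Qed.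

Lemma open_ev_lt f h (c : R) : open [set s : A1an | set_val s h < c * set_val s f].
Proof.
have -> : [set s : A1an | set_val s h < c * set_val s f] =
    (fun s : A1an => c * set_val s f - set_val s h : R^o) @^-1` [set r | 0 < r].
  by apply/seteqP; split=> s /=; rewrite subr_gt0.
apply: open_comp; last exact: open_gt.
move=> s _; apply: (cvg_ev_lin (nbhs_filter s)) => q; exact: ev_continuous.
Qed.

Lemma measurable_near y d : 0 <= d -> measurable ([set xi | near v (ptN xi) y d] : set P1anB).
Proof.
move=> d0.
have oA : open [set s : A1an | near v (ptN (Some s : P1an)) y d].
  have -> : [set s : A1an | near v (ptN (Some s : P1an)) y d] =
     [set s : A1an | set_val s (linp (perp y)) < d * vn v y * set_val s (linp (1, 0))] `|`
     [set s : A1an | set_val s (linp (perp y)) < d * vn v y * set_val s (linp (0, 1))].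
    have nE (s : A1an) : near v (ptN (Some s : P1an)) y d =
      (set_val s (linp (perp y)) < d * vn v y * set_val s (linp (1, 0))) ||
      (set_val s (linp (perp y)) < d * vn v y * set_val s (linp (0, 1))).
      by rewrite /near mulrAC /nn maxr_pMr ?mulr_ge0 ?vn_ge0// lt_max.
    by apply/seteqP; split=> s /=; rewrite nE => /orP.
  by apply: openU; exact: open_ev_lt.
have [h|h] := pselect (near v (ptN (None : P1an)) y d).
  have -> : [set xi : P1anB | near v (ptN xi) y d] =
    (Some @` [set s : A1an | near v (ptN (Some s : P1an)) y d]) `|` [set None].
    apply/seteqP; split=> [[s|]|x] /=; [by left; exists s|by right|].
    by move=> [[s ? <-]|->].
  by apply: measurableU; [exact: measurable_Some|exact: measurable_infty].
have -> : [set xi : P1anB | near v (ptN xi) y d] =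
  (Some @` [set s : A1an | near v (ptN (Some s : P1an)) y d]).
  by apply/seteqP; split=> [[s|]|x] //=; [exists s|move=> [s ? <-]].
exact: measurable_Some.
Qed.

Lemma measurable_continuous (f : P1an -> R) : continuous (f : P1an -> R^o) ->
  measurable_fun setT (f : P1anB -> R).
Proof.
move=> cf; apply: (@measurability _ _ P1anB (measurableTypeR R) setT f _ (measurable_realfun.RGenOpens.measurableE R)).
move=> _ [_ [a [b ->]] <-]; rewrite setTI; apply: sub_sigma_algebra.
by move/continuousP: cf; apply; exact: itv_open.
Qed.

End Action.

(** * Convergence to a stationary measure *)

Section StationaryIntegral.
Local Open Scope ereal_scope.

Lemma integral_mixture (d : measure_display) (T : measurableType d) (R : realType)
  (nu : {measure set T -> \bar R}) (p : nat -> R) (phi : nat -> T -> T) (h : T -> \bar R) :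
  (forall j, 0 <= p j)%R -> (forall j, measurable_fun setT (phi j)) ->
  (forall A, measurable A -> nu A = \sum_(0 <= j <oo) (p j)%:E * nu (phi j @^-1` A)) ->
  measurable_fun setT h -> (forall x, 0 <= h x) ->
  \int[nu]_x h x = \sum_(0 <= j <oo) (p j)%:E * \int[nu]_x h (phi j x).
Proof.
move=> p0 mphi st mh h0.
pose pm j : {measure set T -> \bar R} :=
  measure_function_pushforward__canonical__measure_function_Measure nu (mphi j).
pose sm j : {measure set T -> \bar R} := mscale (NngNum (p0 j)) (pm j).
transitivity (\int[mseries sm 0]_x h x).
  by apply: eq_measure_integral => A mA _; rewrite st.
rewrite ge0_integral_measure_series//; apply: eq_eseriesr => j _.
rewrite /sm ge0_integral_mscale//; congr (_ * _).
by rewrite /pm (ge0_integral_pushforward (mphi j))// => y _; exact: h0.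
Qed.

Lemma integral_wexp (d : measure_display) (T : measurableType d) (R : realType)
  (nu : {measure set T -> \bar R}) (p : nat -> R) n (F : seq nat -> T -> \bar R) :
  (forall j, 0 <= p j)%R -> (forall w, measurable_fun setT (F w)) -> (forall w x, 0 <= F w x) ->
  measurable_fun setT (fun x => wexp p n (F ^~ x)) /\
  \int[nu]_x wexp p n (F ^~ x) = wexp p n (fun w => \int[nu]_x F w x).
Proof.
move=> p0; elim: n F => [|n IH] F mF F0 //=.
have IHj j := IH (fun w => F (j :: w)) (fun w => mF (j :: w)) (fun w x => F0 (j :: w) x).
have mj j : measurable_fun setT (fun x => (p j)%:E * wexp p n (fun w => F (j :: w) x)).
  by apply: emeasurable_funM; [exact: measurable_cst|exact: (IHj j).1].
have j0 j x : 0 <= (p j)%:E * wexp p n (fun w => F (j :: w) x).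
  by rewrite mule_ge0 ?lee_fin// wexp_ge0.
split; first by apply: (ge0_emeasurable_sum (P := predT)) => // j x _ _; exact: j0.
rewrite integral_nneseries//; apply: eq_eseriesr => j _.
rewrite ge0_integralZl ?lee_fin//.
- by rewrite (IHj j).2.
- exact: (IHj j).1.
- by move=> x _; exact: wexp_ge0.
Qed.

End StationaryIntegral.

Lemma measurable_funEFin (d : measure_display) (T : measurableType d) (R : realType) (f : T -> R) :
  measurable_fun setT f -> measurable_fun setT (fun x => (f x)%:E).
Proof. by move=> mf; exact/measurable_EFinP. Qed.

Section Convergence.
Variables (R : realType) (k : fieldType) (v : k -> R).
Hypothesis hv : complete_nonarch_abs v.
Variables (p : nat -> R) (g : nat -> 'M[k]_2).
Hypothesis p_ge0 : forall j, 0 <= p j.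
Hypothesis p_sum1 : (\esum_(j in [set: nat]) (p j)%:E)%E = 1%E.
Hypothesis hSL : forall j, \det (g j) = 1.
Hypothesis hne : non_elementary v (gen_group [set g j | j in [set j | 0 < p j]]).
Local Notation P1anB := (P1anB v).
Local Notation P1an := (P1an v).
Local Notation gam := (gam g).
Local Notation det_gam := (det_gam hSL).

(** Letters act one at a time, as they appear when stationarity is iterated; [ptN_actw] compares the
    result with the matrix [gam w]. *)
Fixpoint actw (w : seq nat) (x : P1anB) : P1anB :=
  if w is j :: w' then act (g j) (actw w' x : P1an) else x.

Lemma measurable_actw w : measurable_fun setT (actw w).
Proof.
elim: w => [|j w IH]; first exact: measurable_id.
exact: (measurableT_comp (measurable_act hv (hSL j)) IH).
Qed.

Lemma ptN_actw w (xi : P1anB) : exists2 c : R, 0 < c &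
  forall x, ptN (actw w xi : P1an) x = c * pull (ptN (xi : P1an)) (gam w) x.
Proof.
elim: w => [|j w [c c0 IH]].
  exists 1 => // x; rewrite mul1r gam_nil /pull /vm !scalar2E /= !mulr0 !mulr1 addr0 add0r.
  by rewrite -surjective_pairing.
have [c' c'0 H] := ptN_act hv (hSL j) (actw w xi : P1an).
exists (c' * c); first by rewrite mulr_gt0.
by move=> x; rewrite [actw _ _]/= H gam_cons pullM /pull -mulrA -IH.
Qed.

Lemma near_actw w (xi : P1anB) y d :
  near v (ptN (actw w xi : P1an)) y d = near v (pull (ptN (xi : P1an)) (gam w)) y d.
Proof. by have [c c0 H] := ptN_actw w xi; exact: near_scale c0 H. Qed.

Variable nu : probability P1anB R.
Hypothesis st : stationary v p g nu.

Lemma integral_cst_probability (c : R) : (\int[nu]_x (cst c%:E x) = c%:E)%E.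
Proof.
transitivity (c%:E * nu setT)%E; first exact: integral_cst.
by rewrite probability_setT mule1.
Qed.

Lemma integral_stationary n (h : P1anB -> \bar R) : measurable_fun setT h ->
  (forall x, 0 <= h x)%E ->
  (\int[nu]_x h x = wexp p n (fun w => \int[nu]_x h (actw w x)))%E.
Proof.
elim: n h => [|n IH] h mh h0 //=.
have ma j : measurable_fun setT (act (g j) : P1anB -> P1anB) by exact: measurable_act.
rewrite (@integral_mixture _ _ _ nu p (fun j => act (g j)))//.
  apply: eq_eseriesr => j _; congr (_ * _)%E.
  by rewrite (IH (fun x => h (act (g j) (x : P1an))))//; exact: (measurableT_comp mh (ma j)).
move=> A mA; rewrite nneseries_esumT; first exact: (st mA).
by move=> j; rewrite mule_ge0 ?lee_fin.
Qed.

(** Stationarity spreads the mass of a ball over [n] steps of the walk, and [near_unlikely] holds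
    for every starting point. *)
Lemma stationary_near (e : R) : 0 < e -> exists2 d : R, 0 < d & forall y, nz y ->
  (nu [set xi | near v (ptN (xi : P1an)) y d] <= e%:E)%E.
Proof.
move=> e0; have [d d0 [n H]] := near_unlikely hv p_ge0 p_sum1 hSL hne e0.
exists d => // y ny.
pose B : set P1anB := [set xi | near v (ptN (xi : P1an)) y d].
have mB : measurable B by apply: measurable_near => //; exact: ltW.
have -> : nu B = (\int[nu]_x (\1_B x)%:E)%E by rewrite integral_indic// setIT.
have mI : measurable_fun setT (fun x : P1anB => (\1_B x : R)%:E).
  exact: (@measurable_funEFin _ P1anB R (\1_B) (measurable_indic mB)).
rewrite (integral_stationary n mI)//.
have mF w : measurable_fun setT (fun x => (\1_B (actw w x) : R)%:E).
  exact: (measurableT_comp mI (measurable_actw w)).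
have F0 w x : (0 <= (\1_B (actw w x) : R)%:E)%E by rewrite lee_fin.
have [mW <-] := @integral_wexp _ _ _ nu p n (fun w x => (\1_B (actw w x) : R)%:E) p_ge0 mF F0.
apply: (@le_trans _ _ (\int[nu]_x (cst e%:E x))%E); last first.
  by rewrite integral_cst_probability.
apply: ge0_le_integral => //.
- by move=> x _; apply: wexp_ge0 => // w; rewrite lee_fin.
- move=> x _ /=; apply: le_trans (H n (ptN (x : P1an)) y (leqnn n) (ptN_seminorm hv _) ny).
  apply: le_wexp => // w _.
  rewrite lee_fin !indicE; have [h|h] := pselect (B (actw w x)).
    by rewrite !mem_set//= -near_actw.
  by rewrite memNset.
Qed.

(** The mean of [I w], the integral of [f] over the image of [nu] under [w], is the constant
    [int f d nu]. For most words [w] maps all but a small part of [nu] close to [attv], and the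
    attracting point is close to [attv] too. *)
Lemma push_att_cvg (f : P1an -> R) : continuous (f : P1an -> R^o) -> (forall x, 0 <= f x) ->
  wexp p n (fun w => (\1_[set w | hyperbolic v (gam w)] w * f (berk_pt v (att v (gam w))))%:E)
    @[n --> \oo] --> (\int[nu]_x (f (x : P1an))%:E)%E /\
  (\int[nu]_x (f (x : P1an))%:E)%E \is a fin_num.
Proof.
move=> cf f0.
have mf : measurable_fun setT (f : P1anB -> R) by exact: measurable_continuous.
have [C C0 HC] := continuous_bounded cf.
have fC x : f x <= C by apply: le_trans (ler_norm _) (HC x).
have mfw w : measurable_fun setT (fun x : P1anB => (f (actw w x))%:E).
  exact: (@measurable_funEFin _ P1anB R (f \o actw w) (measurableT_comp mf (measurable_actw w))).
have int_cst := integral_cst_probability.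
have I_fin w : (\int[nu]_x (f (actw w x))%:E)%E \is a fin_num.
  rewrite ge0_fin_numE; last by apply: integral_ge0 => x _; rewrite lee_fin.
  apply: (@le_lt_trans _ _ (\int[nu]_x (cst C%:E x))%E); last by rewrite int_cst ltry.
  apply: ge0_le_integral => //.
  - by move=> x _; rewrite lee_fin.
  - by move=> x _ /=; rewrite lee_fin.
have fin := I_fin [::]; split => //.
pose I w : R := fine (\int[nu]_x (f (actw w x))%:E)%E.
have IE w : (\int[nu]_x (f (actw w x))%:E)%E = (I w)%:E by rewrite fineK.
have I0 w : 0 <= I w by apply: fine_ge0; apply: integral_ge0 => x _; rewrite lee_fin.
have IC w : I w <= C.
  rewrite -lee_fin -IE -int_cst; apply: ge0_le_integral => //.
  - by move=> x _; rewrite lee_fin.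
  - by move=> x _ /=; rewrite lee_fin.
pose G w := \1_[set w | hyperbolic v (gam w)] w * f (berk_pt v (att v (gam w))).
have G0 w : 0 <= G w by rewrite mulr_ge0.
have GC w : G w <= C.
  rewrite /G indicE; case: (_ \in _); rewrite ?mul1r ?mul0r//; exact: ltW.
have intE n : (\int[nu]_x (f (x : P1an))%:E)%E = wexp p n (fun w => (I w)%:E).
  rewrite (integral_stationary n)//; first by apply: eq_wexp => w _; rewrite IE.
  exact: measurable_funEFin.
have wfin n : wexp p n (fun w => (G w)%:E) \is a fin_num.
  rewrite ge0_fin_numE; last by apply: wexp_ge0.
  apply: (@le_lt_trans _ _ C%:E); last by rewrite ltry.
  by apply: le_wexp_cst => // w _; rewrite lee_fin.
suff : fine (wexp p n (fun w => (G w)%:E)) @[n --> \oo] --> fine (\int[nu]_x (f (x : P1an))%:E)%E.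
  move=> h; rewrite -(fineK fin); apply/fine_cvgP; split => //.
  by apply: nearW => n; exact: wfin.
apply/cvgrPdist_le => e' e'0.
(* The errors add up to [2 e] for the two comparisons with [attv], [C e] for the mass of [nu] near
   the repelling direction, and [2 C e] for the bad words. *)
pose e := e' / (2 + C + 2 * C).
have D0 : 0 < 2 + C + 2 * C by rewrite !addr_gt0// mulr_gt0.
have e0 : 0 < e by rewrite divr_gt0.
have [d1 d10 UC] := unif_continuous_berk hv cf e0.
have [d2 d20 NU] := stationary_near e0.
have [d3 d30 [n3 H3]] := transversal hv p_ge0 p_sum1 hSL hne e0.
(* The summands serve [att_spec] ([d1]), [tr_dominant] ([d3]) and [near_contract] ([d1 * d2]), in
   this order. *)
pose M := 1 + d1^-1 + d3^-1 + (d1 * d2)^-1.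
have d1V : 0 < d1^-1 by rewrite invr_gt0.
have d3V : 0 < d3^-1 by rewrite invr_gt0.
have d12V : 0 < (d1 * d2)^-1 by rewrite invr_gt0 mulr_gt0.
have [n4 H4] := norm_grows hv p_ge0 p_sum1 hSL hne M e0.
pose bad := [set w | v (dot (repv hv (gam w)) (attv hv (gam w))) < d3] `|` [set w | mnorm v (gam w) <= M].
have key w : ~ bad w -> `|G w - I w| <= 2 * e + C * e.
  move=> /not_orP[/negP ntv /negP nnorm].
  have dw := det_gam w.
  have tv : d3 <= v (dot (repv hv (gam w)) (attv hv (gam w))) by rewrite leNgt.
  have nrm : M < mnorm v (gam w) by rewrite ltNge.
  have m0 := mnorm_gt0 hv dw.
  have [_ hyp] : v (\tr (gam w)) = mnorm v (gam w) * v (dot (repv hv (gam w)) (attv hv (gam w))) /\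
      hyperbolic v (gam w).
    by apply: tr_dominant tv => //; apply: lt_trans nrm; rewrite /M; lra.
  have GE : G w = f (berk_pt v (att v (gam w))) by rewrite /G indicE mem_set// mul1r.
  have natt : nz (attv hv (gam w)) by rewrite -(vn_gt0 hv) vn_attv.
  set A := f (berk_pt v (pline (attv hv (gam w)))).
  have GA : `|G w - A| < e.
    rewrite GE; have [x [nx -> xE]] := att_spec hv dw hyp; apply: UC => //.
    rewrite near_berk// vn_attv// mulr1; apply: (le_lt_trans xE).
    rewrite mulrC ltr_pM2r ?vn_gt0// invf_plt ?posrE//.
    by apply: lt_trans nrm; rewrite /M; lra.
  pose y := (- (repv hv (gam w)).2, (repv hv (gam w)).1).
  have rE : perp y = repv hv (gam w) by rewrite /perp /y /= opprK.
  have ny1 : vn v y = 1 by rewrite -(vn_repv hv dw) /vn /y /= vN// maxC.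
  have ny : nz y by rewrite -(vn_gt0 hv) ny1.
  (* [B] collects the points near the repelling direction [y], the zero of the form [repv]; by [NU]
     its mass is at most [e]. *)
  pose B : set P1anB := [set xi | near v (ptN (xi : P1an)) y d2].
  have mB : measurable B by apply: measurable_near => //; exact: ltW.
  have Bfar xi : ~ B xi -> `|f (actw w xi) - A| < e.
    move=> nB; apply: UC => //; rewrite near_actw.
    apply: (near_contract dw (ptN_seminorm hv _) d20).
      by move: nB; rewrite /B /= /near rE ny1 mulr1.
    have m1 : 1 < mnorm v (gam w) by apply: lt_trans nrm; rewrite /M; lra.
    apply: (@lt_le_trans _ _ (d1 * d2 * mnorm v (gam w))).
      rewrite -ltr_pdivrMl ?mulr_gt0// mulr1; apply: lt_trans nrm; rewrite /M; lra.
    by rewrite ler_wpM2l ?mulr_ge0 ?(ltW d10) ?(ltW d20)// expr2 ler_peMl// ltW.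
  have cmp xi : `|f (actw w xi) - A| <= e + C * \1_B xi.
    have [Bx|nBx] := pselect (B xi).
      rewrite indicE mem_set//= mulr1 (@le_trans _ _ C)// ?lerDr ?(ltW e0)//.
      have h1 := f0 (actw w xi); have h2 := fC (actw w xi).
      have h3 : 0 <= A by exact: f0.
      have h4 : A <= C by exact: fC.
      by rewrite ler_norml; apply/andP; split; lra.
    by rewrite indicE memNset//= mulr0 addr0 ltW// Bfar.
  have mI : measurable_fun setT (fun x : P1anB => (\1_B x : R)%:E).
    exact: (@measurable_funEFin _ P1anB R (\1_B) (measurable_indic mB)).
  have intB (c : R) : 0 <= c -> (\int[nu]_x (c%:E + C%:E * (\1_B x)%:E) <= (c + C * e)%:E)%E.
    move=> c0; rewrite ge0_integralD//; last 2 first.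
    - by move=> x _; rewrite -EFinM lee_fin mulr_ge0// ltW.
    - by apply: emeasurable_funM => //; exact: measurable_cst.
    rewrite ge0_integralZl//; last by rewrite lee_fin ltW.
    rewrite -/(cst c%:E) int_cst integral_indic// setIT EFinD EFinM leeD2l// lee_pmul2l//.
    exact: NU.
  have le1 : I w <= A + e + C * e.
    rewrite -lee_fin -IE; apply: (le_trans _ (intB _ _)); last first.
      by rewrite addr_ge0 ?(ltW e0)//; exact: f0.
    apply: ge0_le_integral => //.
    - by move=> x _; rewrite lee_fin.
    - by apply: emeasurable_funD => //; apply: emeasurable_funM => //; exact: measurable_cst.
    - move=> x _; rewrite -EFinM -EFinD lee_fin.
      have := le_trans (ler_norm _) (cmp x); lra.
  have le2 : A <= I w + e + C * e.
    rewrite -lee_fin -int_cst.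
    apply: (@le_trans _ _ (\int[nu]_x ((f (actw w x))%:E + (e%:E + C%:E * (\1_B x)%:E)))%E).
      apply: ge0_le_integral => //.
      - by move=> x _ /=; rewrite lee_fin; exact: f0.
      - apply: emeasurable_funD => //; apply: emeasurable_funD => //.
        by apply: emeasurable_funM => //; exact: measurable_cst.
      - move=> x _ /=; rewrite -EFinM -!EFinD lee_fin.
        have := cmp x; rewrite ler_norml => /andP[]; lra.
    have m2 : measurable_fun setT (fun x : P1anB => (e%:E + C%:E * (\1_B x : R)%:E)%E).
      by apply: emeasurable_funD => //; apply: emeasurable_funM => //; exact: measurable_cst.
    have ge2 (x : P1anB) : (0 <= e%:E + C%:E * (\1_B x : R)%:E)%E.
      by rewrite -EFinM -EFinD lee_fin; apply: addr_ge0; [exact: ltW|apply: mulr_ge0 => //; exact: ltW].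
    have ge1 (x : P1anB) : (0 <= (f (actw w x))%:E)%E by rewrite lee_fin.
    rewrite (ge0_integralD nu measurableT (fun x _ => ge1 x) (mfw w) (fun x _ => ge2 x) m2).
    by rewrite IE -addrA EFinD leeD2l// intB// ltW.
  move: GA; rewrite ltr_norml => /andP[g1 g2].
  by rewrite ler_norml; apply/andP; split; lra.
have comp w : `|G w - I w| <= 2 * e + C * e + C * \1_bad w.
  have [bw|nbw] := pselect (bad w); last first.
    by rewrite indicE memNset//= mulr0 addr0 key.
  rewrite indicE mem_set//= mulr1 (@le_trans _ _ C)//.
    have h1 := G0 w; have h2 := GC w; have h3 := I0 w; have h4 := IC w.
    by rewrite ler_norml; apply/andP; split; lra.
  by rewrite lerDr addr_ge0// mulr_ge0// ltW.
near=> n.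
have n3n : (n3 <= n)%N by near: n; exists n3.
have n4n : (n4 <= n)%N by near: n; exists n4.
have Pbad : (wprob p n bad <= (2 * e)%:E)%E.
  apply: (le_trans (wprobU p_ge0 _ _ _)).
  by rewrite mulr_natl mulr2n EFinD leeD//; [exact: H3|exact: H4].
have c0 : 0 <= 2 * e + C * e by apply: addr_ge0; apply: mulr_ge0 => //; exact: ltW.
have bound (F1 F2 : seq nat -> R) : (forall w, 0 <= F1 w) -> (forall w, 0 <= F2 w) ->
    (forall w, `|F1 w - F2 w| <= 2 * e + C * e + C * \1_bad w) ->
    (wexp p n (fun w => (F1 w)%:E) <= wexp p n (fun w => (F2 w)%:E) + e'%:E)%E.
  move=> F10 F20 H12.
  have -> : e' = 2 * e + C * e + C * (2 * e).
    have -> : 2 * e + C * e + C * (2 * e) = e * (2 + C + 2 * C) by ring.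
    by rewrite /e divfK// gt_eqF.
  apply: (@le_trans _ _ (wexp p n (fun w => ((F2 w)%:E + ((2 * e + C * e)%:E + C%:E * (\1_bad w)%:E))%E))).
    apply: le_wexp => // w _; rewrite -EFinM -!EFinD lee_fin.
    have := le_trans (ler_norm _) (H12 w); lra.
  rewrite wexpD//; last by move=> w; rewrite -EFinM -EFinD lee_fin addr_ge0// mulr_ge0// ltW.
  rewrite wexpD//; last by move=> w; rewrite -EFinM lee_fin mulr_ge0// ltW.
  rewrite wexpZl// wexp_cst// leeD2l// (EFinD (_ + _)) leeD2l// (EFinM C (2 * e)) lee_pmul2l//.
have b1 := bound G I G0 I0 comp.
have b2 : (wexp p n (fun w => (I w)%:E) <= wexp p n (fun w => (G w)%:E) + e'%:E)%E.
  by apply: bound => // w; rewrite distrC.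
rewrite -(intE n) in b1 b2.
move: b1 b2; rewrite -{1 2}(fineK fin) -{1 2}(fineK (wfin n)) -!EFinD !lee_fin => b1 b2.
rewrite ler_norml; apply/andP; split; lra.
Unshelve. all: by end_near. Qed.

End Convergence.

(** * Existence of a stationary measure *)

Section Coding.
Variables (R : realType) (p : nat -> R).
Hypothesis p_ge0 : forall j, 0 <= p j.
Hypothesis p_sum1 : (\esum_(j in [set: nat]) (p j)%:E)%E = 1%E.
Local Notation lam := (@lebesgue_measure R).
Local Notation Om := (`[0, 1[%classic : set (measurableTypeR R)).

Definition cumul (j : nat) : R := \sum_(0 <= i < j) p i.
(* [cumul j + p j * x] maps [0, 1[ onto the j-th interval of a partition of [0, 1[
   into intervals of lengths [p j]. *)
Definition icons (j : nat) (x : measurableTypeR R) : measurableTypeR R := cumul j + p j * x.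

Lemma measurable_icons j : measurable_fun setT (icons j).
Proof.
apply: continuous_measurable_fun => x.
apply: cvgD; first exact: cvg_cst.
by apply: cvgM; [exact: cvg_cst|exact: cvg_id].
Qed.

Lemma lebesgue_affine j (A : set (measurableTypeR R)) : 0 < p j -> measurable A ->
  lam A = ((p j)%:E * lam (icons j @^-1` A))%E.
Proof.
move=> pj mA.
pose pm : {measure set (measurableTypeR R) -> \bar R} :=
  measure_function_pushforward__canonical__measure_function_Measure lam (measurable_icons j).
pose sm : {measure set (measurableTypeR R) -> \bar R} := mscale (NngNum (p_ge0 j)) pm.
suff H : forall X, ocitv X -> lam X = sm X by exact: (lebesgue_measure_unique H mA).
move=> _ [[a b] _ <-]; rewrite /sm /= /mscale /= /pm /= /pushforward.
have -> : icons j @^-1` `]a, b]%classic = `](a - cumul j) / p j, (b - cumul j) / p j]%classic.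
  apply/seteqP; split=> x /=; rewrite !in_itv /= ltr_pdivrMr// ler_pdivlMr// /icons mulrC;
    by rewrite ltrBlDl lerBrDl.
rewrite !lebesgue_measure_itv /= !lte_fin ltr_pM2r ?invr_gt0// ltrD2r.
case: ifP => ab; last by rewrite mule0.
rewrite -!EFinD -EFinM; congr EFin; field.
by rewrite gt_eqF.
Qed.

Lemma cumulS j : cumul j.+1 = cumul j + p j.
Proof. by rewrite /cumul big_nat_recr. Qed.

Lemma cumul_ge0 j : 0 <= cumul j. Proof. exact: sumr_ge0. Qed.

Lemma cumul_le i j : (i <= j)%N -> cumul i <= cumul j.
Proof. by move=> /subnK <-; elim: (j - i)%N => // n IH; rewrite addSn cumulS ler_wpDr. Qed.

Lemma cumul_cvg : (cumul j)%:E @[j --> \oo] --> 1%E.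
Proof.
have h : \sum_(0 <= j < n) (p j)%:E @[n --> \oo] --> (\sum_(0 <= j <oo) (p j)%:E)%E.
  by apply: is_cvg_nneseries => j _ _; rewrite lee_fin.
rewrite nneseries_esumT ?p_sum1 in h; last by move=> j; rewrite lee_fin.
by under eq_cvg do rewrite -sumEFin.
Qed.

Lemma cumul_le1 j : cumul j <= 1.
Proof.
rewrite -lee_fin; apply: (cvge_ge _ cumul_cvg).
by exists j => // n /= jn; rewrite lee_fin cumul_le.
Qed.

Definition Itv j : set (measurableTypeR R) := `[cumul j, cumul j.+1[%classic.

Lemma ItvP j x : Itv j x <-> cumul j <= x < cumul j.+1.
Proof. by rewrite /Itv /= in_itv. Qed.

Lemma Itv_uniq i j x : Itv i x -> Itv j x -> i = j.
Proof.
move=> /ItvP/andP[i1 i2] /ItvP/andP[j1 j2].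
case: (ltngtP i j) => // ij.
  by have := le_lt_trans (le_trans (cumul_le ij) j1) i2; rewrite ltxx.
by have := le_lt_trans (le_trans (cumul_le ij) i1) j2; rewrite ltxx.
Qed.

Lemma Itv_cover : Om = \bigcup_j Itv j.
Proof.
apply/seteqP; split=> [x|x [j _ /ItvP/andP[h1 h2]]]; last first.
  by rewrite /= in_itv /= (le_trans (cumul_ge0 j) h1) (lt_le_trans h2)// cumul_le1.
rewrite /= in_itv /= => /andP[x0 x1].
have ex : exists j, x < cumul j.
  apply: contrapT => /forallNP H; move: x1; rewrite ltNge => /negP; apply.
  rewrite -lee_fin; apply: (cvge_le _ cumul_cvg).
  by apply: nearW => n; rewrite lee_fin leNgt; apply/negP; exact: H.
have [[|j] xj jmin] := find_ex_minn ex.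
  by move: xj; rewrite /cumul big_nil ltNge x0.
exists j => //; apply/ItvP; rewrite xj andbT leNgt; apply/negP => /jmin.
by rewrite ltnn.
Qed.

Lemma icons_Itv j x : 0 < p j -> Itv j (icons j x) <-> Om x.
Proof.
move=> pj; rewrite /Itv /= !in_itv /= cumulS /icons lerDl ltrD2l pmulr_rge0//.
by rewrite gtr_pMr.
Qed.

Lemma measurable_Om : measurable (Om). Proof. exact: measurable_itv. Qed.

(** Lebesgue measure on [[0, 1[] is the mixture of its images under the maps [icons j]. The
    stationarity of the limit law is this identity transported by an equivariant map. *)
Lemma self_similar (A : set (measurableTypeR R)) : measurable A -> A `<=` Om ->
  lam A = (\sum_(0 <= j <oo) (p j)%:E * lam (Om `&` icons j @^-1` A))%E.
Proof.
move=> mA AO.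
have AE : A = \bigcup_j (A `&` Itv j) by rewrite -setI_bigcupr -Itv_cover; apply/esym/setIidl.
have mI j : measurable (A `&` Itv j) by apply: measurableI => //; exact: measurable_itv.
have tI : trivIset setT (fun j => A `&` Itv j).
  by move=> i j _ _ [x [[_ xi] [_ xj]]]; exact: Itv_uniq xi xj.
rewrite {1}AE measure_semi_bigcup//; last by rewrite -AE.
apply: eq_eseriesr => j _.
have [p0|pj] := eqVneq (p j) 0.
  rewrite p0 mul0e (_ : A `&` Itv j = set0) ?measure0//.
  by apply/seteqP; split=> x // [_ /ItvP]; rewrite cumulS p0 addr0 => /andP[h1 h2]; have := le_lt_trans h1 h2; rewrite ltxx.
have pj0 : 0 < p j by rewrite lt0r pj p_ge0.
apply: (etrans (lebesgue_affine pj0 (mI j))); congr (_ * _)%E; congr (lam _).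
by apply/seteqP; split=> x /= [h1 h2]; split=> //; exact/(icons_Itv _ pj0).
Qed.

Definition letter (x : measurableTypeR R) : nat := xget 0%N [set j | Itv j x].
Definition ishift (x : measurableTypeR R) : measurableTypeR R :=
  (x - cumul (letter x)) / p (letter x).
Fixpoint iword n x : seq nat := if n is m.+1 then letter x :: iword m (ishift x) else [::].

Lemma letterE j x : Itv j x -> letter x = j.
Proof.
move=> xj; have /(xgetPex 0%N) : exists j, [set j | Itv j x] j by exists j.
by move=> /Itv_uniq; apply.
Qed.

Lemma iword_icons n j x : 0 < p j -> Om x -> iword n.+1 (icons j x) = j :: iword n x.
Proof.
move=> pj Ox; have xj : Itv j (icons j x) by apply/icons_Itv.
rewrite /= /ishift (letterE xj) /icons addrC addKr mulrC mulKf// gt_eqF//.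
Qed.

Lemma iword_take m n x : (m <= n)%N -> iword m x = take m (iword n x).
Proof. by elim: n m x => [|n IH] [|m] x //=; rewrite ltnS => /IH ->. Qed.

Lemma iword_law n (E : set (seq nat)) :
  measurable (Om `&` [set x | E (iword n x)]) /\
  lam (Om `&` [set x | E (iword n x)]) = wprob p n E.
Proof.
elim: n E => [|n IH] E.
  rewrite /wprob /= indicE; have [E0|E0] := pselect (E [::]).
    rewrite mem_set// (_ : _ `&` _ = Om); last by apply/seteqP; split=> x // [].
    split; first exact: measurable_Om.
    by rewrite lebesgue_measure_itv /= lte_fin ltr01 oppr0 addr0.
  rewrite memNset// (_ : _ `&` _ = set0); last by apply/seteqP; split=> x // [].
  by split; [exact: measurable0|rewrite measure0].
have mA : measurable (Om `&` [set x | E (iword n.+1 x)]).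
  (* On each interval the shift is an explicit affine map, which reduces measurability to words of
     length [n]. Letters of weight 0 have empty intervals. *)
  have -> : Om `&` [set x | E (iword n.+1 x)] =
    \bigcup_j (Itv j `&` [set x | 0 < p j] `&` (fun x : measurableTypeR R => ((x - cumul j) / p j : measurableTypeR R)) @^-1`
       (Om `&` [set x | E (j :: iword n x)])).
    apply/seteqP; split=> [x [Ox Ex]|x [j _ [[xj pj] [h1 h2]]]].
      have : (\bigcup_j Itv j) x by rewrite -Itv_cover.
      move=> [j _ xj]; exists j => //.
      have pj : 0 < p j.
        by move: xj => /ItvP/andP[h1 h2]; have := le_lt_trans h1 h2; rewrite cumulS ltrDl.
      split; first by split.
      split; last by move: Ex; rewrite /= /ishift (letterE xj).
      move: xj => /ItvP/andP[h1 h2]; rewrite /= in_itv /=.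
      rewrite divr_ge0 ?subr_ge0//= ltr_pdivrMr// mul1r.
      by move: h2; rewrite cumulS; lra.
    split; first by rewrite Itv_cover; exists j.
    by rewrite /= /ishift (letterE xj).
  apply: bigcupT_measurable => j; apply: measurableI.
    have [pj|pj] := pselect (0 < p j).
      rewrite (_ : [set x | 0 < p j] = setT) ?setIT; first exact: measurable_itv.
      by apply/seteqP; split.
    rewrite (_ : [set x | 0 < p j] = set0) ?setI0//.
    by apply/seteqP; split.
  rewrite -[X in measurable X]setTI.
  have mf : measurable_fun setT (fun x : measurableTypeR R => ((x - cumul j) / p j : measurableTypeR R)).
    apply: continuous_measurable_fun => x.
    apply: cvgM; last exact: cvg_cst.
    by apply: cvgB; [exact: cvg_id|exact: cvg_cst].
  by apply: mf => //; exact: (IH [set w | E (j :: w)]).1.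
split => //; rewrite (self_similar mA); last by move=> x [].
apply: eq_eseriesr => j _.
have [p0|pj] := eqVneq (p j) 0; first by rewrite p0 !mul0e.
have pj0 : 0 < p j by rewrite lt0r pj p_ge0.
congr (_ * _)%E; rewrite -[RHS]/(wprob p n [set w | E (j :: w)]) -(IH [set w | E (j :: w)]).2.
congr (lam _); apply/seteqP; split=> x [Ox] /=.
  by move=> [_ Ex]; split=> //; move: Ex; rewrite -(iword_icons n pj0 Ox).
move=> Ex; split => //; split; last by have := iword_icons n pj0 Ox; rewrite /= => ->.
suff : Om (icons j x) by [].
by rewrite Itv_cover; exists j => //; apply/icons_Itv.
Qed.

End Coding.

(** * Completeness of the projective line *)

Section Projective.
Variables (R : realType) (k : fieldType) (v : k -> R).
Hypothesis hv : complete_nonarch_abs v.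
Local Notation nrm := (vn v).

Definition clo (e : R) (x y : k * k) : Prop := v (wed x y) < e * nrm x * nrm y.

Lemma clo_sym e x y : clo e x y -> clo e y x.
Proof. by rewrite /clo mulrAC -(vN hv (wed x y)) /wed opprB ![_.2 * _]mulrC. Qed.

Lemma clo_mono e e' x y : e <= e' -> clo e x y -> clo e' x y.
Proof. by move=> ee /lt_le_trans; apply; rewrite !ler_wpM2r// vn_ge0. Qed.

(** The ultrametric inequality, from the linear relation between three vectors of the plane read in
    a coordinate where [y] attains its norm. *)
Lemma clo_trans e x y z : nz x -> nz y -> nz z -> clo e x y -> clo e y z -> clo e x z.
Proof.
move=> nx ny nz'; rewrite /clo => xy yz.
have x0 : 0 < nrm x by rewrite vn_gt0.
have y0 : 0 < nrm y by rewrite vn_gt0.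
have z0 : 0 < nrm z by rewrite vn_gt0.
have main a b c : v b = nrm y -> v a <= nrm x -> v c <= nrm z ->
    b * wed x z = a * wed y z + c * wed x y -> v (wed x z) < e * nrm x * nrm z.
  move=> vb va vc E.
  rewrite -(ltr_pM2l y0) -{1}vb -(vM hv b) E; apply: vDlt => //; rewrite (vM hv).
    apply: (@le_lt_trans _ _ (nrm x * v (wed y z))); first by rewrite ler_wpM2r// v_ge0.
    rewrite -(ltr_pM2l x0) in yz; apply: (lt_le_trans yz); rewrite le_eqVlt; apply/orP; left.
    by apply/eqP; ring.
  apply: (@le_lt_trans _ _ (nrm z * v (wed x y))); first by rewrite ler_wpM2r// v_ge0.
  rewrite -(ltr_pM2l z0) in xy; apply: (lt_le_trans xy); rewrite le_eqVlt; apply/orP; left.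
  by apply/eqP; ring.
have [h|h] : v y.1 = nrm y \/ v y.2 = nrm y.
    by rewrite /vn; case: (leP (v y.1) (v y.2)); [right|left].
  apply: (main x.1 y.1 z.1 h); rewrite ?v1_le_vn//; by rewrite /wed; ring.
apply: (main x.2 y.2 z.2 h); rewrite ?v2_le_vn//; by rewrite /wed; ring.
Qed.

Lemma clo_mv e (h : 'M[k]_2) x y : \det h = 1 -> 0 < e ->
  clo e x y -> clo (e * mnorm v h ^+ 2) (mv h x) (mv h y).
Proof.
move=> dh e0; rewrite /clo wed_mv dh mul1r => /lt_le_trans; apply.
have -> : e * mnorm v h ^+ 2 * nrm (mv h x) * nrm (mv h y) =
  e * (mnorm v h * nrm (mv h x)) * (mnorm v h * nrm (mv h y)) by ring.
apply: ler_pM; rewrite ?mulr_ge0 ?vn_ge0 ?(ltW e0)//; last exact: vn_mv_ge.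
by rewrite ler_pM2l// vn_mv_ge.
Qed.

(** Distance below 1 from [y 0] keeps every [y i] in the chart where the second coordinate
    dominates; there the distance is that of the quotients, and [k] is complete. *)
Lemma projective_complete_chart (y : nat -> k * k) :
  (forall i, nz (y i)) -> v (y 0%N).2 = nrm (y 0%N) ->
  (forall i, clo 1 (y 0%N) (y i)) ->
  (forall e, 0 < e -> exists I, forall i j, (I <= i)%N -> (I <= j)%N -> clo e (y i) (y j)) ->
  exists2 z, nz z & forall e, 0 < e -> exists I, forall i, (I <= i)%N -> clo e (y i) z.
Proof.
move=> ny y2 y0 cau.
have vn0 i : 0 < nrm (y i) by rewrite vn_gt0.
have yi2 i : v (y i).2 = nrm (y i).
  apply/eqP; rewrite eq_le v2_le_vn leNgt; apply/negP => lt.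
  have h1 : v (y i).1 = nrm (y i).
    by move: lt; rewrite /vn lt_max ltxx orbF => /ltW /max_idPl ->.
  have := y0 i; rewrite /clo mul1r /wed addrC vD_dom ?(vN hv) ?(vM hv) ?y2 ?h1 ?ltxx//.
  apply: (@le_lt_trans _ _ (nrm (y 0%N) * v (y i).2)).
    by rewrite ler_wpM2r ?v_ge0// v1_le_vn.
  by rewrite ltr_pM2l.
have nz2 i : (y i).2 != 0 by rewrite -(v_gt0 hv) yi2.
pose t i := (y i).1 / (y i).2.
have tE i j : v (t i - t j) * (nrm (y i) * nrm (y j)) = v (wed (y i) (y j)).
  rewrite -!yi2 -!(vM hv); congr v; rewrite /t /wed; field.
  by rewrite !nz2.
have [l Hl] : exists l, forall e : R, 0 < e -> exists N, forall n, (N <= n)%N -> v (t n - l) < e.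
  apply: (proj2 hv) => e e0; have [I HI] := cau e e0; exists I => m n Im In.
  have := HI m n Im In; rewrite /clo -tE -mulrA ltr_pM2r//.
  by rewrite mulr_gt0.
have l1 : v l <= 1.
  have [N /(_ N (leqnn N)) HN] := Hl 1 ltr01.
  rewrite -(subrK (t N) l); apply: vDle => //; first by rewrite -(vN hv) opprB ltW.
  by rewrite /t (vM hv) (vV hv) ler_pdivrMr ?yi2// mul1r v1_le_vn.
have vl : nrm (l, 1) = 1 by rewrite /vn /= (v1 hv); apply/max_idPr.
exists (l, 1); first by rewrite /nz /= oner_eq0 orbT.
move=> e e0; have [N HN] := Hl e e0; exists N => i Ni.
rewrite /clo vl mulr1.
have -> : wed (y i) (l, 1) = (t i - l) * (y i).2.
  by rewrite /wed /t /= mulrBl divfK// mulr1 [_ * l]mulrC.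
by rewrite (vM hv) yi2 ltr_pM2r// HN.
Qed.

Lemma projective_complete (y : nat -> k * k) I : (forall i, nz (y i)) ->
  (forall i, (I <= i)%N -> clo (2 ^- i.+1) (y i) (y i.+1)) ->
  exists2 z, nz z & forall e, 0 < e -> exists I, forall i, (I <= i)%N -> clo e (y i) z.
Proof.
move=> ny Hy.
have mono i j : (i <= j)%N -> (2 ^- j.+1 : R) <= 2 ^- i.+1.
  by move=> ij; rewrite lef_pV2 ?posrE ?exprn_gt0// ler_weXn2l// ler1n.
have cauJ J i n : (I <= J)%N -> (J <= i)%N -> clo (2 ^- J.+1) (y i) (y (i + n.+1)%N).
  move=> IJ Ji; elim: n => [|n IH].
    by rewrite addn1; apply: clo_mono (Hy i (leq_trans IJ Ji)); exact: mono.
  apply: clo_trans IH _ => //; rewrite [(i + n.+2)%N]addnS.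
  have Jn : (J <= i + n.+1)%N by rewrite (leq_trans Ji)// leq_addr.
  by apply: clo_mono (Hy _ (leq_trans IJ Jn)); exact: mono.
have cl0 e x : nz x -> 0 < e -> clo e x x.
  by move=> nx e0; rewrite /clo /wed mulrC subrr (v0 hv) !mulr_gt0// vn_gt0.
have e0J J : (0 : R) < 2 ^- J.+1 by rewrite invr_gt0 exprn_gt0.
have cau J i j : (I <= J)%N -> (J <= i)%N -> (J <= j)%N -> clo (2 ^- J.+1) (y i) (y j).
  move=> IJ; wlog ij : i j / (i <= j)%N => [H Ji Jj|Ji Jj].
    by have /orP[ij|ij] := leq_total i j; [exact: H|apply: clo_sym; exact: H].
  move: ij; rewrite leq_eqVlt => /orP[/eqP<-|ij]; first exact: cl0.
  by rewrite -(subnKC ij) addSnnS; exact: cauJ.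
have small (e : R) : 0 < e -> exists2 J, (I <= J)%N & (2 ^- J.+1 : R) < e.
  move=> e0; have := truncnS_gt e^-1; move: (Num.truncn e^-1) => T eT.
  exists (maxn I T); first exact: leq_maxl.
  rewrite -[e]invrK ltf_pV2 ?posrE ?invr_gt0 ?exprn_gt0//; apply: (lt_le_trans eT).
  apply: (@le_trans _ _ (2 ^+ T.+1)); first by rewrite -natrX ler_nat ltnW// ltn_expl.
  by apply: ler_weXn2l; [rewrite ler1n|rewrite ltnS leq_maxr].
(* Exchanging the coordinates reduces the other chart to the first. *)
pose swap (x : k * k) := (x.2, x.1).
have vsw x : nrm (swap x) = nrm x by rewrite /vn maxC.
have csw e a b : clo e (swap a) (swap b) <-> clo e a b.
  rewrite /clo !vsw -(vN hv); suff -> : - wed (swap a) (swap b) = wed a b by [].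
  by rewrite /wed /=; ring.
have nsw a : nz (swap a) = nz a by rewrite /nz orbC.
pose y' i := y (I + i)%N.
have y'0 i : clo 1 (y' 0%N) (y' i).
  apply: (@clo_mono (2 ^- I.+1)); last by apply: cau; rewrite // leq_addr.
  by rewrite invf_le1 ?exprn_gt0// exprn_ege1// ler1n.
have y'c e : 0 < e -> exists I, forall i j, (I <= i)%N -> (I <= j)%N -> clo e (y' i) (y' j).
  move=> e0; have [J IJ Je] := small e e0; exists J => i j Ji Jj.
  by apply: clo_mono (ltW Je) _; apply: cau => //; rewrite (leq_trans _ (leq_addl _ _)).
have [z nz' Hz] : exists2 z, nz z & forall e, 0 < e -> exists I, forall i, (I <= i)%N -> clo e (y' i) z.
  have [h|h] : v (y' 0%N).2 = nrm (y' 0%N) \/ v (y' 0%N).1 = nrm (y' 0%N).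
    by rewrite /vn; case: (leP (v (y' 0%N).1) (v (y' 0%N).2)); [left|right].
    by apply: projective_complete_chart => // i; exact: ny.
  have [||||z nz' Hz] := @projective_complete_chart (fun i => swap (y' i)).
  - by move=> i; rewrite nsw; exact: ny.
  - by rewrite vsw.
  - by move=> i; apply/csw.
  - by move=> e /y'c[J HJ]; exists J => i j Ji Jj; apply/csw; exact: HJ.
  exists (swap z); first by rewrite nsw.
  by move=> e /Hz[J HJ]; exists J => i Ji; apply/csw; exact: HJ.
exists z => // e /Hz[J HJ]; exists (I + J)%N => i Ji.
have := HJ (i - I)%N; rewrite /y' subnKC; first by apply; rewrite leq_subRL// (leq_trans _ Ji)// leq_addr.
by rewrite (leq_trans _ Ji)// leq_addr.
Qed.

(** A point killing the form of [y] is the point [y]: for a finite point, [msem_close] applies with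
    arbitrarily small [e]. *)
Lemma ptN_eq0 (xi : P1an v) y : nz y -> ptN xi (perp y) = 0 -> xi = berk_pt v (pline y).
Proof.
move=> ny; rewrite /pline; case: eqP => [y2|/eqP y2].
  rewrite berk_pt_None//; case: xi => [s|//].
  rewrite /ptN /linp /perp /= y2 mulr0 add0r; have [SC _ _ _] := A1an_seminorm s.
  by rewrite SC => /eqP; rewrite (v_eq0 hv) oppr_eq0; move: ny; rewrite /nz y2 eqxx orbF => /negPf ->.
case: xi => [s|] /=; last by move=> /eqP; rewrite (v_eq0 hv) (negPf y2).
have [SC S0 SM SD] := A1an_seminorm s.
have [t -> Ht] := berk_pt_Some hv (y.1 / y.2).
have -> : linp (perp y) = y.2%:P * ('X - (y.1 / y.2)%:P).
  rewrite /linp /perp /= mulrBr -polyCM mulrCA divff// mulr1 polyCN; ring.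
rewrite SM SC => /eqP; rewrite mulf_eq0 (v_eq0 hv) (negPf y2) /= => /eqP sz.
congr Some; apply: A1an_eq => f; rewrite Ht; apply/eqP; rewrite -subr_eq0 -normr_eq0.
rewrite eq_le normr_ge0 andbT; apply/ler_addgt0Pl => e e0; rewrite addr0.
have [d d0 Hd] := msem_close hv f (v_ge0 hv (y.1 / y.2)) e0.
rewrite -[v _]SC; apply: (le_trans (msem_sub hv _ _ (A1an_seminorm s))).
by apply/ltW/Hd => //; rewrite sz.
Qed.

(** Both points kill the form vanishing at [mv h y]. *)
Lemma act_berk (h : 'M[k]_2) y : \det h = 1 -> nz y ->
  act h (berk_pt v (pline y)) = berk_pt v (pline (mv h y)).
Proof.
move=> dh ny; apply: ptN_eq0; first exact: nz_mv.
have [c c0 ->] := ptN_act hv dh (berk_pt v (pline y)).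
have [c' c'0 H] := ptN_berk hv ny.
rewrite /pull H perp_vm// mvV// /ptnorm /dot /perp /= mulNr [y.2 * _]mulrC subrr (v0 hv).
by rewrite !mulr0.
Qed.

End Projective.

Section UnitMass.
Context d (T : measurableType d) (R : realType) (mu : {measure set T -> \bar R}).
Hypothesis mu1 : mu setT = 1%E.

(** The body mentions [mu1] so that the proof of total mass 1 becomes an argument on which the
    probability instance can depend. *)
Definition unit_mass := let _ := mu1 in (mu : set T -> \bar R).
HB.instance Definition _ := Measure.copy unit_mass mu.
HB.instance Definition _ := Measure_isProbability.Build _ _ _ unit_mass mu1.

End UnitMass.

Lemma eq_measure_ae (d : measure_display) (T : measurableType d) (R : realType)
  (mu : {measure set T -> \bar R}) (A B M : set T) :
  measurable A -> measurable B -> measurable M -> mu M = 0%E ->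
  A `\` M `<=` B -> B `\` M `<=` A -> mu A = mu B.
Proof.
move=> mA mB mM M0 AB BA.
have le (C D : set T) : measurable C -> measurable D -> C `\` M `<=` D -> (mu C <= mu D)%E.
  move=> mC mD CD; apply: (@le_trans _ _ (mu (D `|` M))).
    apply: le_measure; rewrite ?inE//; first exact: measurableU.
    by move=> x Cx; have [|nM] := pselect (M x); [right|left; exact: CD].
  have h : (mu (D `|` M) <= mu D + mu M)%E by exact: measureU2.
  by rewrite M0 adde0 in h.
by apply/eqP; rewrite eq_le !le.
Qed.

(** * The limit of the walk and its law *)

Section Existence.
Variables (R : realType) (k : fieldType) (v : k -> R).
Hypothesis hv : complete_nonarch_abs v.
Variables (p : nat -> R) (g : nat -> 'M[k]_2).
Hypothesis p_ge0 : forall j, 0 <= p j.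
Hypothesis p_sum1 : (\esum_(j in [set: nat]) (p j)%:E)%E = 1%E.
Hypothesis hSL : forall j, \det (g j) = 1.
Hypothesis hne : non_elementary v (gen_group [set g j | j in [set j | 0 < p j]]).
Local Notation P1an := (P1an v).
Local Notation P1anB := (P1anB v).
Local Notation gam := (gam g).
Local Notation det_gam := (det_gam hSL).
Local Notation lam := (@lebesgue_measure R).
Local Notation Om := (`[0, 1[%classic : set (measurableTypeR R)).
Local Notation iword := (iword p).

Definition wpt (w : seq nat) : k * k := mv (gam w) (1, 0).

Lemma nz_wpt w : nz (wpt w).
Proof. by apply: nz_mv; rewrite ?det_gam// /nz /= oner_eq0. Qed.

Definition unsettled (e : R) (N : nat) : set (seq nat) :=
  [set w | ~ clo v e (wpt w) (attv hv (gam (take N w)))].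

(** A prefix of large norm sends every point not near its repelling direction close to its [attv].
    The length [N] of the prefix is independent of [n], so the positions at all later times are
    close to the same direction. *)
Lemma unsettled_unlikely (e eta : R) : 0 < e -> 0 < eta -> exists N n0, (N <= n0)%N /\
  forall n, (n0 <= n)%N -> (wprob p n (unsettled e N) <= eta%:E)%E.
Proof.
move=> e0 eta0; have eta20 : 0 < eta / 2 by rewrite divr_gt0.
have [d d0 [n1 H1]] := point_near_unlikely hv p_ge0 p_sum1 hSL hne eta20.
(* Norms above both 1 and [1 / (e d)] satisfy [1 < e * d * |g| ^ 2], as [near_contract] requires. *)
have [N HN] := norm_grows hv p_ge0 p_sum1 hSL hne (Num.max 1 (e * d)^-1) eta20.
exists N, (N + n1)%N; split; first exact: leq_addr.
move=> n nn; have -> : n = (N + (n - N))%N by rewrite subnKC// (leq_trans _ nn)// leq_addr.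
have n1n : (n1 <= n - N)%N by rewrite leq_subRL// (leq_trans _ nn)// leq_addr.
pose A := [set w | Num.max 1 (e * d)^-1 < mnorm v (gam w)].
apply: (@le_trans _ _ ((eta / 2)%:E + wprob p N (~` A))%E); last first.
  rewrite [X in (_ <= X%:E)%E](splitr eta) EFinD; apply: leeD => //.
  apply: le_trans (HN N (leqnn N)); apply: le_wprob => // w _ /=.
  by move=> /negP; rewrite -leNgt.
apply: wprob_cat_le => //; first exact: ltW.
move=> w sw Aw; pose r := repv hv (gam w).
have nr : nz (- r.2, r.1).
  have : nz r by rewrite -(vn_gt0 hv) vn_repv ?det_gam.
  by rewrite /nz /= oppr_eq0 orbC.
have e1 : nz (1 : k, 0 : k) by rewrite /nz /= oner_eq0.
apply: le_trans (H1 (n - N)%N (1, 0) (- r.2, r.1) n1n e1 nr).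
apply: le_wprob => // w' _ /=; rewrite /unsettled /= -sw take_size_cat//.
apply: contra_notP => nclo.
have x0 : nz (mv (gam w') (1, 0)) by exact: nz_wpt.
have vr : vn v (- r.2, r.1) = 1.
  have : vn v r = 1 by rewrite vn_repv ?det_gam.
  by rewrite /vn /= (vN hv) maxC.
have wr : wed (mv (gam w') (1, 0)) (- r.2, r.1) = dot r (mv (gam w') (1, 0)).
  by rewrite /wed /dot /=; ring.
rewrite vr mulr1 wr in nclo.
have := @near_contract _ _ v hv (ptnorm v (mv (gam w') (1, 0))) (gam w) d (det_gam w)
  (seminorm2_ptnorm hv x0) d0.
rewrite nn_ptnorm// /ptnorm => /(_ nclo e); rewrite -/(ptnorm v _) pull_ptnorm near_ptnorm//.
rewrite /clo /wpt gam_cat mvM; apply.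
move: Aw; rewrite /A /= gt_max => /andP[h1 h2].
have ed : 0 < e * d by rewrite mulr_gt0.
rewrite expr2 mulrA -[ltLHS]mulr1; apply: ltr_pM => //.
by rewrite -ltr_pdivrMl// mulr1.
Qed.

Lemma settling_times : exists m N : nat -> nat,
  [/\ forall i, (N i <= m i)%N, forall i, (m i <= m i.+1)%N &
      forall i n, (m i <= n)%N -> (wprob p n (unsettled (2 ^- i.+1) (N i)) <= (2 ^- i.+1)%:E)%E].
Proof.
have H i : exists Nn : nat * nat, (Nn.1 <= Nn.2)%N /\ forall n, (Nn.2 <= n)%N ->
    (wprob p n (unsettled (2 ^- i.+1) Nn.1) <= (2 ^- i.+1)%:E)%E.
  have e0 : (0 : R) < 2 ^- i.+1 by rewrite invr_gt0 exprn_gt0.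
  by have [N [n0 HN]] := unsettled_unlikely e0 e0; exists (N, n0).
have [f Hf] := choice H.
(* Partial sums make the times nondecreasing while dominating each threshold. *)
pose m i := (\sum_(j < i.+1) (f j).2)%N.
have fm i : ((f i).2 <= m i)%N by rewrite /m big_ord_recr leq_addl.
exists m, (fun i => (f i).1); split=> [i|i|i n mn].
- exact: leq_trans (Hf i).1 (fm i).
- by rewrite /m [leqRHS]big_ord_recr leq_addr.
- exact: (Hf i).2 _ (leq_trans (fm i) mn).
Qed.

Section LimitPoint.
Variables m N : nat -> nat.
Hypothesis Nm : forall i, (N i <= m i)%N.
Hypothesis mS : forall i, (m i <= m i.+1)%N.
Hypothesis settled : forall i n, (m i <= n)%N ->
  (wprob p n (unsettled (2 ^- i.+1) (N i)) <= (2 ^- i.+1)%:E)%E.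

Let X n (x : measurableTypeR R) : k * k := wpt (iword n x).
Let ev n (E : set (seq nat)) : set (measurableTypeR R) := Om `&` [set x | E (iword n x)].
Let U i := unsettled (2 ^- i.+1) (N i).
(* The length [(m i).+1] is there for equivariance: prepending a letter to a word of length [m i]
   leaves the sequence [m]. *)
Definition bad i : set (measurableTypeR R) := ev (m i) (U i) `|` ev (m i).+1 (U i) `|` ev (m i.+1) (U i).
Let mev n E : measurable (ev n E) := (iword_law p_ge0 p_sum1 n E).1.

Lemma measurable_bad i : measurable (bad i).
Proof. by apply: measurableU => //; apply: measurableU. Qed.

Lemma measurable_limsup_bad : measurable (lim_sup_set bad).
Proof.
apply: bigcapT_measurable => n; apply: bigcup_measurable => j _; exact: measurable_bad.
Qed.

(** Borel-Cantelli: [bad i] is a union of three events of probability at most [2 ^- i.+1]. *)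
Lemma limsup_bad0 : lam (lim_sup_set bad) = 0%E.
Proof.
apply: lim_sup_set_cvg0; first exact: measurable_bad.
apply: (@le_lt_trans _ _ 3%:E); last by rewrite ltry.
apply: le_trans (@epsilon_trick0 R 3 xpredT _) => //.
apply: lee_nneseries => [i _ _|i _]; first exact: measure_ge0.
have le n : (m i <= n)%N -> (lam (ev n (U i)) <= (2 ^- i.+1)%:E)%E.
  by move=> mn; rewrite /ev (iword_law p_ge0 p_sum1 n _).2; exact: settled.
have -> : ((3 : R) / (2 ^ i.+1)%:R)%:E = ((2 ^- i.+1)%:E + (2 ^- i.+1)%:E + (2 ^- i.+1)%:E)%E.
  by rewrite -!EFinD natrX; congr EFin; ring.
apply: (le_trans (measureU2 _ _ _)) => //; first exact: measurableU.
apply: leeD; last exact: le.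
apply: (le_trans (measureU2 _ _ _)) => //.
by apply: leeD; exact: le.
Qed.

Let G : set (measurableTypeR R) := Om `\` lim_sup_set bad.
Definition limpt (x : measurableTypeR R) (z : k * k) : Prop := nz z /\
  forall e, 0 < e -> exists I, forall i, (I <= i)%N -> clo v e (X (m i) x) z /\ clo v e (X (m i).+1 x) z.

(** Off the limsup, the positions at times [m i], [(m i).+1] and [m i.+1] are eventually all close
    to the [attv] of one prefix, hence to each other, and completeness applies. *)
Lemma limpt_exists x : G x -> exists z, limpt x z.
Proof.
move=> [Ox]; rewrite /lim_sup_set /bigcap /= => /existsNP[I /not_implyP[_ HI]].
have settl i n : (I <= i)%N -> (m i <= n)%N -> ~ ev n (U i) x ->
    clo v (2 ^- i.+1) (X n x) (attv hv (gam (iword (N i) x))).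
  move=> Ii mn nU; apply: contrapT => nc; apply: nU; split => //=.
  by rewrite /U /unsettled /= -iword_take// (leq_trans (Nm i)).
have nb i : (I <= i)%N -> ~ bad i x by move=> Ii bi; apply: HI; exists i.
have good i : (I <= i)%N -> [/\ ~ ev (m i) (U i) x, ~ ev (m i).+1 (U i) x & ~ ev (m i.+1) (U i) x].
  by move=> /nb Nb; split=> h; apply: Nb; [left; left|left; right|right].
have na w : nz (attv hv (gam w)) by rewrite -(vn_gt0 hv) vn_attv ?det_gam.
have c1 i : (I <= i)%N -> clo v (2 ^- i.+1) (X (m i) x) (X (m i.+1) x).
  move=> Ii; have [h1 _ h3] := good i Ii.
  apply: (clo_trans hv _ (na (iword (N i) x))); rewrite ?nz_wpt//; first exact: settl.
  by apply: (clo_sym hv); apply: settl.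
have c2 i : (I <= i)%N -> clo v (2 ^- i.+1) (X (m i).+1 x) (X (m i) x).
  move=> Ii; have [h1 h2 _] := good i Ii.
  apply: (clo_trans hv _ (na (iword (N i) x))); rewrite ?nz_wpt//; first exact: settl.
  by apply: (clo_sym hv); apply: settl.
have [z nz' Hz] := @projective_complete _ _ v hv (fun i => X (m i) x) I (fun i => nz_wpt _) c1.
exists z; split => // e e0.
have [J HJ] := Hz e e0.
have := truncnS_gt e^-1; move: (Num.truncn e^-1) => T eT.
exists (maxn (maxn I J) T) => i; rewrite !geq_max -andbA => /and3P[Ii Ji Ti].
split; first exact: HJ.
apply: (clo_trans hv _ (nz_wpt (iword (m i) x))); rewrite ?nz_wpt//; last exact: HJ.
apply: clo_mono (c2 i Ii) => //.
rewrite -[e]invrK lef_pV2 ?posrE ?invr_gt0 ?exprn_gt0//; apply: (le_trans (ltW eT)).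
apply: (@le_trans _ _ (2 ^+ T.+1)); first by rewrite -natrX ler_nat ltnW// ltn_expl.
by apply: ler_weXn2l; [rewrite ler1n|rewrite ltnS].
Qed.

Lemma clo_eq (y : nat -> k * k) z z' : (forall i, nz (y i)) -> nz z -> nz z' ->
  (forall e, 0 < e -> exists I, forall i, (I <= i)%N -> clo v e (y i) z) ->
  (forall e, 0 < e -> exists I, forall i, (I <= i)%N -> clo v e (y i) z') -> pline z = pline z'.
Proof.
move=> ny nz1 nz2 H1 H2; apply/pline_eqP => //; apply/eqP; rewrite -(v_eq0 hv).
rewrite eq_le v_ge0// andbT; apply/ler_addgt0Pl => e e0; rewrite addr0.
have d0 : 0 < e / (vn v z * vn v z') by rewrite divr_gt0// mulr_gt0// vn_gt0.
have [I HI] := H1 _ d0; have [J HJ] := H2 _ d0.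
have c := clo_trans hv nz1 (ny (I + J)%N) nz2
  (clo_sym hv (HI _ (leq_addr _ _))) (HJ _ (leq_addl _ _)).
by move/ltW: c; rewrite -mulrA divfK// mulf_neq0// gt_eqF// vn_gt0.
Qed.

(** Off [G], that is outside [[0, 1[] or on a null set, the value is the default infinity. *)
Definition bnd (x : measurableTypeR R) : P1anB :=
  xget (None : P1an) [set xi | G x /\ exists2 z, limpt x z & xi = berk_pt v (pline z)].

Lemma bnd_berk x z : G x -> limpt x z -> bnd x = berk_pt v (pline z).
Proof.
move=> Gx xz; rewrite /bnd.
have /(xgetPex None) : exists xi, [set xi | G x /\ exists2 z, limpt x z & xi = berk_pt v (pline z)] xi.
  by exists (berk_pt v (pline z)); split => //; exists z.
move=> [_ [z' xz' ->]]; congr (berk_pt v _).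
have [nz1 H1] := xz'; have [nz2 H2] := xz.
apply: (@clo_eq (fun i => X (m i) x)) => // [i|e /H1[I HI]|e /H2[I HI]]; first exact: nz_wpt.
  by exists I => i /HI[].
by exists I => i /HI[].
Qed.

Lemma bnd_out x : ~ G x -> bnd x = None.
Proof. by move=> nG; apply: xgetPN => xi [Gx _]. Qed.

(** The walk coded by [icons j x] at time [m i + 1] is [g j] applied to the walk coded by [x] at
    time [m i]; take limits on both sides. *)
Lemma bnd_equivariant j x : 0 < p j -> G x -> G (icons p j x) ->
  bnd (icons p j x) = act (g j) (bnd x : P1an).
Proof.
move=> pj Gx Gjx; have [z [nz1 Hz]] := limpt_exists Gx; have [z' [nz2 Hz']] := limpt_exists Gjx.
rewrite (bnd_berk Gx (conj nz1 Hz)) (bnd_berk Gjx (conj nz2 Hz')) act_berk//.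
have Ox : Om x by case: Gx.
have XE i : X (m i).+1 (icons p j x) = mv (g j) (X (m i) x).
  by rewrite /X iword_icons// /wpt gam_cons mvM.
congr (berk_pt v _); apply: (@clo_eq (fun i => X (m i).+1 (icons p j x))) => //.
- by move=> i; exact: nz_wpt.
- exact: nz_mv.
- by move=> e /Hz'[I HI]; exists I => i /HI[].
move=> e e0; have g0 : 0 < mnorm v (g j) ^+ 2 by rewrite exprn_gt0// mnorm_gt0.
have d0 : 0 < e / mnorm v (g j) ^+ 2 by rewrite divr_gt0.
have [I HI] := Hz _ d0; exists I => i /HI[c _]; rewrite XE.
by have := clo_mv hv (hSL j) d0 c; rewrite divfK// gt_eqF.
Qed.

Lemma measurable_G : measurable G.
Proof. by apply: measurableD; [exact: measurable_Om|exact: measurable_limsup_bad]. Qed.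

Lemma measurable_bnd : measurable_fun setT bnd.
Proof.
apply: (@measurability _ _ _ P1anB setT bnd (@open P1an) erefl).
move=> _ [V oV <-]; rewrite setTI.
(* [E q] contains the words whose position has a ball of radius [1 / (q + 1)] mapped into [V]. The
   limit lies in the open set [V] exactly when, for some [q], this holds at all large times [m i], a
   countable condition on finite words. *)
pose E q : set (seq nat) := [set w | forall y, nz y -> clo v q.+1%:R^-1 (wpt w) y -> V (berk_pt v (pline y))].
have inG : G `&` bnd @^-1` V = G `&` \bigcup_q \bigcup_I \bigcap_(i in [set i | (I <= i)%N]) ev (m i) (E q).
  apply/seteqP; split=> x [Gx].
    have [z xz] := limpt_exists Gx; have [nz1 Hz] := xz.
    rewrite /= (bnd_berk Gx xz) => Vz; split => //.
    have [d d0 Hd] := berk_nbhs hv nz1 (open_nbhs_nbhs (conj oV Vz)).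
    have := truncnS_gt d^-1; move: (Num.truncn d^-1) => q dq.
    have q0 : (0 : R) < q.+1%:R^-1 by rewrite invr_gt0 ltr0n.
    have [I HI] := Hz _ q0; exists q => //; exists I => // i /= Ii.
    split; first by case: Gx.
    move=> y ny yc; apply: Hd; rewrite near_berk//.
    have [c _] := HI i Ii.
    have := clo_trans hv ny (nz_wpt _) nz1 (clo_sym hv yc) c.
    apply: clo_mono => //; rewrite -[leRHS]invrK lef_pV2 ?posrE ?invr_gt0 ?ltr0n//; exact: ltW.
  move=> [q _ [I _ HI]]; split => //.
  have [z xz] := limpt_exists Gx; have [nz1 Hz] := xz.
  rewrite /= (bnd_berk Gx xz).
  have q0 : (0 : R) < q.+1%:R^-1 by rewrite invr_gt0 ltr0n.
  have [J HJ] := Hz _ q0.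
  have [_ /(_ z nz1)] := HI (maxn I J) (leq_maxl _ _); apply.
  by have [] := HJ (maxn I J) (leq_maxr _ _).
have minG : measurable (G `&` bnd @^-1` V).
  rewrite inG; apply: measurableI; first exact: measurable_G.
  apply: bigcupT_measurable => q; apply: bigcupT_measurable => I.
  by apply: bigcap_measurable => [|i _]; [exists I => /=|exact: mev].
have [V0|V0] := pselect (V None).
  have -> : bnd @^-1` V = (G `&` bnd @^-1` V) `|` ~` G.
    apply/seteqP; split=> [x Vx|x [[]//|nG]]; last by rewrite /= bnd_out.
    by have [Gx|nG] := pselect (G x); [left|right].
  by apply: measurableU => //; exact: measurableC measurable_G.
have -> : bnd @^-1` V = G `&` bnd @^-1` V; last by [].
apply/seteqP; split=> [x Vx|x []//]; split => //.
by apply: contrapT => nG; apply: V0; rewrite -(bnd_out nG).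
Qed.

Lemma stationary_of_limit : exists nu : probability P1anB R, stationary v p g nu.
Proof.
have mO := @measurable_Om R.
pose lamO : {measure set (measurableTypeR R) -> \bar R} := mrestr lam mO.
pose nu0 : {measure set P1anB -> \bar R} :=
  measure_function_pushforward__canonical__measure_function_Measure lamO measurable_bnd.
have nu01 : nu0 setT = 1%E.
  rewrite /nu0 /= /pushforward /lamO /= /mrestr preimage_setT setTI lebesgue_measure_itv /=.
  by rewrite lte_fin ltr01 oppr0 addr0.
pose nu : probability P1anB R := unit_mass nu01.
exists nu => A mA.
have nuE B : nu B = lam (bnd @^-1` B `&` Om) by [].
rewrite nuE -nneseries_esumT; last first.
  by move=> j; rewrite mule_ge0 ?lee_fin.
have mZ B : measurable B -> measurable (bnd @^-1` B `&` Om).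
  by move=> mB; apply: measurableI => //; rewrite -[X in measurable X]setTI; exact: measurable_bnd.
have ZO B : bnd @^-1` B `&` Om `<=` Om by move=> x [].
rewrite (self_similar p_ge0 p_sum1 (mZ A mA) (ZO A)).
apply: eq_eseriesr => j _.
have [p0|pj] := eqVneq (p j) 0; first by rewrite p0 !mul0e.
have pj0 : 0 < p j by rewrite lt0r pj p_ge0.
congr (_ * _)%E; rewrite nuE.
have mact : measurable (act (g j) @^-1` A : set P1anB).
  by rewrite -[X in measurable X]setTI; apply: (measurable_act hv (hSL j)).
pose L := lim_sup_set bad.
have LO : L `<=` Om.
  by move=> x /(_ 0%N I)[i _ [[|]|]] [].
have mic B : measurable B -> measurable (icons p j @^-1` B).
  by move=> mB; rewrite -[X in measurable X]setTI; exact: measurable_icons.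
have mOi B : measurable B -> measurable (Om `&` icons p j @^-1` B).
  by move=> mB; apply: measurableI => //; exact: mic.
(* A term of positive weight in a vanishing sum of nonnegative terms: by [self_similar] the preimage
   of the null set [L] is null. *)
have L1 : lam (Om `&` icons p j @^-1` L) = 0%E.
  have := self_similar p_ge0 p_sum1 measurable_limsup_bad LO; rewrite limsup_bad0 => /esym S0.
  apply/eqP; rewrite -measure_le0.
  pose u i := ((p i)%:E * lam (Om `&` icons p i @^-1` L))%E.
  have u0 i : (0 <= u i)%E by rewrite mule_ge0 ?lee_fin.
  have : (u j <= \sum_(0 <= i <oo) u i)%E.
    have := @nneseries_lim_ge _ u xpredT 0 j.+1 (fun i _ _ => u0 i).
    by apply: le_trans; rewrite big_nat_recr//= leeDr// sume_ge0.
  rewrite /u S0.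
  by rewrite pmule_rle0.
have mL := measurable_limsup_bad.
apply: (@eq_measure_ae _ _ _ lam _ _ (L `|` (Om `&` icons p j @^-1` L))).
- exact: (mOi _ (mZ _ mA)).
- exact: mZ.
- by apply: measurableU => //; exact: mOi.
- have h : (lam (L `|` (Om `&` icons p j @^-1` L)) <= lam L + lam (Om `&` icons p j @^-1` L))%E.
    exact: (measureU2 _ mL (mOi _ mL)).
  by apply/eqP; rewrite -measure_le0; rewrite /L limsup_bad0 L1 adde0 in h.
- move=> x [[Ox [Zx Ojx]] /not_orP[nL nLj]]; split => //.
  have Gx : G x by split.
  have Gj : G (icons p j x) by split => // h; exact: nLj.
  by rewrite /= -bnd_equivariant.
- move=> x [[Zx Ox] /not_orP[nL nLj]]; split => //.
  have Oj : Om (icons p j x).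
    by rewrite (Itv_cover p_ge0 p_sum1); exists j => //; apply/icons_Itv.
  have Gx : G x by split.
  have Gj : G (icons p j x) by split => // h; exact: nLj.
  by split => //; rewrite /= bnd_equivariant.
Qed.

End LimitPoint.

Lemma stationary_exists : exists nu : probability P1anB R, stationary v p g nu.
Proof. by have [m [N [h1 h2 h3]]] := settling_times; exact: stationary_of_limit h1 h2 h3. Qed.

End Existence.

(** * Laws of the attracting and repelling fixed points *)

Section PushForward.
Variables (R : realType) (k : fieldType) (v : k -> R).
Hypothesis hv : complete_nonarch_abs v.
Variables (p : nat -> R).
Hypothesis p_ge0 : forall j, 0 <= p j.

Lemma push_intE (g : nat -> 'M[k]_2) n (phi : 'M[k]_2 -> P1an v) (f : P1an v -> R) :
  push_int v p g n phi f =
  (wexp p n (fun w => (\1_[set w | hyperbolic v (gam g w)] w * Num.max (f (phi (gam g w))) 0)%:E) -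
   wexp p n (fun w => (\1_[set w | hyperbolic v (gam g w)] w * Num.max (- f (phi (gam g w))) 0)%:E))%E.
Proof.
rewrite /push_int; congr (_ - _)%E.
  by apply: (esum_wexp g p_ge0 n (hyperbolic v) (F := fun h => Num.max (f (phi h)) 0)) => h; rewrite le_max lexx orbT.
by apply: (esum_wexp g p_ge0 n (hyperbolic v) (F := fun h => Num.max (- f (phi h)) 0)) => h; rewrite le_max lexx orbT.
Qed.

Variable g : nat -> 'M[k]_2.
Hypothesis p_sum1 : (\esum_(j in [set: nat]) (p j)%:E)%E = 1%E.
Hypothesis hSL : forall j, \det (g j) = 1.

(** The repelling point of [r_n] is the attracting point of [r_n^-1], which is the inverse walk
    along the reversed word; reversal preserves the law, and inversion preserves the trace. *)
Lemma push_int_rep n (f : P1an v -> R) :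
  push_int v p g n (fun h => berk_pt v (rep v h)) f =
  push_int v p (fun j => invmx (g j)) n (fun h => berk_pt v (att v h)) f.
Proof.
have rev_eq (F : 'M[k]_2 -> R) : (forall h, 0 <= F h) ->
  wexp p n (fun w => (\1_[set w | hyperbolic v (gam g w)] w * F (invmx (gam g w)))%:E) =
  wexp p n (fun w => (\1_[set w | hyperbolic v (gam (fun j => invmx (g j)) w)] w *
                      F (gam (fun j => invmx (g j)) w))%:E).
  move=> F0; rewrite -wexp_rev//; last by move=> w; rewrite lee_fin mulr_ge0.
  apply: eq_wexp => w _; rewrite -(gam_inv_rev hSL) !indicE.
  suff -> : (rev w \in [set w | hyperbolic v (gam g w)]) =
    (w \in [set w | hyperbolic v (gam (fun j => invmx (g j)) w)]) by [].
  apply/idP/idP; rewrite !inE /= /hyperbolic -(gam_inv_rev hSL) (tr_invmx2 (det_gam hSL _)) //.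
rewrite !push_intE; congr (_ - _)%E.
  rewrite -(rev_eq (fun h => Num.max (f (berk_pt v (att v h))) 0)); last by move=> h; rewrite le_max lexx orbT.
  by apply: eq_wexp => w _; rewrite repE// det_gam.
rewrite -(rev_eq (fun h => Num.max (- f (berk_pt v (att v h))) 0)); last by move=> h; rewrite le_max lexx orbT.
by apply: eq_wexp => w _; rewrite repE// det_gam.
Qed.

Hypothesis hne : non_elementary v (gen_group [set g j | j in [set j | 0 < p j]]).

Lemma hyperbolic_likely : Prob p g n (hyperbolic v) @[n --> \oo] --> 1%E.
Proof.
under eq_cvg do rewrite ProbE//.
apply: (wprob_cvg1 p_ge0 p_sum1 (A := fun n => [set w | hyperbolic v (gam g w)])).
move=> e e0; have e20 : 0 < e / 2 by rewrite divr_gt0.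
have [d d0 [n1 H1]] := transversal hv p_ge0 p_sum1 hSL hne e20.
have [n2 H2] := norm_grows hv p_ge0 p_sum1 hSL hne d^-1 e20.
exists (maxn n1 n2) => n; rewrite geq_max => /andP[n1n n2n].
have := leeD (H1 n n1n) (H2 n n2n); rewrite -EFinD -splitr.
apply: le_trans; apply: le_trans (wprobU p_ge0 _ _ _).
apply: le_wprob => // w _ /= nhyp.
have [tv|tv] := ltP (v (dot (repv hv (gam g w)) (attv hv (gam g w)))) d; first by left.
have [ns|ns] := leP (mnorm v (gam g w)) d^-1; first by right.
by case: nhyp; exact: (tr_dominant (det_gam hSL w) d0 ns tv).2.
Qed.

(** Positive and negative parts of [f] are continuous and nonnegative; both limits are finite, so
    the difference of the limits is well defined. *)
Lemma push_int_att_cvg (nu : probability (P1anB v) R) (f : P1an v -> R) : stationary v p g nu ->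
  continuous (f : P1an v -> R^o) ->
  push_int v p g n (fun h => berk_pt v (att v h)) f @[n --> \oo] --> (\int[nu]_x (f x)%:E)%E.
Proof.
move=> st cf; under eq_cvg do rewrite push_intE.
have cpos (h : P1an v -> R) : continuous (h : P1an v -> R^o) ->
    continuous ((fun x => Num.max (h x) 0) : P1an v -> R^o).
  move=> ch x; apply: (@continuous_max _ _ (h : P1an v -> R^o) (fun=> 0)); first exact: ch.
  exact: cst_continuous.
have cN : continuous ((fun x => - f x) : P1an v -> R^o) by move=> x; exact: (cvgN (cf x)).
have ge0 (h : P1an v -> R) x : 0 <= Num.max (h x) 0 by rewrite le_max lexx orbT.
have [c1 f1] := push_att_cvg hv p_ge0 p_sum1 hSL hne st (cpos _ cf) (ge0 f).
have [c2 f2] := push_att_cvg hv p_ge0 p_sum1 hSL hne st (cpos _ cN) (ge0 (fun x => - f x)).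
have -> : (\int[nu]_x (f x)%:E = \int[nu]_x (Num.max (f x) 0)%:E - \int[nu]_x (Num.max (- f x) 0)%:E)%E.
  rewrite integralE; congr (_ - _)%E; apply: eq_integral => x _.
    by rewrite funeposE EFin_max.
  by rewrite funenegE EFin_max.
apply: cvgeB c1 c2.
by rewrite fin_num_adde_defr// fin_numN.
Qed.

End PushForward.

Theorem theorem3p10 (R : realType) (k : fieldType) (v : k -> R)
  (hv : complete_nonarch_abs v)
  (p : nat -> R) (g : nat -> 'M[k]_2)
  (hp0 : forall j, 0 <= p j)
  (hp1 : (\esum_(j in [set: nat]) (p j)%:E)%E = 1%E)
  (hSL : forall j, \det (g j) = 1)
  (hne : non_elementary v (gen_group [set g j | j in [set j | 0 < p j]])) :
  (Prob p g n (hyperbolic v) @[n --> \oo] --> 1%E) /\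
  (exists nu, stationary v p g nu) /\
  (exists nu, stationary v p (fun j => invmx (g j)) nu) /\
  (forall nu, stationary v p g nu ->
     forall f : P1an v -> R, continuous (f : P1an v -> R^o) ->
       push_int v p g n (fun h => berk_pt v (att v h)) f @[n --> \oo]
         --> (\int[nu]_x (f x)%:E)%E) /\
  (forall nu, stationary v p (fun j => invmx (g j)) nu ->
     forall f : P1an v -> R, continuous (f : P1an v -> R^o) ->
       push_int v p g n (fun h => berk_pt v (rep v h)) f @[n --> \oo]
         --> (\int[nu]_x (f x)%:E)%E) /\
  ((\esum_(j in [set: nat]) (p j * ln (mnorm v (g j)))%:E < +oo)%E ->
     forall eps : R, 0 < eps ->
       Prob p g n [set h | \tr h != 0 /\ `|ln (v (\tr h)) / n%:R - chi v p g| < eps]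
         @[n --> \oo] --> 1%E).
Proof.
have dinv := det_ginv hSL; have neinv := non_elementary_inv hne.
split; first exact: hyperbolic_likely.
split; first exact: stationary_exists.
split; first exact: stationary_exists.
split; first by move=> nu st f cf; exact: push_int_att_cvg.
split; last by move=> moment eps eps0; exact: trace_growth.
move=> nu st f cf; under eq_cvg do rewrite push_int_rep//.
exact: push_int_att_cvg.
Qed.
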